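(* Let $\mathcal D=(X_{\mathcal D,0},\Pi_{\mathcal D},\nabla_{\mathcal D})$ be a gradient discretisation for the obstacle problem such that $\mathcal K_{\mathcal D}\ne\emptyset$, and let $\mathcal T=(\mathcal M,\mathcal E,\mathcal P)$ be a polytopal mesh of $\Omega$. Let $\bar u\in\mathcal K$ be the solution to the weak obstacle problem $$\forall v\in\mathcal K,\quad \int_\Omega \Lambda\nabla\bar u\cdot\nabla(\bar u-v)\,dx\le\int_\Omega f(\bar u-v)\,dx,$$ and let $u\in\mathcal K_{\mathcal D}$ be the solution to the gradient scheme $$\forall v\in\mathcal K_{\mathcal D},\quad\int_\Omega\Lambda\nabla_{\mathcal D}u\cdot\nabla_{\mathcal D}(u-v)\,dx\le\int_\Omega f\,\Pi_{\mathcal D}(u-v)\,dx.$$ Assume that $g$ is constant, that $\mathrm{div}(\Lambda\nabla\bar u)\in L^2(\Omega)$, and that $\bar u\in W^{2,\infty}(\Omega)$. Assume also that there exists an interpolant $v_{\mathcal D}\in\mathcal K_{\mathcal D}$ such that $S_{\mathcal D}(\bar u,v_{\mathcal D})\le C_1h_{\mathcal M}$ and, for any $K\in\mathcal M$, $\|\Pi_{\mathcal D}v_{\mathcal D}-\bar u(x_K)\|_{L^2(K)}\le C_2h_K^2|K|^{1/2}$ (the constants $C_1,C_2$ do not depend on the cell or the mesh). Then there exists $C$ depending only on $\Omega$, $\underline\lambda$, $\overline\lambda$, $C_1$, $C_2$ and an upper bound of $C_{\mathcal D}$ such that $$\|\nabla_{\mathcal D}u-\nabla\bar u\|_{L^2(\Omega)^d}+\|\Pi_{\mathcal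 D}u-\bar u\|_{L^2(\Omega)}\le Ch_{\mathcal M}+C\,W_{\mathcal D}(\Lambda\nabla\bar u).$$
   Context: Data. $\Omega$ is an open bounded connected polytopal subset of $\mathbb R^d$, $d\ge1$, with Lipschitz boundary. $\Lambda$ is a measurable function from $\Omega$ to the $d\times d$ real matrices and there exist $\underline\lambda,\overline\lambda>0$ such that, for a.e. $x\in\Omega$, $\Lambda(x)$ is symmetric with eigenvalues in $[\underline\lambda,\overline\lambda]$. $f\in L^2(\Omega)$, $g\in L^2(\Omega)$. $\mathcal K=\{v\in H^1_0(\Omega):v\le g\text{ in }\Omega\}$, assumed non-empty (the weak problem then has a unique solution). Gradient discretisation for the obstacle problem. $\mathcal D=(X_{\mathcal D,0},\Pi_{\mathcal D},\nabla_{\mathcal D})$ where $X_{\mathcal D,0}$ is a finite dimensional real vector space (of discrete unknowns, taking into account the homogeneous Dirichlet boundary condition); $\Pi_{\mathcal D}:X_{\mathcal D,0}\to L^2(\Omega)$ and $\nabla_{\mathcal D}:X_{\mathcal D,0}\to L^2(\Omega)^d$ are linear; and $\|\nabla_{\mathcal D}\cdot\|_{L^2(\Omega)^d}$ is a norm on $X_{\mathcal D,0}$. Set $\mathcal K_{\mathcal D}=\{v\in X_{\mathcal D,0}:\Pi_{\mathcal D}v\le g\text{ in }\Omega\}$. When $\mathcal K_{\mathcal D}\neq\emptyset$ the gradient scheme has a unique solution. Indicators. $C_{\mathcal D}=\max_{v\in X_{\mathcal D,0}\setminus\{0\}}\frac{\|\Pi_{\mathcal D}v\|_{L^2(\Omega)}}{\|\nabla_{\mathcal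 D}v\|_{L^2(\Omega)^d}}$; for $(\varphi,v)\in\mathcal K\times\mathcal K_{\mathcal D}$, $S_{\mathcal D}(\varphi,v)=\|\Pi_{\mathcal D}v-\varphi\|_{L^2(\Omega)}+\|\nabla_{\mathcal D}v-\nabla\varphi\|_{L^2(\Omega)^d}$; for $\boldsymbol\psi\in H_{\rm div}(\Omega)=\{\boldsymbol\psi\in L^2(\Omega)^d:\mathrm{div}\,\boldsymbol\psi\in L^2(\Omega)\}$, $$W_{\mathcal D}(\boldsymbol\psi)=\sup_{v\in X_{\mathcal D,0}\setminus\{0\}}\frac1{\|\nabla_{\mathcal D}v\|_{L^2(\Omega)^d}}\Big|\int_\Omega(\nabla_{\mathcal D}v\cdot\boldsymbol\psi+\Pi_{\mathcal D}v\,\mathrm{div}(\boldsymbol\psi))\,dx\Big|.$$ Polytopal mesh. $\mathcal T=(\mathcal M,\mathcal E,\mathcal P)$ where: (1) $\mathcal M$ is a finite family of non-empty connected polytopal open disjoint subsets of $\Omega$ (cells) with $\overline\Omega=\cup_{K\in\mathcal M}\overline K$; $|K|>0$ is the measure and $h_K$ the diameter of $K$. (2) $\mathcal E$ is a finite family of disjoint subsets of $\overline\Omega$ (edges/faces), each a non-empty open subset of a hyperplane of $\mathbb R^d$; for each $K\in\mathcal M$ there is $\mathcal E_K\subset\mathcal E$ with $\partial K=\cup_{\sigma\in\mathcal E_K}\overline\sigma$; with $\mathcal M_\sigma=\{K\in\mathcal M:\sigma\in\mathcal E_K\}$, for every $\sigma\in\mathcal E$ either $\mathcal M_\sigma$ has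 exactly one element and $\sigma\subset\partial\Omega$, or $\mathcal M_\sigma$ has two elements and $\sigma\subset\Omega$. (3) $\mathcal P=(x_K)_{K\in\mathcal M}$ with $x_K\in K$, and each $K$ is strictly $x_K$-star-shaped: if $x\in\overline K$ then the segment $[x_K,x)$ is included in $K$. The mesh size is $h_{\mathcal M}=\sup\{h_K:K\in\mathcal M\}$.
   Formalization: The constant C is allowed to depend also on f and on the solution ū (it is uniform in Λ, g, the gradient discretisation and the mesh); independence from f as literally claimed is false, since a large f on the contact set gives a counterexample. *)

(* Defs.v *)
From HB Require Import structures.
From mathcomp Require Import all_boot all_order all_algebra.
From mathcomp Require Import all_classical all_reals all_analysis.

Set Implicit Arguments.
Unset Strict Implicit.
Unset Printing Implicit Defensive.

Import Order.TTheory GRing.Theory Num.Def Num.Theory.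
Import numFieldNormedType.Exports.

Local Open Scope classical_set_scope.
Local Open Scope ring_scope.

(* R^d is 'rV[R]_d, with the product sigma-algebra (equal to the Borel one) and
   the Lebesgue measure obtained by iterating the binary product measure. *)
Definition rV_display : measure_display. Proof. exact: default_measure_display. Qed.

Section measurable_rV.
Context {R : realType} (n : nat).

Definition rV_coord (i : 'I_n) (x : 'rV[R]_n) : R := x ord0 i.

Let rV_set0 : g_sigma_preimage rV_coord set0.
Proof. exact: sigma_algebra0. Qed.

Let rV_setC A : g_sigma_preimage rV_coord A -> g_sigma_preimage rV_coord (~` A).
Proof. exact: sigma_algebraC. Qed.

Let rV_bigcup (F : _^nat) : (forall i, g_sigma_preimage rV_coord (F i)) ->
  g_sigma_preimage rV_coord (\bigcup_i (F i)).
Proof. exact: sigma_algebra_bigcup. Qed.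

HB.instance Definition _ := @isMeasurable.Build rV_display
  'rV[R]_n (g_sigma_preimage rV_coord) rV_set0 rV_setC rV_bigcup.

End measurable_rV.

Section lebesgue_rV.
Context {R : realType}.

Lemma measurable_rV_coord n (i : 'I_n) :
  measurable_fun [set: 'rV[R]_n] (@rV_coord R n i).
Proof.
move=> _ Y mY; rewrite setTI; apply: sub_sigma_algebra => /=.
rewrite -bigcup_seq/=; exists i => /=; first by rewrite mem_index_enum.
by exists Y => //; rewrite setTI.
Qed.

Lemma measurable_fun_rVP d (T : measurableType d) n (f : T -> 'rV[R]_n) :
  (forall i, measurable_fun [set: T] (rV_coord i \o f)) ->
  measurable_fun [set: T] f.
Proof.
move=> mf; apply: (@measurability _ _ T 'rV[R]_n setT f
  (\big[setU/set0]_(i < n) preimage_set_system setT (@rV_coord R n i) measurable)) => //.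
move=> _ [B + <-]; rewrite -bigcup_seq/= => -[i _ [A mA <-]].
by rewrite [X in _ `&` (_ @^-1` X)]setTI -comp_preimage; exact: mf.
Qed.

Definition rV_cons n (p : measurableTypeR R * 'rV[R]_n) : 'rV[R]_n.+1 :=
  row_mx (p.1)%:M p.2.

Definition rV_uncons n (x : 'rV[R]_n.+1) : measurableTypeR R * 'rV[R]_n :=
  (x ord0 ord0, rsubmx (x : 'rV[R]_(1 + n))).

Lemma rV_consK n : cancel (@rV_cons n) (@rV_uncons n).
Proof.
case=> a v; rewrite /rV_uncons /rV_cons row_mxKr; congr (_, _) => /=.
have -> : (ord0 : 'I_n.+1) = lshift n (ord0 : 'I_1) by exact/val_inj.
by rewrite (@row_mxEl _ 1 1 n) mxE eqxx.
Qed.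

Lemma measurable_rV_cons n : measurable_fun setT (@rV_cons n).
Proof.
apply: measurable_fun_rVP => i.
rewrite -[i](@splitK 1 n); case: (@fintype.split 1 n i) => j /=.
  rewrite (_ : _ \o _ = fst); first exact: measurable_fst.
  by apply/funext => -[a v]; rewrite /rV_coord /rV_cons/= (@row_mxEl _ 1 1 n) mxE [j]ord1 eqxx.
rewrite (_ : _ \o _ = rV_coord j \o snd).
  exact: measurableT_comp (measurable_rV_coord j) measurable_snd.
by apply/funext => -[a v]; rewrite /rV_coord /rV_cons/= (@row_mxEr _ 1 1 n).
Qed.

HB.instance Definition _ n :=
  isMeasurableFun.Build _ _ _ _ (@rV_cons n) (@measurable_rV_cons n).

Lemma measurable_rV_uncons n : measurable_fun setT (@rV_uncons n).
Proof.
apply: measurable_fun_pair; first exact: (@measurable_rV_coord n.+1 ord0).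
apply: measurable_fun_rVP => i.
rewrite (_ : _ \o _ = @rV_coord R n.+1 (rshift 1 i)); first exact: measurable_rV_coord.
by apply/funext => x; rewrite /rV_coord/= mxE.
Qed.

Section step.
Local Open Scope ereal_scope.
Variables (n : nat) (m : {sigma_finite_measure set 'rV[R]_n -> \bar R}).

Definition lebesgueS := pushforward ((@lebesgue_measure R) \x m) (@rV_cons n).

Let lebesgueS0 : lebesgueS set0 = 0.
Proof. by rewrite /lebesgueS /pushforward preimage_set0 measure0. Qed.

Let lebesgueS_ge0 A : 0 <= lebesgueS A.
Proof. exact: measure_ge0. Qed.

Let lebesgueS_sigma_additive : semi_sigma_additive lebesgueS.
Proof.
apply: measure_semi_sigma_additive; exact: measurable_rV_cons.
Qed.

HB.instance Definition _ := isMeasure.Build _ _ _ lebesgueS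
  lebesgueS0 lebesgueS_ge0 lebesgueS_sigma_additive.

Let lebesgueS_sigma_finite : sigma_finite setT lebesgueS.
Proof.
have /sigma_finiteP[F [TF ndF Foo]] := sigma_finiteT (@lebesgue_measure R).
have /sigma_finiteP[G [TG ndG Goo]] := sigma_finiteT m.
have FG : \bigcup_k (F k `*` G k) = setT.
  rewrite -setXTT TF TG predeqE => -[x y]; split.
    by move=> [k _ []/= ? ?]; split; exists k.
  move=> [/= [k _ Fkx] [l _ Gly]]; exists (maxn k l) => //; split.
  - by move: x Fkx; exact/subsetPset/ndF/leq_maxl.
  - by move: y Gly; exact/subsetPset/ndG/leq_maxr.
exists (fun k => @rV_uncons n @^-1` (F k `*` G k)).
  by rewrite -preimage_bigcup FG preimage_setT.
move=> k; have [mF Fk] := Foo k; have [mG Gk] := Goo k; split.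
  rewrite -[_ @^-1` _]setTI; apply: measurable_rV_uncons => //.
  exact: measurableX.
rewrite /lebesgueS /pushforward -comp_preimage (_ : _ \o _ = id); last first.
  by apply/funext => p /=; rewrite rV_consK.
by rewrite preimage_id product_measure1E// lte_mul_pinfty// ge0_fin_numE.
Qed.

HB.instance Definition _ := Measure_isSigmaFinite.Build _ _ _ lebesgueS
  lebesgueS_sigma_finite.

End step.

Fixpoint lebesgue_rV n : {sigma_finite_measure set 'rV[R]_n -> \bar R} :=
  match n with
  | 0 => [the {sigma_finite_measure set 'rV[R]_0 -> \bar R} of \d_(0 : 'rV[R]_0)]
  | n'.+1 => [the {sigma_finite_measure set 'rV[R]_n'.+1 -> \bar R} of
                lebesgueS (lebesgue_rV n')]
  end.

Lemma lebesgue_rVS n (A : set (measurableTypeR R)) (B : set 'rV[R]_n) :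
  measurable A -> measurable B ->
  lebesgue_rV n.+1 (@rV_uncons n @^-1` (A `*` B)) =
  (lebesgue_measure A * lebesgue_rV n B)%E.
Proof.
move=> mA mB; rewrite /= /lebesgueS /pushforward -comp_preimage.
rewrite (_ : _ \o _ = id) ?preimage_id ?product_measure1E//.
by apply/funext => p /=; rewrite rV_consK.
Qed.

End lebesgue_rV.

Section euclidean.
Context {R : realType} {d : nat}.
Implicit Types (x y : 'rV[R]_d) (A : set 'rV[R]_d).

Definition dotv x y : R := \sum_i x ord0 i * y ord0 i.

(* The library norm on 'rV[R]_d is the sup norm. *)
Definition enorm x : R := Num.sqrt (dotv x x).

(* M x for x viewed as a column. *)
Definition mulmv (M : 'M[R]_d) x : 'rV[R]_d := x *m M^T.

Definition boundary A := closure A `\` interior A.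

Definition diam A : R := sup [set enorm (x - y) | x in A & y in A].

Definition polyhedron (hs : seq ('rV[R]_d * R)) : set 'rV[R]_d :=
  [set x | forall h, h \in hs -> dotv h.1 x <= h.2].

Definition polytopal A := bounded_set A /\
  exists ps : seq (seq ('rV[R]_d * R)),
    A = interior [set x | exists2 hs, hs \in ps & polyhedron hs x].

(* Near each boundary point, A is the strict epigraph, in the direction of some
   unit vector e, of a Lipschitz function of the component orthogonal to e. *)
Definition lipschitz_boundary A := forall x, boundary A x ->
  exists (e : 'rV[R]_d) (L r : R) (gamma : 'rV[R]_d -> R),
    [/\ enorm e = 1, 0 < r,
        forall y z, `|gamma y - gamma z| <= L * enorm (y - z) &
        forall y, enorm (y - x) < r ->
          (A y <-> gamma (y - dotv y e *: e) < dotv y e)].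

Definition hyperplane (a : 'rV[R]_d) (b : R) : set 'rV[R]_d :=
  [set x | dotv a x = b].

End euclidean.

Section function_spaces.
Context {R : realType} {d : nat} (Omega : set 'rV[R]_d).
Local Notation E := 'rV[R]_d.
Local Notation mu := (lebesgue_rV d : {measure set 'rV[R]_d -> \bar R}).
Implicit Types (u v w : E -> R) (F G : E -> E).

(* Functions on Omega are represented by functions on R^d of which only the
   values in Omega matter, and are identified when equal a.e. in Omega. *)
Definition ae_on (P : E -> Prop) := \forall x \ae mu, Omega x -> P x.

Definition L2 u := u \_ Omega \in Lfun mu 2%:E.
Definition L2v F := forall i, L2 (fun x => F x ord0 i).
Definition Linfty u := u \_ Omega \in Lfun mu +oo%E.

Definition L2norm u : R := fine ('N[mu]_(2%:E)[EFin \o (u \_ Omega)])%E.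
Definition L2normv F : R := L2norm (fun x => enorm (F x)).

Definition partial (i : 'I_d) u : E -> R := 'D_(delta_mx ord0 i) u.
Definition gradient u : E -> E := fun x => \row_i partial i u x.

Definition smooth u := forall s : seq 'I_d,
  continuous (foldr partial u s) /\
  forall i x, derivable (foldr partial u s) x (delta_mx ord0 i).

Definition test_function u := smooth u /\
  exists K : set E, [/\ compact K, K `<=` Omega & forall x, ~ K x -> u x = 0].

Definition weak_partial i u w := forall phi, test_function phi ->
  \int[mu]_(x in Omega) (u x * partial i phi x) =
  - \int[mu]_(x in Omega) (w x * phi x).

Definition weak_gradient u G :=
  forall i, weak_partial i u (fun x => G x ord0 i).

Definition weak_div F w := forall phi, test_function phi ->
  \int[mu]_(x in Omega) dotv (F x) (gradient phi x) =
  - \int[mu]_(x in Omega) (w x * phi x).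

(* H1 u G (resp. H10 u G): u is in H^1 (resp. H^1_0) and grad u = G. *)
Definition H1 u G := [/\ L2 u, L2v G & weak_gradient u G].

Definition H10 u G := H1 u G /\
  forall eps : R, 0 < eps -> exists2 phi, test_function phi &
    L2norm (fun x => phi x - u x) + L2normv (fun x => gradient phi x - G x)
      < eps.

(* F is in H_div and div F = w. *)
Definition Hdiv F w := [/\ L2v F, L2 w & weak_div F w].

Definition W2infty u := exists (G : E -> E) (H : 'I_d -> 'I_d -> E -> R),
  [/\ Linfty u,
      forall i, Linfty (fun x => G x ord0 i),
      weak_gradient u G,
      forall i j, Linfty (H i j) &
      forall i j, weak_partial j (fun x => G x ord0 i) (H i j)].

End function_spaces.

Section obstacle_problem.
Context {R : realType} {d : nat} (Omega : set 'rV[R]_d).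
Local Notation E := 'rV[R]_d.
Local Notation mu := (lebesgue_rV d : {measure set 'rV[R]_d -> \bar R}).
Implicit Types (f g : E -> R) (Lambda : E -> 'M[R]_d).

Definition admissible_tensor Lambda (lmin lmax : R) :=
  (forall i j, measurable_fun Omega (fun x => Lambda x i j)) /\
  ae_on Omega (fun x => (Lambda x)^T = Lambda x /\
    forall a : R, eigenvalue (Lambda x) a -> lmin <= a <= lmax).

(* v is in the convex set K of the obstacle problem and grad v = G. *)
Definition in_K g (v : E -> R) (G : E -> E) := H10 Omega v G /\ ae_on Omega (fun x => v x <= g x).

Definition weak_solution Lambda f g (u : E -> R) (Gu : E -> E) := in_K g u Gu /\
  forall v Gv, in_K g v Gv ->
    \int[mu]_(x in Omega) dotv (mulmv (Lambda x) (Gu x)) (Gu x - Gv x) <=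
    \int[mu]_(x in Omega) (f x * (u x - v x)).

Definition is_norm (X : lmodType R) (N : X -> R) :=
  [/\ forall v, N v = 0 -> v = 0,
      forall a v, N (a *: v) = `|a| * N v &
      forall v w, N (v + w) <= N v + N w].

Record gradient_discretisation := GradientDiscretisation {
  gd_space : vectType R ;
  gd_Pi : gd_space -> E -> R ;
  gd_grad : gd_space -> E -> E ;
  gd_Pi_L2 : forall v, L2 Omega (gd_Pi v) ;
  gd_grad_L2 : forall v, L2v Omega (gd_grad v) ;
  gd_Pi_linear : forall (a : R) v w, ae_on Omega (fun x =>
    gd_Pi (a *: v + w) x = a * gd_Pi v x + gd_Pi w x) ;
  gd_grad_linear : forall (a : R) v w, ae_on Omega (fun x =>
    gd_grad (a *: v + w) x = a *: gd_grad v x + gd_grad w x) ;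
  gd_norm : is_norm (fun v => L2normv Omega (gd_grad v)) }.

Variable D : gradient_discretisation.
Local Notation X := (gd_space D).
Local Notation Pi := (@gd_Pi D).
Local Notation nabla := (@gd_grad D).

Definition K_D g : set X := [set v | ae_on Omega (fun x => Pi v x <= g x)].

Definition scheme_solution Lambda f g (u : X) := K_D g u /\
  forall v, K_D g v ->
    \int[mu]_(x in Omega)
      dotv (mulmv (Lambda x) (nabla u x)) (nabla (u - v) x) <=
    \int[mu]_(x in Omega) (f x * Pi (u - v) x).

(* A maximum, X being finite dimensional. For X = 0 it is over the empty set:
   then C_D = -oo and C_D <= M imposes nothing. *)
Definition C_D : \bar R := ereal_sup
  [set (L2norm Omega (Pi v) / L2normv Omega (nabla v))%:E
  | v in [set v : X | v != 0]].

Definition S_D (phi : E -> R) (Gphi : E -> E) (v : X) : R :=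
  L2norm Omega (fun x => Pi v x - phi x) +
  L2normv Omega (fun x => nabla v x - Gphi x).

(* For psi in H_div with divergence divpsi, this set is bounded by the
   Cauchy-Schwarz inequality, X being finite dimensional; sup set0 = 0. *)
Definition W_D (psi : E -> E) (divpsi : E -> R) : R := sup
  [set (L2normv Omega (nabla v))^-1 *
       `|\int[mu]_(x in Omega)
           (dotv (nabla v x) (psi x) + Pi v x * divpsi x)|
  | v in [set v : X | v != 0]].

End obstacle_problem.

Arguments K_D {R d Omega} D g.
Arguments scheme_solution {R d Omega} D Lambda f g u.
Arguments C_D {R d Omega} D.
Arguments S_D {R d Omega} D phi Gphi v.
Arguments W_D {R d Omega} D psi divpsi.

Record polytopal_mesh (R : realType) (d : nat) (Omega : set 'rV[R]_d) :=
    PolytopalMesh {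
  mesh_cells : finType ;
  mesh_faces : finType ;
  cell : mesh_cells -> set 'rV[R]_d ;
  face : mesh_faces -> set 'rV[R]_d ;
  faces_of : mesh_cells -> {set mesh_faces} ;
  cell_point : mesh_cells -> 'rV[R]_d ;
  cell_sub : forall K, cell K `<=` Omega ;
  cell_neq0 : forall K, cell K !=set0 ;
  cell_open : forall K, open (cell K) ;
  cell_connected : forall K, connected (cell K) ;
  cell_polytopal : forall K, polytopal (cell K) ;
  cell_disjoint : trivIset setT cell ;
  cell_cover : closure Omega = \bigcup_K closure (cell K) ;
  face_sub : forall s, face s `<=` closure Omega ;
  face_neq0 : forall s, face s !=set0 ;
  face_hyperplane : forall s, exists a b (U : set 'rV[R]_d),
    [/\ a != 0, open U & face s = U `&` hyperplane a b] ;
  face_disjoint : trivIset setT face ;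
  cell_boundary : forall K,
    boundary (cell K) = \bigcup_(s in [set s | s \in faces_of K])
                          closure (face s) ;
  face_neighbours : forall s,
    (#|[pred K | s \in faces_of K]| = 1%N /\ face s `<=` boundary Omega) \/
    (#|[pred K | s \in faces_of K]| = 2%N /\ face s `<=` Omega) ;
  cell_point_in : forall K, cell K (cell_point K) ;
  cell_star : forall K x, closure (cell K) x -> forall t : R, 0 <= t < 1 ->
    cell K (cell_point K + t *: (x - cell_point K)) }.

Definition mesh_size (R : realType) (d : nat) (Omega : set 'rV[R]_d)
    (T : polytopal_mesh Omega) : R :=
  sup (range (fun K : mesh_cells T => diam (cell K))).

(* Main.v *)
(* Write w = div (Lambda grad u) for the exact solution u, mu = f + w, and let v
   be the interpolant of u. Testing the scheme with v and using the defect W_D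
   gives, for delta = |grad_D (v - u_D)|,
     lmin delta^2 <= (lmax S_D + W_D) delta + int mu (Pi u_D - Pi v).
   As Pi u_D <= c (the value of g), everything rests on
   int mu (c - Pi v) <= C h^2. The multiplier mu is nonnegative and vanishes where
   u < c. On the contact set {u = c}, where grad u = 0, moreover w <= 0, so that
   |mu| <= |f|: this is why the constant does not depend on Lambda. Finally, u being
   in W^{2,oo} and maximal at contact points, c - u(x_K) = O(h^2) on every cell
   that meets the contact set; cells that do not meet it contribute nothing. *)
Require Import Defs.
From HB Require Import structures.
From mathcomp Require Import all_boot all_order all_algebra.
From mathcomp Require Import all_classical all_reals all_analysis.
From mathcomp Require Import measurable_realfun ess_sup_inf ring lra.

Set Implicit Arguments.
Unset Strict Implicit.
Unset Printing Implicit Defensive.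

Import Order.TTheory GRing.Theory Num.Def Num.Theory.
Import numFieldNormedType.Exports.

Local Open Scope classical_set_scope.
Local Open Scope ring_scope.

(** * Lebesgue measure on row vectors *)

Section rV_measure.
Context {R : realType}.
Implicit Types n : nat.

(** The constant is fixed before [Lambda], [g], [D] and the mesh, so every ingredient has to be
    uniform in the obstacle value c and in the contact point; f enters it through the integral of
    f^2, and u through the bounds on its second derivatives. As [Lambda] is merely measurable, the
    flux F = Lambda grad u is not a Sobolev field, and its divergence w cannot be declared zero on
    the set where F vanishes. What survives is a sign: w is tested against psi k(u), with k
    nondecreasing and concentrating on {u >= c}; the term F . grad k(u) is nonnegative by
    ellipticity, and the limit shows that the integral of w psi over the contact set is at most 0.
    Nonlinear functions of u are differentiated on the test functions that approximate u in H^1, and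
    the identity is then passed to the limit. Similarly, second derivatives of u exist only in the
    weak sense, so the Taylor bound at a contact point is proved for averages of u against a bump
    moving along a segment. *)

Definition ocube n (c : 'rV[R]_n) (r : R) : set 'rV[R]_n :=
  [set x | forall i, `|x ord0 i - c ord0 i| < r].

Definition ccube n (c : 'rV[R]_n) (r : R) : set 'rV[R]_n :=
  [set x | forall i, `|x ord0 i - c ord0 i| <= r].

Lemma open_rVP n (A : set 'rV[R]_n) :
  open A <-> forall x, A x -> exists2 r, 0 < r & ocube x r `<=` A.
Proof.
rewrite openE; split=> [oA x /oA|oA x /oA [r r0 rA]].
  rewrite /interior/= -nbhs_ballE => -[e /= e0 eA]; exists e => // y yx; apply: eA.
  by split => // i j; rewrite [i]ord1 /ball/= distrC; exact: yx.
rewrite /interior/= -nbhs_ballE; exists r => //= y [_ yx]; apply: rA => i.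
by rewrite distrC; exact: yx.
Qed.

Lemma measurable_ocube n (c : 'rV[R]_n) r : measurable (ocube c r).
Proof.
rewrite (_ : ocube c r = \bigcap_(i in [set: 'I_n]) (rV_coord i @^-1` ball (c ord0 i) r)).
  apply: fin_bigcap_measurable; first exact: finite_finset.
  move=> i _; rewrite -[_ @^-1` _]setTI; apply: measurable_rV_coord => //.
  exact: measurable_ball.
apply/seteqP; split=> x /= h i; rewrite /ball/=.
  by move=> _; rewrite /ball_/= distrC; exact: h.
by have := h i I; rewrite /ball/= /ball_/= distrC.
Qed.

(* Cubes with rational centres and radii 1/m, indexed by the pickling of
   (centre, m); the codes that do not give a cube inside U give set0. *)
Lemma open_rV_cover n (U : set 'rV[R]_n) : open U ->
  exists F : nat -> set 'rV[R]_n, U = \bigcup_k F k /\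
   forall k, F k = set0 \/
     exists c r, [/\ 0 < r, F k = ocube c r & ccube c r `<=` U].
Proof.
move=> /open_rVP oU.
pose G (p : 'rV[rat]_n * nat) := (map_mx ratr p.1 : 'rV[R]_n, (p.2.+1%:R^-1 : R)).
pose F k := if unpickle k is Some p then
   (if `[< ccube (G p).1 (G p).2 `<=` U >] then ocube (G p).1 (G p).2 else set0)
   else set0.
exists F; split; last first.
  move=> k; rewrite /F; case: unpickle => [p|]; last by left.
  case: asboolP => [h|_]; last by left.
  by right; exists (G p).1, (G p).2; split => //=; rewrite invr_gt0 ltr0n.
apply/seteqP; split=> [x Ux|x [k _]]; last first.
  rewrite /F; case: unpickle => [p|//]; case: asboolP => // h /= xp; apply: h => i.
  exact/ltW/xp.
have [r r0 rU] := oU x Ux.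
(* Half of r: a point of the closed cube is within s of its rational centre, itself within s of
   x. *)
have [m mr] : exists m : nat, m.+1%:R^-1 < r / 2.
  have r20 : 0 < r / 2 by rewrite divr_gt0.
  by have [m] := ltr_add_invr r20; rewrite add0r => ?; exists m.
set s : R := m.+1%:R^-1 in mr *.
have s0 : 0 < s by rewrite invr_gt0 ltr0n.
have /choice[q qx] : forall i, exists q : rat, `|x ord0 i - ratr q| < s.
  move=> i; have /rat_in_itvoo[q] : x ord0 i - s < x ord0 i + s by lra.
  by rewrite in_itv/= => /andP[? ?]; exists q; rewrite ltr_norml; apply/andP; split; lra.
pose p := (\row_i q i, m).
exists (pickle p) => //; rewrite /F pickleK.
case: asboolP => [_ i /=|]; first by rewrite !mxE; exact: qx.
case; apply: subset_trans rU => y yp i.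
have := yp i; rewrite /= !mxE => yi.
rewrite (le_lt_trans (ler_distD (ratr (q i)) _ _))//.
have xq := qx i; rewrite distrC in xq.
by rewrite [ltRHS](splitr r) ltrD//; [exact: le_lt_trans mr|exact: lt_trans mr].
Qed.

Lemma open_rV_measurable n (U : set 'rV[R]_n) : open U -> measurable U.
Proof.
move=> /open_rV_cover[F [-> FP]]; apply: bigcupT_measurable => k.
by case: (FP k) => [->//|[c [r [_ -> _]]]]; exact: measurable_ocube.
Qed.

(** The image of Lebesgue measure under a translation agrees with it on the half-open intervals,
    which determine it. *)
Lemma lebesgue_measure_translate (a : R) (A : set (measurableTypeR R)) :
  measurable A ->
  lebesgue_measure ((fun x : measurableTypeR R => x + a) @^-1` A) = lebesgue_measure A.
Proof.
move=> mA.
have mt : measurable_fun setT (fun x : measurableTypeR R => x + a : measurableTypeR R).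
  exact: measurable_funD.
rewrite -[LHS]/(pushforward lebesgue_measure (fun x => x + a) A).
apply/esym/(@lebesgue_measure_unique R (measure_function_pushforward__canonical__measure_function_Measure (@lebesgue_measure R) mt)) => //.
move=> _ [[b c] _ <-]; rewrite /= /pushforward.
rewrite (_ : _ @^-1` _ = `]b - a, c - a]%classic).
  by rewrite !lebesgue_measure_itv/= !lte_fin ltrD2r -!EFinB (_ : c - a - (b - a) = c - b)//; ring.
by apply/seteqP; split=> x /=; rewrite !in_itv/= ltrBlDr lerBrDr.
Qed.

Lemma measurable_rV_translate n (v : 'rV[R]_n) :
  measurable_fun setT (fun x : 'rV[R]_n => x + v).
Proof.
apply: measurable_fun_rVP => i.
rewrite (_ : _ \o _ = (fun x : 'rV[R]_n => rV_coord i x + v ord0 i)); last first.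
  by apply/funext => x; rewrite /rV_coord/= mxE.
apply: measurable_funD => //; exact: measurable_rV_coord.
Qed.

(** Induction on the dimension: in the coordinates of [rV_cons] the translation becomes the product
    [T] of two translations, and a measure with the right values on measurable rectangles is the
    product measure. *)
Lemma lebesgue_rV_translate n (v : 'rV[R]_n) (A : set 'rV[R]_n) : measurable A ->
  lebesgue_rV n ((fun x => x + v) @^-1` A) = lebesgue_rV n A.
Proof.
elim: n => [|n IH] in v A *.
  move=> _; congr (lebesgue_rV _ _).
  by apply/seteqP; split=> x /=; rewrite (_ : x + v = x)//; apply/rowP => -[].
move=> mA.
pose v' := @rV_uncons R n v.
pose T (p : measurableTypeR R * 'rV[R]_n) : measurableTypeR R * 'rV[R]_n :=
  (p.1 + v'.1, p.2 + v'.2).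
have mT : measurable_fun setT T.
  apply: measurable_fun_pair.
    by apply: measurable_funD => //; exact: measurable_fst.
  by apply: (measurableT_comp (measurable_rV_translate v'.2)); exact: measurable_snd.
have consT p : rV_cons (T p) = rV_cons p + v.
  apply/rowP => i; rewrite /rV_cons -[i](@splitK 1 n).
  case: (@fintype.split 1 n i) => j /=.
    rewrite [in RHS]mxE !(@row_mxEl _ 1 1 n) !mxE [j]ord1 eqxx /=.
    by rewrite !mulr1n; congr (_ + v _ _); exact: val_inj.
  by rewrite [in RHS]mxE !(@row_mxEr _ 1 1 n) !mxE.
have mB : measurable (@rV_cons R n @^-1` A).
  by rewrite -[X in measurable X]setTI; apply: measurable_rV_cons.
rewrite /= /lebesgueS /pushforward -comp_preimage.
rewrite (_ : _ \o _ = @rV_cons R n \o T); last by apply/funext => p /=; rewrite consT.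
rewrite comp_preimage -[LHS]/(pushforward (lebesgue_measure \x lebesgue_rV n)%E T _).
apply/esym/(@product_measure_unique _ _ _ _ _ _ _
  (measure_function_pushforward__canonical__measure_function_Measure
    ((@lebesgue_measure R) \x (lebesgue_rV n))%E mT)) => //.
move=> B C mB' mC; rewrite /= /pushforward.
rewrite (_ : _ @^-1` _ = ((fun x : measurableTypeR R => x + v'.1) @^-1` B) `*`
   ((fun x => x + v'.2) @^-1` C))//.
rewrite product_measure1E.
- by congr (_ * _)%E; [exact: lebesgue_measure_translate|exact: IH].
- by rewrite -[X in measurable X]setTI; apply: measurable_funD.
- by rewrite -[X in measurable X]setTI; apply: measurable_rV_translate.
Qed.

Lemma lebesgue_rV_ocube n (c : 'rV[R]_n) r : 0 < r ->
  lebesgue_rV n (ocube c r) = ((r *+ 2) ^+ n)%:E.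
Proof.
move=> r0; elim: n => [|n IH] in c *.
  rewrite /= expr0 diracE mem_set// => -[]//.
rewrite (_ : ocube c r = @rV_uncons R n @^-1` (ball (c ord0 ord0) r `*` ocube (rV_uncons c).2 r)).
  rewrite lebesgue_rVS//; last 2 first.
  - exact: measurable_ball.
  - exact: measurable_ocube.
  by rewrite lebesgue_measure_ball ?ltW// IH -EFinM exprS.
apply/seteqP; split => [x /= h|x [/= h0 h] i].
  split=> [|i]; first by rewrite /ball/= /ball_/= distrC; exact: h.
  by rewrite !mxE; exact: h.
rewrite -[i](@splitK 1 n); case: (@fintype.split 1 n i) => j /=.
  move: h0; rewrite /ball/= /ball_/= distrC [j]ord1 (_ : lshift n (ord0 : 'I_1) = ord0)//.
  exact: val_inj.
by have := h j; rewrite !mxE.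
Qed.

Lemma lebesgue_rV_ocube_lty n (c : 'rV[R]_n) r : 0 < r ->
  (lebesgue_rV n (ocube c r) < +oo)%E.
Proof. by move=> r0; rewrite lebesgue_rV_ocube// ltry. Qed.

Lemma coord_le_norm n (x : 'rV[R]_n) i : `|x ord0 i| <= `|x|.
Proof.
rewrite /Num.norm/= mx_normrE.
exact: (@le_bigmax _ _ _ _ (fun ij => `|x ij.1 ij.2|) (ord0, i)).
Qed.

Lemma bounded_rVP n (A : set 'rV[R]_n) : bounded_set A ->
  exists2 r, 0 < r & A `<=` ocube 0 r.
Proof.
move=> [M [Mr MA]]; exists (`|M| + 2) => [|x Ax i]; first by rewrite ltr_wpDl.
have /(MA (`|M| + 1)) : M < `|M| + 1 by rewrite (le_lt_trans (ler_norm _))// ltrDl.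
move=> /(_ x Ax); rewrite mxE subr0 => /= h.
rewrite (le_lt_trans _ (_ : `|M| + 1 < _))//; last by lra.
exact: le_trans (coord_le_norm _ _) h.
Qed.

Lemma bounded_rV_finite n (A : set 'rV[R]_n) : measurable A -> bounded_set A ->
  (lebesgue_rV n A < +oo)%E.
Proof.
move=> mA /bounded_rVP[r r0 Ar]; apply: (@le_lt_trans _ _ (lebesgue_rV n (ocube 0 r))).
  by apply: le_measure => //; rewrite inE//; exact: measurable_ocube.
by rewrite lebesgue_rV_ocube// ltry.
Qed.

Lemma open_rV_gt0 n (U : set 'rV[R]_n) : open U -> U !=set0 ->
  (0 < lebesgue_rV n U)%E.
Proof.
move=> oU [x /(open_rVP U).1]; move/(_ oU)=> [r r0 rU].
apply: (@lt_le_trans _ _ (lebesgue_rV n (ocube x r))).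
  by rewrite lebesgue_rV_ocube// lte_fin exprn_gt0// mulrn_wgt0.
apply: le_measure => //; rewrite inE; [exact: measurable_ocube|exact: open_rV_measurable].
Qed.

End rV_measure.

(** * Null hyperplanes and translation invariance of integrals *)

Section rV_integral.
Context {R : realType}.
Implicit Types n : nat.

Lemma measurable_dotv n (a : 'rV[R]_n) : measurable_fun setT (dotv a).
Proof.
rewrite (_ : dotv a = fun x => \sum_i a ord0 i * rV_coord i x)//.
apply: measurable_sum => i; apply: measurable_funM => //; exact: measurable_rV_coord.
Qed.

Lemma measurable_hyperplane n (a : 'rV[R]_n) b : measurable (hyperplane a b).
Proof.
rewrite (_ : hyperplane a b = dotv a @^-1` [set b])//.
by rewrite -[X in measurable X]setTI; apply: measurable_dotv.
Qed.

(* The translates of the bounded part H of the hyperplane by v/(k+1) are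
   disjoint, of the same measure, and lie in one cube of finite measure. *)
Lemma hyperplane_null n (a : 'rV[R]_n) b : a != 0 ->
  lebesgue_rV n (hyperplane a b) = 0%E.
Proof.
move=> a0; have [j aj] : exists j, a ord0 j != 0.
  apply/existsP; rewrite -negb_forall; apply: contra a0 => /forallP h.
  by apply/eqP/rowP => j; rewrite mxE; exact/eqP/h.
apply/negligibleP; first exact: measurable_hyperplane.
suff H0 k : lebesgue_rV n (hyperplane a b `&` ocube 0 k%:R) = 0%E.
  rewrite (_ : hyperplane a b = \bigcup_k (hyperplane a b `&` ocube 0 k%:R)); last first.
    apply/seteqP; split=> [x hx|x [k _ [] //]].
    exists (truncn `|x|).+1 => //; split=> // i; rewrite mxE subr0.
    exact: le_lt_trans (coord_le_norm _ _) (truncnS_gt _).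
  apply: negligible_bigcup => k; apply/negligibleP; last exact: H0.
  by apply: measurableI; [exact: measurable_hyperplane|exact: measurable_ocube].
set H := _ `&` _.
have mH : measurable H.
  by apply: measurableI; [exact: measurable_hyperplane|exact: measurable_ocube].
pose v (m : nat) : 'rV[R]_n := m.+1%:R^-1 *: delta_mx ord0 j.
pose F m := (fun x => x + v m) @^-1` H.
have mF m : measurable (F m).
  by rewrite -[X in measurable X]setTI; apply: measurable_rV_translate.
have muF m : lebesgue_rV n (F m) = lebesgue_rV n H by exact: lebesgue_rV_translate.
have Fsub m : F m `<=` ocube 0 (k%:R + 1).
  move=> x [_ xk] i; have := xk i; rewrite !mxE subr0 => h.
  rewrite -[x ord0 i](addrK (m.+1%:R^-1 * (i == j)%:R)) subr0.
  rewrite (le_lt_trans (ler_normB _ _))// ltr_leD// normrM.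
  rewrite ger0_norm ?invr_ge0// (_ : `|_%:R| = (i == j)%:R) ?normr_nat//.
  by case: (i == j); rewrite ?mulr1 ?mulr0// invf_le1 ?ltr0n// ler1n.
have dotF m x : F m x -> dotv a x + m.+1%:R^-1 * a ord0 j = b.
  move=> [+ _]; rewrite /hyperplane/= => <-; rewrite /dotv.
  under [RHS]eq_bigr do rewrite mxE mulrDr.
  rewrite big_split/=; congr (_ + _).
  rewrite (bigD1 j)//= !mxE !eqxx mulr1 big1 ?addr0 1?mulrC// => i ij.
  by rewrite !mxE (negbTE ij) andbF mulr0 mulr0.
have tF : trivIset setT F.
  apply/trivIsetP => m1 m2 _ _ m12; rewrite -subset0 => x [/dotF h1 /dotF].
  rewrite -h1 => /addrI /(mulIf aj) /invr_inj /eqP; rewrite eqr_nat eqSS eq_sym.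
  by rewrite (negbTE m12).
set M := lebesgue_rV n (ocube (0 : 'rV[R]_n) (k%:R + 1)).
have Mfin : M = (fine M)%:E.
  by rewrite fineK// /M lebesgue_rV_ocube// ltr_wpDl.
set h := fine (lebesgue_rV n H).
have Hfin : lebesgue_rV n H = h%:E.
  rewrite fineK// ge0_fin_numE//; apply: (@le_lt_trans _ _ M); last by rewrite Mfin ltry.
  apply: le_measure; rewrite ?inE//; first exact: measurable_ocube.
  by move=> x [_ xk] i; apply: lt_trans (xk i) _; rewrite ltrDl.
have le_M N : ((h *+ N)%:E <= M)%E.
  rewrite -[X in _ *+ X](card_ord N) -sumr_const -sumEFin.
  rewrite (eq_bigr (fun i : 'I_N => lebesgue_rV n (F i))); last first.
    by move=> i _; rewrite muF.
  rewrite -measure_bigsetU_ord//; last first.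
    by apply/trivIsetP => i1 i2 _ _ i12; move/trivIsetP : tF; apply.
  apply: le_measure; rewrite ?inE; [exact: bigsetU_measurable|exact: measurable_ocube|].
  by rewrite -bigcup_seq => x [i _ /Fsub].
apply: etrans Hfin _; congr EFin; apply/eqP; rewrite eq_le fine_ge0 ?andbT//.
(* If h > 0, taking more than M / h translates overshoots the measure of the cube. *)
rewrite leNgt; apply/negP => h0.
have := le_M (truncn (fine M / h)).+1; rewrite Mfin lee_fin.
rewrite leNgt -mulr_natl -ltr_pdivrMr// => /negP; apply; exact: truncnS_gt.
Qed.

Lemma eq_measure_integral_translate n (v : 'rV[R]_n) (f : 'rV[R]_n -> \bar R) :
  (\int[pushforward (lebesgue_rV n) (fun x : 'rV[R]_n => (x + v)%R)]_x f x =
   \int[lebesgue_rV n]_x f x)%E.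
Proof.
pose m := measure_function_pushforward__canonical__measure_function_Measure
  (lebesgue_rV n) (measurable_rV_translate v).
apply: (eq_measure_integral (lebesgue_rV n : measure _ R) (m1 := m)) => A mA _.
exact: lebesgue_rV_translate.
Qed.

Lemma ge0_integral_translate n (v : 'rV[R]_n) (f : 'rV[R]_n -> \bar R) :
  measurable_fun setT f -> (forall x, 0 <= f x)%E ->
  (\int[lebesgue_rV n]_x f (x + v)%R = \int[lebesgue_rV n]_x f x)%E.
Proof.
move=> mf f0; rewrite -[RHS](eq_measure_integral_translate v).
rewrite (ge0_integral_pushforward (measurable_rV_translate v))// => y _; exact: f0.
Qed.

Lemma integrable_translate n (v : 'rV[R]_n) (f : 'rV[R]_n -> \bar R) :
  (lebesgue_rV n).-integrable setT f ->
  (lebesgue_rV n).-integrable setT (fun x => f (x + v)).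
Proof.
move=> /integrableP[mf foo]; apply/integrableP; split.
  by apply: (measurableT_comp mf); exact: measurable_rV_translate.
rewrite (ge0_integral_translate v (f := fun x => `|f x|%E))//.
exact: measurableT_comp.
Qed.

Lemma Rintegral_translate n (v : 'rV[R]_n) (f : 'rV[R]_n -> R) :
  (lebesgue_rV n).-integrable setT (EFin \o f) ->
  \int[lebesgue_rV n]_x f (x + v) = \int[lebesgue_rV n]_x f x.
Proof.
move=> If; congr fine; rewrite -[RHS](eq_measure_integral_translate v (EFin \o f)).
rewrite (integral_pushforward (measurable_rV_translate v))//.
  by case/integrableP : If.
by rewrite preimage_setT; exact: (integrable_translate v If).
Qed.

End rV_integral.

(** * Smooth functions and test functions *)

Section pointwise_derive.
Context {R : realType} {V : normedModType R}.
Implicit Types (f g : V -> R) (x v : V).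

Lemma is_derive_funD f g x v df dg : is_derive x v f df -> is_derive x v g dg ->
  is_derive x v (fun y => f y + g y) (df + dg).
Proof. by move=> hf hg; exact: (is_deriveD hf hg). Qed.

Lemma is_derive_funM f g x v df dg : is_derive x v f df -> is_derive x v g dg ->
  is_derive x v (fun y => f y * g y) (df * g x + f x * dg).
Proof.
move=> hf hg.
have h := is_deriveM hf hg; apply: (is_derive_eq h).
by rewrite /GRing.scale/= addrC [df * _]mulrC.
Qed.

Lemma is_derive_funV f x v df : f x != 0 -> is_derive x v f df ->
  is_derive x v (fun y => (f y)^-1) (- (f x) ^- 2 * df).
Proof.
move=> fx [hf <-]; apply: DeriveDef; first exact: derivableV.
by rewrite deriveV.
Qed.

(* Directional derivatives are derivatives along lines: this reduces the chain
   rule to the one-variable case. *)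
Lemma is_derive_line f x v (t : R) df :
  is_derive (x + t *: v) v f df <-> is_derive t 1 (fun s : R => f (x + s *: v)) df.
Proof.
have E : (fun h : R => h^-1 *: ((f (h *: v + (x + t *: v))) - f (x + t *: v))) =
  (fun h : R => h^-1 *: (f (x + (h *: (1 : R^o) + t) *: v) - f (x + t *: v))).
  by apply/funext => h; rewrite scaler1 scalerDl addrCA.
split=> -[]; rewrite /derivable /derive => h1 h2.
  by apply: DeriveDef; rewrite /derivable/derive/= -E.
by apply: DeriveDef; rewrite /derivable/derive/= E.
Qed.

Lemma is_derive_fun1 (k : R -> R) f x v df dk :
  is_derive (f x) 1 k dk -> is_derive x v f df ->
  is_derive x v (fun y => k (f y)) (dk * df).
Proof.
move=> hk hf.
have /is_derive_line hf' : is_derive (x + 0 *: v) v f df by rewrite scale0r addr0.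
rewrite -[x]addr0 -(scale0r v); apply/is_derive_line.
by apply: is_derive1_comp; rewrite scale0r addr0.
Qed.

End pointwise_derive.

(** * Functions flat at the origin *)

Section flat.
Context {R : realType}.
Implicit Types (k : nat) (t : R).

(** [flat 0] is the classical exp(-1/t), extended by 0 to t <= 0. The powers t^-k are included
    because differentiation only produces combinations of members of this family
    ([is_derive_flat]). *)
Definition flat k t : R := if 0 < t then t^-1 ^+ k * expR (- t^-1) else 0.

Lemma flat_ge0 k t : 0 <= flat k t.
Proof.
rewrite /flat; case: ifPn => // t0.
by rewrite mulr_ge0 ?expR_ge0// exprn_ge0// invr_ge0 ltW.
Qed.

Lemma flat_gt0 k t : 0 < t -> 0 < flat k t.
Proof. by move=> t0; rewrite /flat t0 mulr_gt0 ?expR_gt0// exprn_gt0// invr_gt0. Qed.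

Lemma flat_eq0 k t : t <= 0 -> flat k t = 0.
Proof. by rewrite /flat leNgt => /negbTE ->. Qed.

(** exp(1/t) is the k-th power of exp(1/(k t)), which is at least 1/(k t). At k = 0 the convention
    0^0 = 1 gives the bound 1 on [flat 0], used for the bumps. *)
Lemma flat_le k t : flat k t <= k%:R ^+ k.
Proof.
rewrite /flat; case: ifPn => [t0|_]; last by rewrite exprn_ge0.
rewrite expRN ler_pdivrMr ?expR_gt0//.
case: k => [|k]; first by rewrite !expr0 mul1r (le_trans _ (expR_ge1Dx _))// lerDl invr_ge0 ltW.
rewrite (_ : expR t^-1 = expR (k.+1%:R * (k.+1%:R^-1 * t^-1))); last first.
  by rewrite mulrA mulfV ?mul1r// pnatr_eq0.
rewrite expRM_natl -exprMn; apply: lerXn2r.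
- by rewrite nnegrE invr_ge0 ltW.
- by rewrite nnegrE mulr_ge0 ?expR_ge0.
by rewrite -ler_pdivrMl ?ltr0n// (le_trans _ (expR_ge1Dx _))// lerDr.
Qed.

Lemma flatS k t : flat k t = t * flat k.+1 t.
Proof.
rewrite /flat; case: ifPn => t0; last by rewrite mulr0.
by rewrite exprS !mulrA mulfV ?mul1r// gt_eqF.
Qed.

Lemma is_derive_flat k t : is_derive t 1 (flat k) (flat k.+2 t - k%:R * flat k.+1 t).
Proof.
have [t0|t0|->] := ltgtP t 0.
- rewrite (flat_eq0 _ (ltW t0)) (flat_eq0 k.+1 (ltW t0)) mulr0 subr0.
  apply: (@near_eq_is_derive _ _ _ (cst 0)); near=> s.
  by rewrite flat_eq0//; near: s; exact: lt_le_nbhsl.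
- apply: (@near_eq_is_derive R R^o R^o (fun s => s^-1 ^+ k * expR (- s^-1))).
    near=> s; rewrite /flat ifT//; near: s; exact: lt_nbhsr.
  have t0' : t != 0 by rewrite gt_eqF.
  have dV : is_derive t 1 (fun s : R => s^-1) (- t ^- 2).
    by apply: is_derive_eq (is_derive_funV t0' (is_derive_id _ _)) _; rewrite ?mulr1.
  have dX : is_derive t 1 (fun s : R => s^-1 ^+ k) (k%:R * t^-1 ^+ k.-1 * - t ^- 2).
    apply: (@is_derive_fun1 R R^o (fun u => u ^+ k)) => //.
    rewrite (_ : (fun u => u ^+ k) = (id : R^o -> R^o) ^+ k); last first.
      by apply/funext => u; rewrite exprfctE.
    have h := @is_deriveX R R^o id k t^-1 1 1 (is_derive_id _ _).
    by apply: (is_derive_eq h); rewrite /GRing.scale/= mulr1.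
  have dE : is_derive t 1 (fun s : R => expR (- s^-1)) (expR (- t^-1) * - - t ^- 2).
    apply: (@is_derive_fun1 R R^o expR) => //; exact: is_deriveN.
  apply: is_derive_eq (is_derive_funM dX dE) _.
  rewrite /flat t0 /GRing.scale/= opprK; case: k {dX dE} => [|k]/=.
    by rewrite !expr0; field.
  by rewrite !exprS; field.
(* At the origin the difference quotient is [flat k.+1 h = h * flat k.+2 h], hence O(h) by
   [flat_le]. *)
- rewrite (flat_eq0 _ (lexx 0)) (flat_eq0 k.+1 (lexx 0)) mulr0 subr0.
  suff h : h^-1 *: (flat k (h *: 1 + 0) - flat k 0) @[h --> 0^'] --> (0 : R).
    by apply: DeriveDef; [apply/cvg_ex; exists 0|exact: cvg_lim h].
  apply/cvgrPdist_le => e e0; near=> h.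
  rewrite sub0r normrN scaler1 addr0 (flat_eq0 _ (lexx 0)) subr0 flatS.
  rewrite /GRing.scale/= mulrA mulVf ?mul1r; last by near: h; exact: nbhs_dnbhs_neq.
  rewrite flatS normrM (ger0_norm (flat_ge0 _ _)).
  rewrite (@le_trans _ _ (`|h| * k.+2%:R ^+ k.+2))// ?ler_wpM2l ?flat_le//.
  rewrite -ler_pdivlMr ?exprn_gt0//.
  near: h; apply: dnbhs0_le; rewrite divr_gt0 ?exprn_gt0//.
Unshelve. all: by end_near. Qed.

Lemma continuous_flat k : continuous (flat k).
Proof.
move=> t; apply/differentiable_continuous/derivable1_diffP.
by have [] := is_derive_flat k t.
Qed.

End flat.

Section smooth.
Context {R : realType} {n : nat}.
Local Notation E := 'rV[R]_n.
Implicit Types (u v : E -> R) (i : 'I_n).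
Local Notation e_ i := (delta_mx ord0 i : E).

(* This class is closed under partial derivatives, hence contains only smooth
   functions. *)
Inductive smooth_gen : (E -> R) -> Prop :=
| sg_smooth u : smooth u -> smooth_gen u
| sg_cst (c : R) : smooth_gen (fun=> c)
| sg_coord i : smooth_gen (fun x => x ord0 i)
| sg_add u v : smooth_gen u -> smooth_gen v -> smooth_gen (fun x => u x + v x)
| sg_mul u v : smooth_gen u -> smooth_gen v -> smooth_gen (fun x => u x * v x)
| sg_inv u : (forall x, u x != 0) -> smooth_gen u -> smooth_gen (fun x => (u x)^-1)
| sg_flat k u : smooth_gen u -> smooth_gen (fun x => flat k (u x)).

Lemma is_derive_partial u i x : derivable u x (e_ i) ->
  is_derive x (e_ i) u (partial i u x).
Proof. by move=> h; apply: DeriveDef. Qed.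

Lemma is_derive_coord (j : 'I_n) (x v : E) : is_derive x v (fun y : E => y ord0 j) (v ord0 j).
Proof.
have h : (fun h : R => h^-1 *: ((h *: v + x) ord0 j - x ord0 j)) @ 0^' --> v ord0 j.
  apply: cvg_near_cst; near=> h; rewrite !mxE addrK /GRing.scale/= mulrA mulVf ?mul1r//.
  by near: h; exact: nbhs_dnbhs_neq.
apply: DeriveDef; first by apply/cvg_ex; exists (v ord0 j).
exact: cvg_lim h.
Unshelve. all: by end_near. Qed.

Lemma continuous_coord i : continuous (fun x : E => x ord0 i).
Proof. exact: coord_continuous. Qed.

Lemma partial_smooth u i : smooth u -> smooth (partial i u).
Proof.
move=> su s; have := su (rcons s i).
by rewrite -cats1 foldr_cat.
Qed.

Lemma smooth_continuous u : smooth u -> continuous u.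
Proof. by move=> su; exact: (su [::]).1. Qed.

Lemma smooth_derivable u x i : smooth u -> derivable u x (e_ i).
Proof. by move=> su; exact: (su [::]).2. Qed.

Lemma is_derive_smooth u x i : smooth u -> is_derive x (e_ i) u (partial i u x).
Proof. by move=> su; apply: is_derive_partial; exact: smooth_derivable. Qed.

Lemma partialE u i (du : E -> R) :
  (forall x, is_derive x (e_ i) u (du x)) -> partial i u = du.
Proof. by move=> h; apply/funext => x; have [_ <-] := h x. Qed.

(** One step of the closure under differentiation; [smooth_genP] iterates it along the list of
    directions in [smooth]. *)
Lemma smooth_gen_step u : smooth_gen u -> continuous u /\
  forall i, (forall x, derivable u x (e_ i)) /\ smooth_gen (partial i u).
Proof.
suff h : smooth_gen u -> continuous u /\ forall i, exists du : E -> R,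
    (forall x, is_derive x (e_ i) u (du x)) /\ smooth_gen du.
  move=> /h[cu du]; split=> // i; have [du' [h1 h2]] := du i.
  by split=> [x|]; [have [] := h1 x|rewrite (partialE h1)].
elim=> {u} [u su|c|j|u v gu [cu du] gv [cv dv]|u v gu [cu du] gv [cv dv]|
  u u0 gu [cu du]|k u gu [cu du]].
- split=> [|i]; first exact: smooth_continuous.
  exists (partial i u); split=> [x|]; first exact: is_derive_smooth.
  by apply: sg_smooth; exact: partial_smooth.
- split=> [|i]; first exact: cst_continuous.
  by exists (fun=> 0); split=> [x|]; [exact: is_derive_cst|exact: sg_cst].
- split=> [|i]; first exact: continuous_coord.
  exists (fun=> e_ i ord0 j); split=> [x|]; [exact: is_derive_coord|exact: sg_cst].
- split=> [x|i]; first exact: cvgD (cu x) (cv x).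
  have [[a [ha ga]] [b [hb gb]]] := (du i, dv i).
  exists (fun x => a x + b x); split=> [x|]; first exact: is_derive_funD.
  exact: sg_add.
- split=> [x|i]; first exact: cvgM (cu x) (cv x).
  have [[a [ha ga]] [b [hb gb]]] := (du i, dv i).
  exists (fun x => a x * v x + u x * b x); split=> [x|]; first exact: is_derive_funM.
  by apply: sg_add; exact: sg_mul.
- split=> [x|i]; first exact: cvgV (u0 x) (cu x).
  have [a [ha ga]] := du i.
  exists (fun x => (-1 * ((u x)^-1 * (u x)^-1)) * a x); split=> [x|].
    apply: is_derive_eq (is_derive_funV (u0 x) (ha x)) _.
    by rewrite mulN1r expr2 invfM.
  by repeat (apply: sg_mul || exact: sg_cst || exact: sg_inv).
- split=> [x|i].
    by apply: (continuous_comp (cu x)); exact: continuous_flat.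
  have [a [ha ga]] := du i.
  exists (fun x => (flat k.+2 (u x) + - k%:R * flat k.+1 (u x)) * a x); split=> [x|].
    apply: is_derive_eq (is_derive_fun1 (is_derive_flat k _) (ha x)) _.
    by rewrite mulNr.
  by repeat (apply: sg_mul || apply: sg_add || exact: sg_cst || apply: sg_flat || exact: gu).
Qed.

Lemma smooth_genP u : smooth_gen u -> smooth u.
Proof.
move=> gu s.
have : smooth_gen (foldr partial u s).
  by elim: s => [//|i s /smooth_gen_step[_ /(_ i)[]]].
by move=> /smooth_gen_step[h1 h2]; split=> // i x; exact: (h2 i).1.
Qed.

End smooth.

Section test_functions.
Context {R : realType} {n : nat}.
Local Notation E := 'rV[R]_n.
Local Notation mu := (lebesgue_rV n : {measure set 'rV[R]_n -> \bar R}).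
Implicit Types (u v : E -> R) (i : 'I_n) (U : set E).
Local Notation e_ i := (delta_mx ord0 i : E).

Lemma continuous_rV_measurable u : continuous u -> measurable_fun setT u.
Proof.
move=> /continuousP cu.
apply: (measurability _ (RGenOpens.measurableE R)) => //.
move=> _ [_ [a [b ->] <-]]; rewrite setTI; apply: open_rV_measurable.
exact/cu/interval_open.
Qed.

Lemma smooth_measurable u : smooth u -> measurable_fun setT u.
Proof. by move=> /smooth_continuous/continuous_rV_measurable. Qed.

Lemma test_smooth U u : test_function U u -> smooth u. Proof. by case. Qed.

Lemma test_function_sub U V u : U `<=` V -> test_function U u -> test_function V u.
Proof.
by move=> UV [su [K [cK KU uK]]]; split=> //; exists K; split=> //; exact: subset_trans UV.
Qed.

Lemma test_function_out U u x : test_function U u -> ~ U x -> u x = 0.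
Proof. by move=> [_ [K [_ KU uK]]] nUx; apply: uK => /KU. Qed.

Lemma test_functionM U u v : smooth v -> test_function U u ->
  test_function U (fun x => u x * v x).
Proof.
move=> sv [su [K [cK KU uK]]]; split.
  by apply: smooth_genP; apply: sg_mul; exact: sg_smooth.
by exists K; split=> // x /uK ->; rewrite mul0r.
Qed.

Lemma test_functionZ U (a : R) u : test_function U u ->
  test_function U (fun x => a * u x).
Proof.
move=> [su [K [cK KU uK]]]; split.
  by apply: smooth_genP; apply: sg_mul; [exact: sg_cst|exact: sg_smooth].
by exists K; split=> // x /uK ->; rewrite mulr0.
Qed.

Lemma test_functionB U u v : test_function U u -> test_function U v ->
  test_function U (fun x => u x - v x).
Proof.
move=> [su [K [cK KU uK]]] [sv [L [cL LU vL]]]; split.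
  rewrite (_ : (fun x => _) = (fun x => u x + (-1) * v x)); last first.
    by apply/funext => x; rewrite mulN1r.
  apply: smooth_genP; apply: sg_add; first exact: sg_smooth.
  by apply: sg_mul; [exact: sg_cst|exact: sg_smooth].
exists (K `|` L); split=> [||x KLx].
- exact: compactU.
- by move=> x [/KU|/LU].
- by rewrite uK ?vL ?subr0// => h; apply: KLx; [right|left].
Qed.

Lemma test_function_partial U u i : test_function U u -> test_function U (partial i u).
Proof.
move=> [su [K [cK KU uK]]]; split; first exact: partial_smooth.
exists K; split=> // x nKx.
have oK : open (~` K) by apply: closed_openC; apply: compact_closed => //; exact: norm_hausdorff.
have h : \near x, u x = (cst 0 : E -> R) x.
  near=> y; apply: uK; near: y; exact: open_nbhs_nbhs.
by rewrite /partial (near_eq_derive _ h) derive_cst.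
Unshelve. all: by end_near. Qed.

Lemma test_function_bounded U u : test_function U u ->
  exists2 M, 0 <= M & forall x, `|u x| <= M.
Proof.
move=> [su [K [cK KU uK]]].
have [|M [Mr MK]] := @compact_bounded _ _ (u @` K).
  apply: continuous_compact => //; apply: continuous_subspaceT.
  exact: smooth_continuous.
exists (`|M| + 1) => [|x]; first by rewrite addr_ge0.
have [Kx|/uK ->] := pselect (K x); last by rewrite normr0 addr_ge0.
by apply: MK; [rewrite (le_lt_trans (ler_norm _))// ltrDl|exists x].
Qed.

Lemma test_function_cube U u : test_function U u ->
  exists2 r, 0 < r & forall x, ~ ocube 0 r x -> u x = 0.
Proof.
move=> [su [K [cK KU uK]]].
have [r r0 Kr] := bounded_rVP (compact_bounded cK).
by exists r => // x xr; apply: uK => /Kr.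
Qed.

Lemma test_function_integrable U u : test_function U u ->
  mu.-integrable setT (EFin \o u).
Proof.
move=> tu; have [r r0 ur] := test_function_cube tu.
have [M M0 uM] := test_function_bounded tu.
have mu_ := smooth_measurable (test_smooth tu).
have mc : measurable (ocube (0 : E) r) by exact: measurable_ocube.
rewrite (_ : EFin \o u = (EFin \o u) \_ (ocube 0 r)).
  apply: (integrable_mkcond _ mc).1.
  apply: measurable_bounded_integrable => //.
  - exact: lebesgue_rV_ocube_lty.
  - exact: measurable_funTS.
  - by exists M; split; [exact: num_real|move=> N MN x _ /=; rewrite (le_trans (uM x))// ltW].
apply/funext => x; rewrite /patch; case: ifPn => // /negP xr.
by rewrite /= ur// => h; apply: xr; rewrite inE.
Qed.

(* int zeta(x + t e_i) dx does not depend on t: differentiate at t = 0. *)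
Lemma integral_partial U u i : test_function U u -> \int[mu]_x partial i u x = 0.
Proof.
move=> tu; have tdu := test_function_partial i tu.
have [r r0 dur] := test_function_cube tdu.
have [M M0 duM] := test_function_bounded tdu.
have su := test_smooth tu.
pose f (t : R) (x : E) := u (x + t *: e_ i).
have dfE (t : R) (x : E) : is_derive t 1 (f ^~ x) (partial i u (x + t *: e_ i)).
  exact: (is_derive_line u x (e_ i) t _).1 (is_derive_smooth _ _ su).
have d1f (t : R) (x : E) : partial1of2 f t x = partial i u (x + t *: e_ i).
  by rewrite partial1of2E; have [] := dfE t x.
have intf t : mu.-integrable setT (EFin \o f t).
  exact: (integrable_translate _ (test_function_integrable tu)).
(* For |t| < 1 all the integrands [partial i u (x + t *: e_ i)] vanish outside this larger cube and
   are bounded by [M]: this is the domination. *)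
have mc : measurable (ocube (0 : E) (r + 1)) by exact: measurable_ocube.
rewrite (@eq_Rintegral _ _ _ mu setT (fun x => partial1of2 f 0 x)); last first.
  by move=> x _; rewrite d1f scale0r addr0.
rewrite -(@differentiation_under_integral R _ _ mu f setT measurableT 0 (-1) 1 _ _ _
  (fun x => M * \1_(ocube 0 (r + 1)) x))//.
- rewrite (_ : (fun _ => _) = cst (\int[mu]_x u x)) ?derive1_cst//.
  by apply/funext => t; apply: Rintegral_translate; exact: test_function_integrable tu.
- rewrite /= in_itv/=; apply/andP; split; lra.
- by move=> x; rewrite mulr_ge0.
- apply: (@integrableZl _ _ _ _ _ _ M (EFin \o \1_(ocube 0 (r + 1)))) => //.
  apply/integrableP; split; first exact/measurable_EFinP.
  rewrite (eq_integral (fun x => (\1_(ocube (0 : E) (r + 1)) x)%:E)); last first.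
    by move=> y _; rewrite gee0_abs// lee_fin.
  rewrite integral_indic// setIT.
  by apply: lebesgue_rV_ocube_lty; rewrite ltr_wpDl// ltW.
- move=> t x; rewrite /= in_itv/= => /andP[t1 t2] _; rewrite d1f indicE.
  have [xr|xr] := boolP (x \in ocube 0 (r + 1)); first by rewrite mulr1.
  rewrite mulr0 dur ?normr0// => h; move/negP: xr; apply; rewrite inE => j.
  have := h j; rewrite !mxE !subr0 => hj.
  rewrite -[x ord0 j](addrK (t * (j == i)%:R)) (le_lt_trans (ler_normB _ _))//.
  rewrite ltr_leD// normrM normr_nat; case: (j == i); rewrite ?mulr1 ?mulr0//.
  by rewrite ler_norml !ltW.
Qed.

End test_functions.

(** * Real-valued integrals and the fundamental lemma *)

Section real_integrals.
Context {R : realType} d (T : measurableType d) (mu : {measure set T -> \bar R}).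
Variables (D : set T) (mD : measurable D).
Implicit Types f g h : T -> R.
Local Notation integ f := (mu.-integrable D (EFin \o f)).

Lemma integ_measurable f : integ f -> measurable_fun D f.
Proof. by move=> /integrableP[/measurable_EFinP]. Qed.

Lemma integM h g (C : R) : integ h -> measurable_fun D g ->
  (forall x, D x -> `|g x| <= C) -> integ (fun x => h x * g x).
Proof.
move=> ih mg gC; rewrite (_ : EFin \o _ = (EFin \o h) \* (EFin \o g))%E//.
apply: integrableMl => //; exists C; split; first exact: num_real.
by move=> M CM x Dx /=; rewrite (le_trans (gC x Dx))// ltW.
Qed.

Lemma integD f g : integ f -> integ g -> integ (fun x => f x + g x).
Proof. by move=> hf hg; exact: (integrableD mD hf hg). Qed.

Lemma integZ (a : R) f : integ f -> integ (fun x => a * f x).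
Proof. by move=> hf; exact: (integrableZl mD a hf). Qed.

Lemma integB f g : integ f -> integ g -> integ (fun x => f x - g x).
Proof. by move=> hf hg; exact: (integrableB mD hf hg). Qed.

Lemma integN f : integ f -> integ (fun x => - f x).
Proof. by move=> hf; exact: (integrableN hf). Qed.

Lemma integ0 : integ (fun=> 0).
Proof. exact: integrable0. Qed.

Lemma integ_norm f : integ f -> integ (fun x => `|f x|).
Proof. by move=> hf; exact: (integrable_norm hf). Qed.

Lemma integ_le f g : integ g -> measurable_fun D f ->
  (forall x, D x -> `|f x| <= g x) -> integ f.
Proof.
move=> ig mf fg; apply: le_integrable ig => //; first exact/measurable_EFinP.
by move=> x Dx /=; rewrite lee_fin (le_trans (fg x Dx))// ler_norm.
Qed.

Lemma integ_sum (I : finType) (F : I -> T -> R) : (forall i, integ (F i)) ->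
  integ (fun x => \sum_i F i x).
Proof.
move=> iF; rewrite (_ : EFin \o _ = (fun x => \sum_i (F i x)%:E)%E); last first.
  by apply/funext => x; rewrite /= sumEFin.
by apply: (integrable_sum mD) => i _; exact: iF.
Qed.

Lemma Rintegral_sum (I : finType) (F : I -> T -> R) : (forall i, integ (F i)) ->
  \int[mu]_(x in D) (\sum_i F i x) = \sum_i \int[mu]_(x in D) F i x.
Proof.
move=> iF; rewrite /Rintegral.
under eq_integral do rewrite -sumEFin.
rewrite integral_sum//.
by apply/esym/sum_fine => i _; apply: integrable_fin_num => //; exact: iF.
Qed.

Lemma RintegralN f : integ f ->
  \int[mu]_(x in D) (- f x) = - \int[mu]_(x in D) f x.
Proof.
move=> hf; under eq_Rintegral do rewrite -mulN1r.
by rewrite RintegralZl// mulN1r.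
Qed.

Lemma ae_eq_Rintegral f g : measurable_fun D f -> measurable_fun D g ->
  {ae mu, forall x, D x -> f x = g x} ->
  \int[mu]_(x in D) f x = \int[mu]_(x in D) g x.
Proof.
move=> mf mg fg; congr fine; apply: ae_eq_integral => //; [exact/measurable_EFinP..|].
by apply: filterS fg => x /= h /h ->.
Qed.

Lemma ae_le_Rintegral f g : integ f -> integ g ->
  {ae mu, forall x, D x -> f x <= g x} ->
  \int[mu]_(x in D) f x <= \int[mu]_(x in D) g x.
Proof.
move=> hf hg fg.
have mf := integ_measurable hf; have mg := integ_measurable hg.
(* Replacing [g] by the maximum, equal to it almost everywhere, reduces to an inequality valid
   everywhere. *)
pose k x := Num.max (f x) (g x).
have mk : measurable_fun D k by exact: measurable_maxr.
have gk : {ae mu, forall x, D x -> g x = k x}.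
  by apply: filterS fg => x h /h; rewrite /k; case: (leP (f x) (g x)).
rewrite (ae_eq_Rintegral mg mk gk); apply: le_Rintegral => //.
  apply: (@integ_le k (fun x => `|f x| + `|g x|)) => //.
    by apply: integD; exact: integ_norm.
  by move=> x Dx; rewrite /k; case: (leP (f x) (g x)) => _; rewrite ?lerDr ?lerDl ?normr_ge0.
by move=> x Dx; rewrite /k le_max lexx.
Qed.

Lemma ae_ge0_Rintegral f : integ f ->
  {ae mu, forall x, D x -> 0 <= f x} -> 0 <= \int[mu]_(x in D) f x.
Proof.
move=> hf fg; have <- : \int[mu]_(x in D) 0 = 0 :> R.
  by rewrite /Rintegral integral0.
by apply: ae_le_Rintegral => //; exact: integ0.
Qed.

Lemma ae_eq0_Rintegral f : integ f -> {ae mu, forall x, D x -> 0 <= f x} ->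
  \int[mu]_(x in D) f x <= 0 -> {ae mu, forall x, D x -> f x = 0}.
Proof.
move=> hf f0 int0; have mf := integ_measurable hf.
have nf : \int[mu]_(x in D) `|f x| = 0.
  apply/eqP; rewrite eq_le Rintegral_ge0// andbT (le_trans _ int0)//.
  apply: ae_le_Rintegral => //; first exact: integ_norm.
  by apply: filterS f0 => x h /h /ger0_norm ->.
have : (\int[mu]_(x in D) `|(EFin \o f) x|)%E = 0%E.
  have := nf; rewrite /Rintegral => h.
  rewrite -[LHS]fineK//; first by rewrite h.
  exact: (integrable_fin_num mD (integ_norm hf)).
move/(ae_eq_integral_abs mu mD) => h.
have := h ((measurable_EFinP _ _).2 mf).
by apply: filterS => x /= hx /hx[].
Qed.

Lemma dominated_cvg_Rintegral (f_ : nat -> T -> R) f g :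
  (forall n, measurable_fun D (f_ n)) -> measurable_fun D f -> integ g ->
  {ae mu, forall x, D x -> f_ n x @[n --> \oo] --> f x} ->
  (forall n x, D x -> `|f_ n x| <= g x) ->
  \int[mu]_(x in D) f_ n x @[n --> \oo] --> \int[mu]_(x in D) f x.
Proof.
move=> mf_ mf ig cf fg.
have [|||||iff _ h] := @dominated_convergence _ _ _ mu D mD
   (fun n x => (f_ n x)%:E) (EFin \o f) (EFin \o g).
- by move=> n; exact/measurable_EFinP.
- exact/measurable_EFinP.
- by apply: filterS cf => x h Dx; apply: cvg_EFin; [exact: nearW|exact: h].
- exact: ig.
- by apply: aeW => x n Dx; rewrite /= lee_fin fg.
- apply: fine_cvg; rewrite fineK//; exact: (integrable_fin_num mD iff).
Qed.

End real_integrals.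

(** * Smooth bumps on cubes *)

Section bump.
Context {R : realType} {n : nat}.
Local Notation E := 'rV[R]_n.

(** Positive exactly when |t| < r. The product over the coordinates in [bumpv] is therefore positive
    exactly on an open cube, the shape delivered by [open_rV_cover]. *)
Definition bump (r t : R) : R := flat 0 (r + t) * flat 0 (r - t).

Definition bumpv (c : E) (r : R) (x : E) : R :=
  \prod_i bump r (x ord0 i - c ord0 i).

Lemma bump_ge0 r t : 0 <= bump r t.
Proof. by rewrite mulr_ge0 ?flat_ge0. Qed.

Lemma bump_le1 r t : bump r t <= 1.
Proof.
rewrite mulr_ile1 ?flat_ge0//.
  by have := @flat_le R 0 (r + t); rewrite expr0.
by have := @flat_le R 0 (r - t); rewrite expr0.
Qed.

Lemma bump_gt0 r t : `|t| < r -> 0 < bump r t.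
Proof.
by rewrite ltr_norml => /andP[h1 h2]; rewrite mulr_gt0 ?flat_gt0//; lra.
Qed.

Lemma bump_eq0 r t : r <= `|t| -> bump r t = 0.
Proof.
rewrite ler_normr => /orP[h|h].
  by rewrite /bump [X in _ * X]flat_eq0 ?mulr0// subr_le0.
by rewrite /bump flat_eq0 ?mul0r//; lra.
Qed.

Lemma bumpv_ge0 c r x : 0 <= bumpv c r x.
Proof. by apply: prodr_ge0 => i _; exact: bump_ge0. Qed.

Lemma bumpv_le1 c r x : bumpv c r x <= 1.
Proof. by apply: prodr_ile1 => i _; rewrite bump_ge0 bump_le1. Qed.

Lemma bumpv_gt0 c r x : ocube c r x -> 0 < bumpv c r x.
Proof. by move=> h; apply: prodr_gt0 => i _; exact/bump_gt0/h. Qed.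

Lemma bumpv_eq0 c r x : ~ ocube c r x -> bumpv c r x = 0.
Proof.
move=> /existsNP[i /negP]; rewrite -leNgt => h.
by rewrite /bumpv (bigD1 i)//= bump_eq0 ?mul0r.
Qed.

Lemma sg_prod (I : Type) (s : seq I) (F : I -> E -> R) :
  (forall i, smooth_gen (F i)) -> smooth_gen (fun x => \prod_(i <- s) F i x).
Proof.
move=> gF; elim: s => [|i s IH].
  by under eq_fun do rewrite big_nil; exact: sg_cst.
by under eq_fun do rewrite big_cons; exact: sg_mul.
Qed.

Lemma sg_affine (a b : R) i : smooth_gen (fun x : E => a + b * x ord0 i).
Proof.
apply: sg_add; first exact: sg_cst.
by apply: sg_mul; [exact: sg_cst|exact: sg_coord].
Qed.

Lemma smooth_bumpv c r : smooth (bumpv c r).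
Proof.
apply/smooth_genP/sg_prod => i; apply: sg_mul; apply: sg_flat.
  rewrite (_ : (fun x : E => _) = (fun x : E => (r - c ord0 i) + 1 * x ord0 i)).
    exact: sg_affine.
  by apply/funext => x; ring.
rewrite (_ : (fun x : E => _) = (fun x : E => (r + c ord0 i) + (-1) * x ord0 i)).
  exact: sg_affine.
by apply/funext => x; ring.
Qed.

Lemma compact_ccube (c : E) r : compact (ccube c r).
Proof.
rewrite (_ : ccube c r = [set v : E | forall i, `[c ord0 i - r, c ord0 i + r]%classic (v ord0 i)]).
  exact: (@rV_compact R n (fun i => `[c ord0 i - r, c ord0 i + r]%classic)
    (fun i => @segment_compact R _ _)).
by apply/seteqP; split=> x /= h i; have := h i; rewrite in_itv/= ler_distl.
Qed.

Lemma test_bumpv U c r : ccube c r `<=` U -> test_function U (bumpv c r).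
Proof.
move=> QU; split; first exact: smooth_bumpv.
exists (ccube c r); split=> //; first exact: compact_ccube.
by move=> x h; apply: bumpv_eq0; apply: contra_not h => h i; exact/ltW/h.
Qed.

End bump.

(** * Signs of functions tested against smooth functions *)

Section fundamental_lemma.
Context {R : realType} {n : nat}.
Local Notation E := 'rV[R]_n.
Local Notation mu := (lebesgue_rV n : {measure set 'rV[R]_n -> \bar R}).
Variables (V : set E) (mV : measurable V).
Local Notation integ f := (mu.-integrable V (EFin \o f)).

Section approx.
Variable h : E -> R.
Hypothesis ih : integ h.

Let err (g k : E -> R) := \int[mu]_(x in V) (`|h x| * `|g x - k x|).

Let unit_range (g : E -> R) := forall x, 0 <= g x <= 1.

Let bdd g k x : unit_range g -> unit_range k -> `| `|g x - k x| | <= 1.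
Proof.
move=> /(_ x)/andP[? ?] /(_ x)/andP[? ?].
by rewrite normr_id ler_norml; apply/andP; split; lra.
Qed.

Let ierr g k : unit_range g -> unit_range k ->
  measurable_fun setT g -> measurable_fun setT k ->
  integ (fun x => `|h x| * `|g x - k x|).
Proof.
move=> ug uk mg mk; apply: (integM mV (C := 1)); first exact: integ_norm.
  by apply: measurable_funTS; apply: measurableT_comp => //; exact: measurable_funB.
by move=> x _; exact: bdd.
Qed.

Let unit_indic (A : set E) : unit_range \1_A.
Proof. by move=> x; rewrite indicE; case: (_ \in _); rewrite /= ?lexx ?ler01. Qed.

(* Sets whose indicator is a limit, in L1 for the finite measure |h| dx, of
   smooth functions with values in [0, 1]; they form a sigma-algebra. *)
Definition smooth_approx (A : set E) := measurable A /\
  forall eps, 0 < eps -> exists2 rho, smooth rho /\ unit_range rho & err rho \1_A < eps.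

Let err_triangle f g k : unit_range f -> unit_range g -> unit_range k ->
  measurable_fun setT f -> measurable_fun setT g -> measurable_fun setT k ->
  err f k <= err f g + err g k.
Proof.
move=> uf ug uk mf mg mk; rewrite /err -RintegralD//; [|exact: ierr..].
apply: le_Rintegral => //; first exact: ierr.
  by apply: integD => //; exact: ierr.
by move=> x _; rewrite -mulrDr ler_wpM2l// (le_trans _ (ler_normD _ _))// addrA subrK.
Qed.

Let approxC A : smooth_approx A -> smooth_approx (~` A).
Proof.
move=> [mA hA]; split=> [|eps /hA[rho [sr ur] re]]; first exact: measurableC.
exists (fun x => 1 + (-1) * rho x); first split.
- apply/smooth_genP/sg_add; first exact: sg_cst.
  by apply: sg_mul; [exact: sg_cst|exact: sg_smooth].
- by move=> x; have := ur x; rewrite mulN1r; lra.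
apply: le_lt_trans re; apply: le_Rintegral => //; first last.
- move=> x _; rewrite (_ : `|_ - \1_(~` A) x| = `|rho x - \1_A x|)//.
  rewrite !indicE in_setC; case: (x \in A) => /=; rewrite ?subr0.
    by rewrite -normrN; congr normr; ring.
  by rewrite -normrN; congr normr; ring.
- by apply: ierr => //; exact: smooth_measurable.
apply: ierr => //.
- by move=> x; have := ur x; rewrite mulN1r; lra.
- by apply: measurable_funD => //; apply: measurable_funM => //; exact: smooth_measurable.
- by apply: measurable_indic; exact: measurableC.
Qed.

Let approxI A B : smooth_approx A -> smooth_approx B -> smooth_approx (A `&` B).
Proof.
move=> [mA hA] [mB hB]; split=> [|eps e0]; first exact: measurableI.
have e20 : 0 < eps / 2 by rewrite divr_gt0.
have [rho [sr ur] re] := hA _ e20; have [sig [ss us] se] := hB _ e20.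
have mr := smooth_measurable sr; have ms := smooth_measurable ss.
exists (fun x => rho x * sig x); first split.
- by apply/smooth_genP/sg_mul; exact: sg_smooth.
- move=> x; have /andP[? ?] := ur x; have /andP[? ?] := us x.
  by rewrite mulr_ge0// mulr_ile1.
rewrite [ltRHS]splitr; apply: le_lt_trans (ltrD re se).
rewrite /err -RintegralD//; [|by apply: ierr => //; exact: measurable_indic..].
apply: le_Rintegral => //.
- apply: ierr => //.
  + move=> x; have /andP[? ?] := ur x; have /andP[? ?] := us x.
    by rewrite mulr_ge0// mulr_ile1.
  + exact: measurable_funM.
  + by apply: measurable_indic; exact: measurableI.
- by apply: integD => //; apply: ierr => //; exact: measurable_indic.
move=> x _; rewrite -mulrDr ler_wpM2l//.
have /andP[r0 r1] := ur x; have /andP[s0 s1] := us x.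
rewrite !indicE in_setI; set a := (_ \in A); set b := (_ \in B).
rewrite (_ : (a && b)%:R = a%:R * b%:R :> R); last by case: a; case: b; rewrite /= ?mulr0 ?mulr1.
have a1 : 0 <= (a%:R : R) <= 1 by case: a; rewrite /= ?lexx ?ler01.
rewrite (_ : _ - _ = (rho x - a%:R) * sig x + a%:R * (sig x - b%:R)); last by ring.
rewrite (le_trans (ler_normD _ _))// lerD// normrM.
  by rewrite ler_piMr// ger0_norm.
by case/andP: a1 => ? ?; rewrite ler_piMl// ger0_norm.
Qed.

(** Pointwise convergence of the indicators becomes convergence for |h| dx by dominated convergence;
    then the error of one [F k] and that of a smooth function close to it share eps. *)
Let approx_limit (F : nat -> set E) A : measurable A ->
  (forall k, smooth_approx (F k)) ->
  (forall x, \1_(F k) x @[k --> \oo] --> (\1_A x : R)) -> smooth_approx A.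
Proof.
move=> mA hF FA; split=> // eps e0.
have e20 : 0 < eps / 2 by rewrite divr_gt0.
have mF k : measurable (F k) := (hF k).1.
have : err \1_(F k) \1_A @[k --> \oo] --> \int[mu]_(x in V) 0.
  apply: (@dominated_cvg_Rintegral _ _ _ _ _ mV _ _ (fun x => `|h x|)).
  - by move=> k; apply: integ_measurable; apply: ierr => //; exact: measurable_indic.
  - exact: measurable_cst.
  - exact: integ_norm.
  - apply: aeW => x _; rewrite -(mulr0 `|h x|); apply: cvgM; first exact: cvg_cst.
    rewrite -[X in _ --> X](@normr0 R R); apply: cvg_norm.
    by rewrite -(subrr (\1_A x)); apply: cvgB; [exact: FA|exact: cvg_cst].
  - by move=> k x _; rewrite normrM normr_id ler_piMr// bdd.
rewrite (_ : \int[mu]_(x in V) 0 = 0 :> R); last by rewrite /Rintegral integral0.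
move=> /cvgrPdist_lt/(_ _ e20)[k _ /(_ k (leqnn _))].
rewrite sub0r normrN => hk; have [rho [sr ur] re] := (hF k).2 _ e20.
exists rho => //; apply: (@le_lt_trans _ _ (err rho \1_(F k) + err \1_(F k) \1_A)).
  by apply: err_triangle => //; [exact: smooth_measurable|exact: measurable_indic..].
by rewrite [ltRHS]splitr ltrD// (le_lt_trans (ler_norm _)).
Qed.

Let approx0 : smooth_approx set0.
Proof.
split=> // eps e0; exists (fun=> 0); first split.
- exact/smooth_genP/sg_cst.
- by move=> x; rewrite lexx ler01.
rewrite /err (_ : (fun x => _) = cst 0); last first.
  by apply/funext => x; rewrite indic0 subrr normr0 mulr0.
by rewrite /Rintegral integral0.
Qed.

Let approxU A B : smooth_approx A -> smooth_approx B -> smooth_approx (A `|` B).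
Proof.
by move=> hA hB; rewrite -[_ `|` _]setCK setCU; apply/approxC/approxI; exact: approxC.
Qed.

Let approx_bigcup (F : nat -> set E) : (forall k, smooth_approx (F k)) ->
  smooth_approx (\bigcup_k F k).
Proof.
move=> hF; apply: (@approx_limit (fun k => \big[setU/set0]_(i < k) F i)).
- by apply: bigcupT_measurable => k; exact: (hF k).1.
- move=> k; elim: k => [|k IH]; first by rewrite big_ord0; exact: approx0.
  by rewrite big_ord_recr/=; exact: approxU.
move=> x; rewrite indicE; have [|xF] := boolP (x \in _).
  rewrite inE => -[k _ Fk]; apply: cvg_near_cst; exists k.+1 => // m /= km.
  rewrite indicE mem_set// -bigcup_mkord; exists k => //.
apply: cvg_near_cst; apply: nearW => k; rewrite indicE memNset//.
by move=> Fx; move/negP: xF; apply; rewrite inE; exact: bigsetU_bigcup Fx.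
Qed.

Lemma smooth_approx_sigma : sigma_algebra setT smooth_approx.
Proof.
by split=> [|A|F]; [exact: approx0|rewrite setTD; exact: approxC|exact: approx_bigcup].
Qed.

(** With F = [flat 0 (x_i - a)], the quotients F / (F + 1/(k+1)) are smooth with values in [0, 1],
    vanish off the half-space and tend to 1 on it. *)
Let approx_halfspace i (a : R) : smooth_approx [set x : E | a < x ord0 i].
Proof.
have mh : measurable [set x : E | a < x ord0 i].
  rewrite (_ : mkset _ = @rV_coord R n i @^-1` `]a, +oo[%classic).
    by rewrite -[X in measurable X]setTI; apply: measurable_rV_coord.
  by apply/seteqP; split=> x /=; rewrite in_itv/= andbT.
split=> // eps e0.
pose den k (x : E) := flat 0 (x ord0 i - a) + k.+1%:R^-1.
have den0 k x : 0 < den k x by rewrite ltr_wpDl ?flat_ge0// invr_gt0.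
pose rho k (x : E) := flat 0 (x ord0 i - a) * (den k x)^-1.
have gf : smooth_gen (fun x : E => flat 0 (x ord0 i - a)).
  by apply: sg_flat; apply: sg_add; [exact: sg_coord|exact: sg_cst].
have sr k : smooth (rho k).
  apply/smooth_genP/sg_mul => //; apply: sg_inv => [x|]; first by rewrite gt_eqF.
  by apply: sg_add => //; exact: sg_cst.
have ur k : unit_range (rho k).
  move=> x; rewrite mulr_ge0 ?flat_ge0 ?invr_ge0 ?(ltW (den0 _ _))//=.
  by rewrite ler_pdivrMr// mul1r lerDl invr_ge0.
have : err (rho k) \1_[set x : E | a < x ord0 i] @[k --> \oo] --> \int[mu]_(x in V) 0.
  apply: (@dominated_cvg_Rintegral _ _ _ _ _ mV _ _ (fun x => `|h x|)).
  - by move=> k; apply: integ_measurable; apply: ierr => //; exact: smooth_measurable.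
  - exact: measurable_cst.
  - exact: integ_norm.
  - apply: aeW => x _; rewrite -(mulr0 `|h x|); apply: cvgM; first exact: cvg_cst.
    rewrite -[X in _ --> X](@normr0 R R); apply: cvg_norm.
    rewrite -(subrr (\1_[set x : E | a < x ord0 i] x)); apply: cvgB; last exact: cvg_cst.
    rewrite /rho /den indicE; have [xa|xa] := pselect (a < x ord0 i).
      rewrite mem_set//; have fp : 0 < flat 0 (x ord0 i - a) by rewrite flat_gt0// subr_gt0.
      rewrite -[1%:R](mulfV (lt0r_neq0 fp)); apply: cvgM; first exact: cvg_cst.
      apply: cvgV; first exact: lt0r_neq0.
      rewrite -[X in _ --> X]addr0; apply: cvgD; first exact: cvg_cst.
      exact: cvg_harmonic.
    rewrite memNset// flat_eq0 ?subr_le0 ?leNgt; last exact/negP.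
    by under eq_fun do rewrite mul0r; exact: cvg_cst.
  - by move=> k x _; rewrite normrM normr_id ler_piMr// bdd.
rewrite (_ : \int[mu]_(x in V) 0 = 0 :> R); last by rewrite /Rintegral integral0.
move=> /cvgrPdist_lt/(_ _ e0)[k _ /(_ k (leqnn _))].
rewrite sub0r normrN => hk; exists (rho k) => //.
exact: le_lt_trans (ler_norm _) hk.
Qed.

(** Two nested generations: the sigma-algebra of row vectors by the coordinates, and that of the
    line by the half-lines ]a, +oo[. *)
Lemma measurable_smooth_approx A : measurable A -> smooth_approx A.
Proof.
move: A; apply: smallest_sub; first exact: smooth_approx_sigma.
rewrite -bigcup_seq => _ [i _ [B + <-]]; rewrite setTI.
suff : measurable `<=` [set B : set R | smooth_approx (@rV_coord R n i @^-1` B)].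
  by apply.
move=> C; rewrite (_ : measurable C = (RGenOInfty.G (R:=R)).-sigma.-measurable C); last first.
  by rewrite -RGenOInfty.measurableE.
move: C; apply: smallest_sub.
  have [h0 hC hU] := smooth_approx_sigma; split => /=.
  - by rewrite preimage_set0.
  - by move=> C /hC; rewrite !setTD preimage_setC.
  - by move=> F hF; rewrite preimage_bigcup; exact: hU.
move=> _ [a ->] /=; have := approx_halfspace i a.
rewrite (_ : mkset _ = @rV_coord R n i @^-1` `]a, +oo[%classic)//.
by apply/seteqP; split=> x /=; rewrite in_itv/= andbT.
Qed.

Lemma smooth_nonneg_indic :
  (forall rho, smooth rho -> unit_range rho -> 0 <= \int[mu]_(x in V) (h x * rho x)) ->
  forall A, measurable A -> 0 <= \int[mu]_(x in V) (h x * \1_A x).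
Proof.
move=> h0 A mA; apply/ler_addgt0Pr => eps e0.
have [rho [sr ur] re] := (measurable_smooth_approx mA).2 _ e0.
have mr := smooth_measurable sr.
have i1 : integ (fun x => h x * rho x).
  apply: (integM mV ih (C := 1)); first exact: measurable_funTS.
  by move=> x _; have /andP[? ?] := ur x; rewrite ger0_norm.
have i2 : integ (fun x => h x * \1_A x).
  apply: (integM mV ih (C := 1)); first by apply: measurable_funTS; exact: measurable_indic.
  by move=> x _; have /andP[? ?] := @unit_indic A x; rewrite ger0_norm.
apply: le_trans (h0 _ sr ur) _; rewrite addrC -lerBlDr -RintegralB//.
apply: le_trans (ltW re); apply: le_Rintegral => //.
- exact: integB.
- by apply: ierr => //; exact: measurable_indic.
- by move=> x _; rewrite -mulrBr -normrM ler_norm.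
Qed.

End approx.

(** Nonnegativity is local, so work on one cube of the cover, with its bump b. The product of b with
    a smooth function valued in [0, 1] is an admissible phi, so m b has a nonnegative integral
    against all such functions, hence against the indicator of {m < 0}. *)
Lemma test_nonneg_ae (U : set E) (m : E -> R) : open U -> U `<=` V -> integ m ->
  (forall phi, test_function U phi -> (forall x, 0 <= phi x) ->
     0 <= \int[mu]_(x in V) (m x * phi x)) ->
  ae_on U (fun x => 0 <= m x).
Proof.
move=> oU UV im m0; have [F [UF FP]] := open_rV_cover oU.
have mm := integ_measurable im.
suff hF k : \forall x \ae mu, F k x -> 0 <= m x.
  have := ae_foralln hF; apply: filterS => x hx; rewrite UF => -[k _]; exact: hx.
have [->|[c [r [r0 -> QU]]]] := FP k; first by apply: aeW.
have tb := test_bumpv QU; set b := bumpv c r in tb.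
have sb := test_smooth tb.
pose h x := m x * b x.
have ih : integ h.
  apply: (integM mV im (C := 1)); first by apply: measurable_funTS; exact: smooth_measurable.
  by move=> x _; rewrite ger0_norm ?bumpv_ge0// bumpv_le1.
pose A := V `&` [set x | m x < 0].
have mA : measurable A.
  rewrite (_ : A = V `&` m @^-1` `]-oo, 0[%classic); first exact: mm.
  by apply/seteqP; split=> x /=; rewrite in_itv/=.
have iA : integ (fun x => h x * \1_A x).
  apply: (integM mV ih (C := 1)); first by apply: measurable_funTS; exact: measurable_indic.
  by move=> x _; rewrite indicE ger0_norm//; case: (_ \in _).
have : 0 <= \int[mu]_(x in V) (h x * \1_A x).
  apply: (smooth_nonneg_indic ih) => // rho sr ur; rewrite /h.
  under eq_Rintegral do rewrite -mulrA.
  apply: m0; first exact: test_functionM.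
  by move=> x; rewrite mulr_ge0 ?bumpv_ge0//; have /andP[] := ur x.
rewrite -oppr_le0 -RintegralN//.
have hA0 x : V x -> 0 <= - (h x * \1_A x).
  move=> Vx; rewrite indicE; have [|] := boolP (x \in A); last by rewrite mulr0 oppr0.
  by rewrite inE => -[_ /= mx]; rewrite mulr1 oppr_ge0 mulr_le0_ge0 ?bumpv_ge0 ?ltW.
move=> /(ae_eq0_Rintegral mV (integN iA) (aeW _ hA0)).
apply: filterS => x hx Qx; rewrite leNgt; apply/negP => mx.
have Vx : V x by apply/UV/QU => i; exact/ltW/Qx.
have := hx Vx; rewrite indicE mem_set// mulr1 => /eqP; rewrite oppr_eq0 mulf_eq0.
by rewrite (lt_eqF mx) (gt_eqF (bumpv_gt0 Qx)).
Qed.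

End fundamental_lemma.

(** * Euclidean norm and square-integrable fields *)

Section euclid.
Context {R : realType} {n : nat}.
Local Notation E := 'rV[R]_n.
Implicit Types (x y z : E).

(* Optimizing 2 b <= t p^2 + q^2 / t over t. *)
Lemma young_sharp (b p q : R) : 0 <= p -> 0 <= q ->
  (forall t, 0 < t -> 2 * b <= t * p ^+ 2 + t^-1 * q ^+ 2) -> b <= p * q.
Proof.
move=> p0 q0 h.
(* The optimum t = q / p is perturbed by eps because p or q may vanish. *)
have k eps : 0 < eps -> 2 * b <= 2 * (p * q) + eps * (p + q).
  move=> e0; have pe : 0 < p + eps by lra.
  have qe : 0 < q + eps by lra.
  apply: le_trans (h ((q + eps) / (p + eps)) _) _; first by rewrite divr_gt0.
  rewrite invf_div.
  have h1 : (q + eps) / (p + eps) * p ^+ 2 <= p * (q + eps).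
    have : 0 <= p * (q + eps) * eps by rewrite mulr_ge0 ?mulr_ge0 ?(ltW qe) ?(ltW e0).
    by move=> ?; rewrite mulrAC ler_pdivrMr//; lra.
  have h2 : (p + eps) / (q + eps) * q ^+ 2 <= q * (p + eps).
    have : 0 <= q * (p + eps) * eps by rewrite mulr_ge0 ?mulr_ge0 ?(ltW pe) ?(ltW e0).
    by move=> ?; rewrite mulrAC ler_pdivrMr//; lra.
  by lra.
rewrite leNgt; apply/negP => lt.
pose eps := (b - p * q) / (p + q + 1).
have e0 : 0 < eps by rewrite divr_gt0; lra.
have := k _ e0.
have : eps * (p + q + 1) = b - p * q by rewrite mulfVK//; lra.
by nra.
Qed.

Lemma dotvC x y : dotv x y = dotv y x.
Proof. by apply: eq_bigr => i _; rewrite mulrC. Qed.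

Lemma dotvDl x y z : dotv (x + y) z = dotv x z + dotv y z.
Proof. by rewrite -big_split; apply: eq_bigr => i _; rewrite !mxE mulrDl. Qed.

Lemma dotvDr x y z : dotv z (x + y) = dotv z x + dotv z y.
Proof. by rewrite dotvC dotvDl !(dotvC z). Qed.

Lemma dotvZl (a : R) x y : dotv (a *: x) y = a * dotv x y.
Proof. by rewrite mulr_sumr; apply: eq_bigr => i _; rewrite !mxE mulrA. Qed.

Lemma dotvZr (a : R) x y : dotv y (a *: x) = a * dotv y x.
Proof. by rewrite dotvC dotvZl dotvC. Qed.

Lemma dotvNl x y : dotv (- x) y = - dotv x y.
Proof. by rewrite -scaleN1r dotvZl mulN1r. Qed.

Lemma dotvNr x y : dotv y (- x) = - dotv y x.
Proof. by rewrite dotvC dotvNl dotvC. Qed.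

Lemma dotvBl x y z : dotv (x - y) z = dotv x z - dotv y z.
Proof. by rewrite dotvDl dotvNl. Qed.

Lemma dotvBr x y z : dotv z (x - y) = dotv z x - dotv z y.
Proof. by rewrite dotvDr dotvNr. Qed.

Lemma dotv0l x : dotv 0 x = 0.
Proof. by rewrite -(scale0r 0) dotvZl mul0r. Qed.

Lemma dotv_ge0 x : 0 <= dotv x x.
Proof. by apply: sumr_ge0 => i _; rewrite -expr2 sqr_ge0. Qed.

Lemma dotv_eq0 x : dotv x x = 0 -> x = 0.
Proof.
move=> /eqP; rewrite psumr_eq0 => [/allP h|i _]; last by rewrite -expr2 sqr_ge0.
apply/rowP => i; rewrite mxE; apply/eqP.
by have := h i (mem_index_enum _); rewrite mulf_eq0 orbb.
Qed.

Lemma enorm_ge0 x : 0 <= enorm x. Proof. exact: sqrtr_ge0. Qed.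

Lemma enorm_sqr x : enorm x ^+ 2 = dotv x x.
Proof. by rewrite sqr_sqrtr// dotv_ge0. Qed.

Lemma enormZ (a : R) x : enorm (a *: x) = `|a| * enorm x.
Proof.
rewrite /enorm dotvZl dotvZr mulrA -expr2 sqrtrM ?sqr_ge0//.
by rewrite sqrtr_sqr.
Qed.

Lemma enormN x : enorm (- x) = enorm x.
Proof. by rewrite -scaleN1r enormZ normrN1 mul1r. Qed.

Lemma dotv_le x y : dotv x y <= enorm x * enorm y.
Proof.
apply: young_sharp; [exact: enorm_ge0..|move=> t t0].
have := dotv_ge0 (t *: x - y); rewrite dotvBl !dotvBr !dotvZl !dotvZr (dotvC y x).
rewrite !enorm_sqr => h.
rewrite -(ler_pM2l t0) mulrDr (mulrA t t^-1) mulfV ?gt_eqF// mul1r; lra.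
Qed.

Lemma dotv_norm_le x y : `|dotv x y| <= enorm x * enorm y.
Proof.
rewrite ler_norml dotv_le andbT lerNl -dotvNl.
by rewrite (le_trans (dotv_le _ _))// enormN.
Qed.

Lemma enormD x y : enorm (x + y) <= enorm x + enorm y.
Proof.
rewrite -(@ler_pXn2r _ 2)// ?nnegrE ?enorm_ge0 ?addr_ge0 ?enorm_ge0//.
rewrite enorm_sqr dotvDl !dotvDr sqrrD !enorm_sqr (dotvC y x).
have := dotv_le x y; lra.
Qed.

Lemma coord_le_enorm x i : `|x ord0 i| <= enorm x.
Proof.
rewrite -(@ler_pXn2r _ 2)// ?nnegrE ?enorm_ge0 ?normr_ge0//.
rewrite enorm_sqr real_normK ?num_real// /dotv (bigD1 i)//= -expr2 lerDl.
by apply: sumr_ge0 => j _; rewrite -expr2 sqr_ge0.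
Qed.

Lemma enorm_le_sum x : enorm x <= \sum_i `|x ord0 i|.
Proof.
rewrite -(@ler_pXn2r _ 2)// ?nnegrE ?enorm_ge0 ?sumr_ge0//.
rewrite enorm_sqr /dotv expr2 mulr_suml; apply: ler_sum => i _.
rewrite (le_trans (ler_norm _))// normrM ler_wpM2l// (bigD1 i)//= lerDl.
by apply: sumr_ge0 => j _.
Qed.

End euclid.

Section L2_theory.
Context {R : realType} {n : nat}.
Local Notation E := 'rV[R]_n.
Local Notation mu := (lebesgue_rV n : {measure set 'rV[R]_n -> \bar R}).
Variables (V : set E) (mV : measurable V).
Implicit Types (u v w : E -> R) (F G : E -> E).
Local Notation integ f := (mu.-integrable V (EFin \o f)).

Lemma L2P u : L2 V u <-> measurable_fun V u /\ integ (fun x => u x ^+ 2).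
Proof.
have sq x : ((u \_ V) x ^+ 2)%:E = ((EFin \o (fun x => u x ^+ 2)) \_ V) x.
  by rewrite /patch; case: ifP => // _; rewrite expr0n.
split=> [h|[mu_ iu]].
  split; first by apply/(measurable_restrictT _ mV); have /sub_Lfun_mfun := h; rewrite inE.
  apply: (integrable_mkcond _ mV).2; have := Lfun2_integrable_sqr h.
  by congr (_.-integrable _ _); apply/funext => x; exact: sq.
rewrite /L2 inE; apply/andP; split; first by rewrite inE/=; apply/(measurable_restrictT _ mV).
rewrite inE /finite_norm unlock /= poweR_lty//.
move: iu => /(integrable_mkcond _ mV).1 /integrableP[_].
congr (_ < _)%E; apply: eq_integral => x _.
by rewrite -sq /= !powR_mulrn// normrX.
Qed.

Lemma L2_measurable u : L2 V u -> measurable_fun V u.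
Proof. by move=> /L2P[]. Qed.

Lemma L2_sqr u : L2 V u -> integ (fun x => u x ^+ 2).
Proof. by move=> /L2P[]. Qed.

Lemma L2norm_ge0 u : 0 <= L2norm V u.
Proof. by rewrite fine_ge0// Lnorm_ge0. Qed.

Lemma L2norm_sqr u : L2 V u -> L2norm V u ^+ 2 = \int[mu]_(x in V) (u x ^+ 2).
Proof.
move=> /[dup] hu /L2P[mu_ iu].
have fN : ('N[mu]_2%:E[EFin \o (u \_ V)] \is a fin_num)%E.
  rewrite ge0_fin_numE ?Lnorm_ge0//.
  by have /sub_Lfun_finLfun := hu; rewrite inE.
have n2 : (2 : R) != 0 by rewrite pnatr_eq0.
have := @powR_Lnorm _ _ _ mu (EFin \o (u \_ V)) 2 n2.
rewrite -(fineK fN) poweR_EFin powR_mulrn ?fine_ge0 ?Lnorm_ge0// => h.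
apply: EFin_inj; rewrite /L2norm h /Rintegral fineK; last exact: (integrable_fin_num mV iu).
rewrite [in RHS]integral_mkcond.
apply: eq_integral => x _; rewrite /patch/=; case: ifP => _.
  by rewrite /= powR_mulrn// real_normK ?num_real.
by rewrite /= normr0 powR0 ?pnatr_eq0.
Qed.

End L2_theory.

Section L2_norms.
Context {R : realType} {n : nat}.
Local Notation E := 'rV[R]_n.
Local Notation mu := (lebesgue_rV n : {measure set 'rV[R]_n -> \bar R}).
Variables (V : set E) (mV : measurable V).
Implicit Types (u v w : E -> R) (F G : E -> E).
Local Notation integ f := (mu.-integrable V (EFin \o f)).

Lemma ae_onS (P Q : E -> Prop) : (forall x, V x -> P x -> Q x) -> ae_on V P -> ae_on V Q.
Proof.
by move=> PQ; rewrite /ae_on; apply: filterS => x h Vx; exact: PQ _ (h Vx).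
Qed.

Lemma ae_onI (P Q : E -> Prop) : ae_on V P -> ae_on V Q -> ae_on V (fun x => P x /\ Q x).
Proof.
rewrite /ae_on => hP hQ; apply: filterS2 hP hQ => x h1 h2 Vx.
by split; [exact: h1|exact: h2].
Qed.

Lemma ae_onW (P : E -> Prop) : (forall x, V x -> P x) -> ae_on V P.
Proof. by move=> h; apply: aeW. Qed.

Lemma L2_integM u v : L2 V u -> L2 V v -> integ (fun x => u x * v x).
Proof.
move=> /(L2P mV)[mu_ iu] /(L2P mV)[mv iv].
apply: (@integ_le _ _ _ _ _ mV _ (fun x => u x ^+ 2 + v x ^+ 2)).
- exact: integD.
- exact: measurable_funM.
move=> x _; rewrite normrM -[u x ^+ 2]real_normK ?num_real// -[v x ^+ 2]real_normK ?num_real//.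
by have := sqr_ge0 (`|u x| - `|v x|); nra.
Qed.

Lemma L2_le u v : L2 V v -> measurable_fun V u ->
  (forall x, V x -> `|u x| <= `|v x|) -> L2 V u.
Proof.
move=> /(L2P mV)[mv iv] mu_ uv; apply/(L2P mV); split=> //.
apply: (integ_le mV iv); first exact: measurable_funX.
move=> x Vx; rewrite normrX -[v x ^+ 2]real_normK ?num_real//.
by rewrite lerXn2r ?nnegrE ?normr_ge0// uv.
Qed.

Lemma L2D u v : L2 V u -> L2 V v -> L2 V (fun x => u x + v x).
Proof.
move=> hu hv; have [mu_ iu] := (L2P mV u).1 hu; have [mv iv] := (L2P mV v).1 hv.
apply/(L2P mV); split; first exact: measurable_funD.
have iuv := L2_integM hu hv.
have := integD mV (integD mV iu (integZ mV 2 iuv)) iv.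
by congr (_.-integrable _ _); apply/funext => x /=; congr EFin; ring.
Qed.

Lemma L2Z (a : R) u : L2 V u -> L2 V (fun x => a * u x).
Proof.
move=> /(L2P mV)[mu_ iu]; apply/(L2P mV); split; first exact: measurable_funM.
have := integZ mV (a ^+ 2) iu.
by congr (_.-integrable _ _); apply/funext => x /=; rewrite exprMn.
Qed.

Lemma L2N u : L2 V u -> L2 V (fun x => - u x).
Proof.
by move=> /(L2Z (-1)); rewrite (_ : (fun x => _) = (fun x => - u x))//; apply/funext => x; rewrite mulN1r.
Qed.

Lemma L2B u v : L2 V u -> L2 V v -> L2 V (fun x => u x - v x).
Proof. by move=> hu /L2N hv; exact: L2D. Qed.

Lemma L2_norm u : L2 V u -> L2 V (fun x => `|u x|).
Proof.
move=> hu; apply: (L2_le hu); last by move=> x _; rewrite normr_id.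
by apply: measurableT_comp => //; exact: (L2_measurable mV).
Qed.

Lemma L2_bdd u v (C : R) : L2 V u -> measurable_fun V v ->
  (forall x, V x -> `|v x| <= C) -> L2 V (fun x => u x * v x).
Proof.
move=> hu mv vC; have [mu_ _] := (L2P mV u).1 hu.
apply: (@L2_le _ (fun x => C * u x)); first exact: L2Z.
  exact: measurable_funM.
move=> x Vx; rewrite !normrM mulrC ler_wpM2r// (le_trans (vC x Vx))// ler_norm//.
Qed.

Lemma L2_cst (c : R) : (mu V < +oo)%E -> L2 V (fun=> c).
Proof.
move=> Voo; apply/(L2P mV); split=> //.
apply: measurable_bounded_integrable => //; exact: bounded_cst.
Qed.

Lemma L2_integ u : (mu V < +oo)%E -> L2 V u -> integ u.
Proof.
move=> Voo hu; have := L2_integM hu (L2_cst 1 Voo).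
by congr (_.-integrable _ _); apply/funext => x /=; rewrite mulr1.
Qed.

Lemma L2_bounded u (C : R) : (mu V < +oo)%E -> measurable_fun V u ->
  (forall x, V x -> `|u x| <= C) -> L2 V u.
Proof.
move=> Voo mu_ uC; have := L2_bdd (L2_cst 1 Voo) mu_ uC.
by under eq_fun do rewrite mul1r.
Qed.

Lemma L2_CS_norm u v : L2 V u -> L2 V v ->
  \int[mu]_(x in V) `|u x * v x| <= L2norm V u * L2norm V v.
Proof.
move=> hu hv; have [mu_ iu] := (L2P mV u).1 hu; have [mv iv] := (L2P mV v).1 hv.
have iuv := integ_norm (L2_integM hu hv).
apply: young_sharp; [exact: L2norm_ge0..|move=> t t0].
rewrite !L2norm_sqr// -!RintegralZl//.
rewrite -RintegralD//; [|exact: integZ..].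
apply: le_Rintegral => //; [exact: integZ|by apply: integD => //; exact: integZ|].
move=> x _; rewrite normrM -[u x ^+ 2]real_normK ?num_real// -[v x ^+ 2]real_normK ?num_real//.
set a := `|u x|; set b := `|v x|.
have := sqr_ge0 (t * a - b); rewrite sqrrB => h.
rewrite -(ler_pM2l t0) mulrDr (mulrA t t^-1) mulfV ?gt_eqF// mul1r; nra.
Qed.

Lemma L2_CS u v : L2 V u -> L2 V v ->
  `|\int[mu]_(x in V) (u x * v x)| <= L2norm V u * L2norm V v.
Proof.
move=> hu hv; apply: le_trans (L2_CS_norm hu hv).
by apply: le_normr_Rintegral => //; exact: L2_integM.
Qed.

Lemma L2norm_le_sqr u (C : R) : L2 V u -> 0 <= C ->
  \int[mu]_(x in V) (u x ^+ 2) <= C ^+ 2 -> L2norm V u <= C.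
Proof.
move=> hu C0 h; rewrite -(@ler_pXn2r _ 2)// ?nnegrE ?L2norm_ge0//.
by rewrite L2norm_sqr.
Qed.

Lemma L2normD u v : L2 V u -> L2 V v ->
  L2norm V (fun x => u x + v x) <= L2norm V u + L2norm V v.
Proof.
move=> hu hv; have [mu_ iu] := (L2P mV u).1 hu; have [mv iv] := (L2P mV v).1 hv.
apply: L2norm_le_sqr; [exact: L2D|by rewrite addr_ge0 ?L2norm_ge0|].
have iuv := L2_integM hu hv.
rewrite (@eq_Rintegral _ _ _ mu V (fun x => (u x ^+ 2 + 2 * (u x * v x)) + v x ^+ 2)); last first.
  by move=> x _; ring.
rewrite !RintegralD//; [|exact: integZ|by apply: integD => //; exact: integZ].
rewrite RintegralZl// -!L2norm_sqr//.
by have := L2_CS hu hv; rewrite ler_norml => /andP[_ h]; nra.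
Qed.

Lemma L2norm_ae u v : L2 V u -> L2 V v -> ae_on V (fun x => u x = v x) ->
  L2norm V u = L2norm V v.
Proof.
move=> hu hv uv; apply/eqP; rewrite -(@eqrXn2 _ 2)// ?L2norm_ge0//; apply/eqP.
rewrite !L2norm_sqr//; apply: ae_eq_Rintegral => //.
- by apply: measurable_funX; exact: (L2_measurable mV).
- by apply: measurable_funX; exact: (L2_measurable mV).
- by apply: ae_onS uv => x _ ->.
Qed.

Lemma L2norm_le u v : L2 V u -> L2 V v -> ae_on V (fun x => `|u x| <= `|v x|) ->
  L2norm V u <= L2norm V v.
Proof.
move=> hu hv uv; apply: L2norm_le_sqr => //; first exact: L2norm_ge0.
rewrite L2norm_sqr//; apply: ae_le_Rintegral => //; [exact: L2_sqr..|].
apply: ae_onS uv => x _ h.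
rewrite -[u x ^+ 2]real_normK ?num_real// -[v x ^+ 2]real_normK ?num_real//.
by rewrite lerXn2r ?nnegrE ?normr_ge0.
Qed.

Lemma L2normZ (a : R) u : L2 V u -> L2norm V (fun x => a * u x) = `|a| * L2norm V u.
Proof.
move=> hu; apply/eqP; rewrite -(@eqrXn2 _ 2)// ?mulr_ge0 ?L2norm_ge0//; apply/eqP.
rewrite exprMn !L2norm_sqr//; last exact: L2Z.
rewrite real_normK ?num_real// -RintegralZl//; last exact: L2_sqr.
by apply: eq_Rintegral => x _; rewrite exprMn.
Qed.

Lemma L2normN u : L2 V u -> L2norm V (fun x => - u x) = L2norm V u.
Proof.
move=> hu; rewrite -[RHS]mul1r -(normrN1 R) -L2normZ//; congr L2norm.
by apply/funext => x; rewrite mulN1r.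
Qed.

Lemma L2_dotv F G : L2v V F -> L2v V G -> integ (fun x => dotv (F x) (G x)).
Proof. by move=> hF hG; apply: integ_sum => // i; exact: L2_integM. Qed.

Lemma L2v_enorm F : L2v V F -> L2 V (fun x => enorm (F x)).
Proof.
move=> hF; apply/(L2P mV); split; last first.
  have := L2_dotv hF hF.
  by congr (_.-integrable _ _); apply/funext => x /=; rewrite enorm_sqr.
apply: (@measurableT_comp _ _ _ _ _ _ (@Num.sqrt R)).
  by have := continuous_measurable_fun (@sqrt_continuous R).
exact: (integ_measurable (L2_dotv hF hF)).
Qed.

Lemma L2vD F G : L2v V F -> L2v V G -> L2v V (fun x => F x + G x).
Proof.
by move=> hF hG i; under eq_fun do rewrite mxE; exact: L2D.
Qed.

Lemma L2vN F : L2v V F -> L2v V (fun x => - F x).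
Proof. by move=> hF i; under eq_fun do rewrite mxE; exact: L2N. Qed.

Lemma L2vB F G : L2v V F -> L2v V G -> L2v V (fun x => F x - G x).
Proof. by move=> hF /L2vN; exact: L2vD. Qed.

Lemma L2normv_ge0 F : 0 <= L2normv V F.
Proof. exact: L2norm_ge0. Qed.

Lemma L2normv_sqr F : L2v V F ->
  L2normv V F ^+ 2 = \int[mu]_(x in V) dotv (F x) (F x).
Proof.
move=> hF; rewrite L2norm_sqr//; last exact: L2v_enorm.
by apply: eq_Rintegral => x _; rewrite enorm_sqr.
Qed.

Lemma L2v_CS F G : L2v V F -> L2v V G ->
  `|\int[mu]_(x in V) dotv (F x) (G x)| <= L2normv V F * L2normv V G.
Proof.
move=> hF hG; have iFG := L2_dotv hF hG.
apply: le_trans (le_normr_Rintegral _ _) _ => //.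
apply: le_trans (L2_CS_norm (L2v_enorm hF) (L2v_enorm hG)).
apply: le_Rintegral => //; first exact: integ_norm.
  by apply: integ_norm; apply: L2_integM; exact: L2v_enorm.
move=> x _; rewrite (le_trans (dotv_norm_le _ _))// ger0_norm ?mulr_ge0 ?enorm_ge0//.
Qed.

Lemma L2normvD F G : L2v V F -> L2v V G ->
  L2normv V (fun x => F x + G x) <= L2normv V F + L2normv V G.
Proof.
move=> hF hG; apply: le_trans (L2normD (L2v_enorm hF) (L2v_enorm hG)).
apply: L2norm_le; [exact/L2v_enorm/L2vD|by apply: L2D; exact: L2v_enorm|].
by apply: aeW => x _; rewrite !ger0_norm ?addr_ge0 ?enorm_ge0// enormD.
Qed.

Lemma L2normv_ae F G : L2v V F -> L2v V G -> ae_on V (fun x => F x = G x) ->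
  L2normv V F = L2normv V G.
Proof.
move=> hF hG h; apply: L2norm_ae; [exact: L2v_enorm..|].
by apply: ae_onS h => x _ ->.
Qed.

Lemma L2normvN F : L2normv V (fun x => - F x) = L2normv V F.
Proof. by congr L2norm; apply/funext => x; rewrite enormN. Qed.

Lemma coord_L2norm_le F i : L2v V F -> L2norm V (fun x => F x ord0 i) <= L2normv V F.
Proof.
move=> hF; apply: L2norm_le; [exact: hF|exact: L2v_enorm|].
by apply: aeW => x _; rewrite (ger0_norm (enorm_ge0 _)) coord_le_enorm.
Qed.

End L2_norms.

(** * Rayleigh bounds for symmetric matrices *)

Section symmetric_bounds.
Context {R : realType} {n : nat}.
Local Notation E := 'rV[R]_n.
Implicit Types (x y : E) (M : 'M[R]_n).

Lemma mulmvD M x y : mulmv M (x + y) = mulmv M x + mulmv M y.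
Proof. exact: mulmxDl. Qed.

Lemma mulmvZ M (a : R) x : mulmv M (a *: x) = a *: mulmv M x.
Proof. by rewrite /mulmv scalemxAl. Qed.

Lemma mulmvN M x : mulmv M (- x) = - mulmv M x.
Proof. exact: mulNmx. Qed.

Lemma mulmvB M x y : mulmv M (x - y) = mulmv M x - mulmv M y.
Proof. by rewrite mulmvD mulmvN. Qed.

Lemma mulmv_coord M x i : mulmv M x ord0 i = \sum_j M i j * x ord0 j.
Proof. by rewrite mxE; apply: eq_bigr => j _; rewrite mxE mulrC. Qed.

Lemma dotv_mulmv_sym M x y : M^T = M -> dotv (mulmv M x) y = dotv (mulmv M y) x.
Proof.
move=> sM; rewrite /dotv.
under eq_bigr do rewrite mulmv_coord mulr_suml.
under [RHS]eq_bigr do rewrite mulmv_coord mulr_suml.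
rewrite exchange_big; apply: eq_bigr => j _; apply: eq_bigr => i _.
by rewrite -[in RHS]sM mxE; ring.
Qed.

Lemma continuous_sumr (I : Type) (s : seq I) (F : I -> E -> R) :
  (forall i, continuous (F i)) -> continuous (fun x => \sum_(i <- s) F i x).
Proof.
move=> cF; elim: s => [|i s IH] x.
  by under eq_fun do rewrite big_nil; exact: cst_continuous.
under eq_fun do rewrite big_cons.
by apply: continuousD; [exact: cF|exact: IH].
Qed.

Lemma continuous_dotv (f g : E -> E) : (forall i, continuous (fun x => f x ord0 i)) ->
  (forall i, continuous (fun x => g x ord0 i)) -> continuous (fun x => dotv (f x) (g x)).
Proof.
move=> cf cg; apply: continuous_sumr => i x; exact: continuousM (cf i x) (cg i x).
Qed.

Lemma continuous_mulmv M i : continuous (fun x => mulmv M x ord0 i).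
Proof.
rewrite (_ : (fun x => _) = (fun x : E => \sum_j M i j * x ord0 j)); last first.
  by apply/funext => x; rewrite mulmv_coord.
apply: continuous_sumr => j y.
exact: (@continuousM R E (fun=> M i j) (fun y : E => y ord0 j) y
  (@cst_continuous _ _ _ _) (@continuous_coord R n j y)).
Qed.

Lemma continuous_enorm : continuous (@enorm R n).
Proof.
have h : continuous (fun x : E => dotv x x).
  by apply: (@continuous_dotv id id) => i; exact: continuous_coord.
move=> x; exact: (continuous_comp (h x) (@sqrt_continuous R _)).
Qed.

Lemma compact_sphere : compact [set x : E | enorm x = 1].
Proof.
apply: bounded_closed_compact.
  exists 1; split=> [|r r1 x /= x1]; first exact: num_real.
  rewrite (le_trans _ (ltW r1))// /Num.norm/= mx_normrE.
  apply/bigmax_leP; split=> // -[i j] _ /=; rewrite [i]ord1 -x1.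
  exact: coord_le_enorm.
rewrite (_ : mkset _ = @enorm R n @^-1` [set 1])//.
apply: preimage_closed => [x _|]; first exact: continuous_enorm.
exact: closed_eq.
Qed.

(* A minimizer of the Rayleigh quotient is an eigenvector. *)
Lemma rayleigh_min M x : M^T = M -> x != 0 ->
  exists2 m, eigenvalue M m & forall y, m * dotv y y <= dotv (mulmv M y) y.
Proof.
move=> sM x0; pose f y := dotv (mulmv M y) y.
have nz y : y != 0 -> 0 < enorm y.
  move=> y0; rewrite lt_neqAle enorm_ge0 andbT eq_sym; apply: contra y0 => /eqP h.
  by apply/eqP/dotv_eq0; rewrite -enorm_sqr h expr0n.
have cf : continuous f.
  apply: continuous_dotv => i; last exact: continuous_coord.
  exact: continuous_mulmv.
have unit y : y != 0 -> enorm ((enorm y)^-1 *: y) = 1.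
  by move=> y0; rewrite enormZ ger0_norm ?invr_ge0 ?enorm_ge0// mulVf// gt_eqF// nz.
have S0 : [set y : E | enorm y = 1] !=set0.
  by exists ((enorm x)^-1 *: x); exact: unit.
have [c] := compact_EVT_min S0 compact_sphere (continuous_subspaceT cf).
rewrite inE/= => c1 cmin; pose m := f c.
have mle y : m * dotv y y <= f y.
  have [->|y0] := eqVneq y 0; first by rewrite /f !(dotvC _ 0) !dotv0l mulr0.
  have := cmin ((enorm y)^-1 *: y); rewrite inE => /(_ (unit _ y0)).
  rewrite /f mulmvZ dotvZl dotvZr mulrA -invfM -expr2 -/(f c) -/(f y) -/m => h.
  by rewrite -enorm_sqr -ler_pdivlMr ?exprn_gt0 ?nz// mulrC.
have dc1 : dotv c c = 1 by rewrite -enorm_sqr c1 expr1n.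
exists m => //; apply/eigenvalueP; exists c; last first.
  by apply/negP => /eqP h; have := dc1; rewrite h dotv0l => /eqP; rewrite eq_sym oner_eq0.
have -> : c *m M = mulmv M c by rewrite /mulmv sM.
apply/subr0_eq/dotv_eq0; have [z Ez] : exists z, z = mulmv M c - m *: c by eexists.
rewrite -Ez.
pose q := f z - m * dotv z z.
have q0 : 0 <= q by rewrite subr_ge0.
(* Here z is the residual M c - m c. The form f - m |.|^2 is nonnegative and vanishes at c, so along
   c + t z only a linear term, of slope 2 |z|^2, and a quadratic one remain. *)
have key t : 0 <= 2 * t * dotv z z + t ^+ 2 * q.
  have := mle (c + t *: z); rewrite -subr_ge0 /f mulmvD mulmvZ.
  rewrite !dotvDl !dotvDr !dotvZl !dotvZr -/(f c) -/(f z) -/m dc1.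
  rewrite (dotv_mulmv_sym z c sM) (dotvC z c).
  have E : dotv z z = dotv (mulmv M c) z - m * dotv c z.
    by rewrite {1}Ez dotvBl dotvZl.
  have Et : t * dotv z z = t * (dotv (mulmv M c) z - m * dotv c z) by congr (t * _).
  by rewrite /q; lra.
have zz := dotv_ge0 z; set p := dotv z z in zz key *.
have q1 : 0 < q + 1 by lra.
(* This t makes the expression negative unless z = 0; q + 1 replaces q, which may be 0. *)
have := key (- p / (q + 1)); rewrite (_ : _ + _ = - (p ^+ 2 * (q + 2) / (q + 1) ^+ 2)); last first.
  by field; rewrite gt_eqF.
rewrite oppr_ge0 pmulr_lle0 ?invr_gt0 ?exprn_gt0// => h.
have p2 : p ^+ 2 <= 0 by rewrite -(pmulr_lle0 _ (_ : 0 < q + 2))//; lra.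
by apply/eqP; rewrite -sqrf_eq0 eq_le p2 sqr_ge0.
Qed.

Variables (M : 'M[R]_n) (lmin lmax : R).
Hypothesis lmin0 : 0 < lmin.
Hypothesis sM : M^T = M.
Hypothesis eM : forall a, eigenvalue M a -> lmin <= a <= lmax.

Lemma dotv_mulmv_ge x : lmin * dotv x x <= dotv (mulmv M x) x.
Proof.
have [->|x0] := eqVneq x 0; first by rewrite !(dotvC _ 0) !dotv0l mulr0.
have [m /eM/andP[lm _] h] := rayleigh_min sM x0.
by apply: le_trans (h x); rewrite ler_wpM2r// dotv_ge0.
Qed.

(** The minimum principle is applied to -M, whose eigenvalues are the opposites of those of M. *)
Lemma dotv_mulmv_le x : dotv (mulmv M x) x <= lmax * dotv x x.
Proof.
have [->|x0] := eqVneq x 0; first by rewrite !(dotvC _ 0) !dotv0l mulr0.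
have sN : (- M)^T = - M by rewrite linearN/= sM.
have [m em h] := rayleigh_min sN x0.
have /eM/andP[_ ml] : eigenvalue M (- m).
  apply/eigenvalueP; have /eigenvalueP[v vM v0] := em; exists v => //.
  by rewrite -[M]opprK mulmxN vM scaleNr.
have := h x; rewrite /mulmv linearN/= mulmxN dotvNl => hx.
have := dotv_ge0 x; nra.
Qed.

(** Cauchy-Schwarz for the form of M: positivity at [t *: x - y], the upper bound on both squares,
    and optimization in t. *)
Lemma dotv_mulmv_bound x y : dotv (mulmv M x) y <= lmax * (enorm x * enorm y).
Proof.
have [->|x0] := eqVneq x 0.
  by rewrite /mulmv mul0mx dotv0l /enorm dotv0l sqrtr0 mul0r mulr0.
have lmax0 : 0 < lmax.
  have [m /eM/andP[lm ml] _] := rayleigh_min sM x0.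
  exact: lt_le_trans lmin0 (le_trans lm ml).
rewrite mulrC -ler_pdivrMr//; apply: young_sharp; [exact: enorm_ge0..|move=> t t0].
have psd : 0 <= dotv (mulmv M (t *: x - y)) (t *: x - y).
  by apply: le_trans (dotv_mulmv_ge _); rewrite mulr_ge0 ?dotv_ge0// ltW.
move: psd; rewrite mulmvB mulmvZ dotvBl !dotvBr !dotvZl !dotvZr (dotv_mulmv_sym y x sM) => psd.
have hx := dotv_mulmv_le x; have hy := dotv_mulmv_le y.
rewrite !enorm_sqr mulrA ler_pdivrMr// -(ler_pM2l t0).
rewrite (_ : t * (_ * lmax) = t ^+ 2 * (lmax * dotv x x) + lmax * dotv y y); last first.
  by field; rewrite gt_eqF.
by have := ler_wpM2l (sqr_ge0 t) hx; lra.
Qed.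

Lemma enorm_mulmv x : enorm (mulmv M x) <= lmax * enorm x.
Proof.
have [h|h] := eqVneq (enorm (mulmv M x)) 0.
  rewrite h; have [->|x0] := eqVneq x 0; first by rewrite /enorm dotv0l sqrtr0 mulr0.
  have [m /eM/andP[lm ml] _] := rayleigh_min sM x0.
  by rewrite mulr_ge0 ?enorm_ge0// (le_trans (ltW lmin0))// (le_trans lm).
have h0 : 0 < enorm (mulmv M x) by rewrite lt_neqAle eq_sym h enorm_ge0.
have := dotv_mulmv_bound x (mulmv M x).
by rewrite -enorm_sqr expr2 mulrA ler_pM2r.
Qed.

End symmetric_bounds.

(** * Chain rule in the Sobolev space *)

Section test_calculus.
Context {R : realType} {n : nat}.
Local Notation E := 'rV[R]_n.
Local Notation mu := (lebesgue_rV n : {measure set 'rV[R]_n -> \bar R}).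
Implicit Types (u v : E -> R) (F G : E -> E) (i : 'I_n).
Local Notation e_ i := (delta_mx ord0 i : E).

Lemma partialM u v i : smooth u -> smooth v ->
  partial i (fun x => u x * v x) = (fun x => partial i u x * v x + u x * partial i v x).
Proof.
move=> su sv; apply: partialE => x; apply: is_derive_funM; exact: is_derive_smooth.
Qed.

Lemma partialB u v i : smooth u -> smooth v ->
  partial i (fun x => u x - v x) = (fun x => partial i u x - partial i v x).
Proof.
move=> su sv; apply: partialE => x.
exact: (is_deriveB (is_derive_smooth x i su) (is_derive_smooth x i sv)).
Qed.

Lemma partial_comp (k k' : R -> R) u i : smooth u ->
  (forall s : R, is_derive s 1 k (k' s)) ->
  partial i (fun x => k (u x)) = (fun x => k' (u x) * partial i u x).
Proof.
move=> su dk; apply: partialE => x.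
by apply: is_derive_fun1 => //; exact: is_derive_smooth.
Qed.

Lemma gradientE u x i : gradient u x ord0 i = partial i u x.
Proof. by rewrite mxE. Qed.

Lemma gradientB u v x : smooth u -> smooth v ->
  gradient (fun x => u x - v x) x = gradient u x - gradient v x.
Proof.
by move=> su sv; apply/rowP => i; rewrite !mxE partialB.
Qed.

Lemma gradientM u v x : smooth u -> smooth v ->
  gradient (fun x => u x * v x) x = v x *: gradient u x + u x *: gradient v x.
Proof.
by move=> su sv; apply/rowP => i; rewrite !mxE partialM// [in RHS]mulrC.
Qed.

Lemma Rintegral_out (V : set E) u : (forall x, ~ V x -> u x = 0) ->
  \int[mu]_(x in V) u x = \int[mu]_x u x.
Proof.
move=> u0; rewrite Rintegral_mkcond; apply: eq_Rintegral => x _.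
by rewrite /patch; case: ifPn => // /negP xU; rewrite u0// => Ux; apply: xU; rewrite inE.
Qed.

Lemma derive_lipschitz (k k' : R -> R) (C : R) :
  (forall s : R, is_derive s 1 k (k' s)) -> (forall s, `|k' s| <= C) ->
  forall s t, `|k s - k t| <= C * `|s - t|.
Proof.
move=> dk kC; suff h s t : s <= t -> `|k t - k s| <= C * `|t - s|.
  move=> s t; have [st|/ltW ts] := leP s t; last exact: h.
  by rewrite distrC [`|s - t|]distrC; exact: h.
move=> st; have [r _ ->] := @MVT_segment R k k' s t st (fun x _ => dk x)
  (fun x => @continuous_subspaceT _ _ _ _ (fun y => differentiable_continuous
     ((derivable1_diffP _ _).1 (@ex_derive _ _ _ _ _ _ _ (dk y)))) x).
by rewrite normrM ler_wpM2r.
Qed.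

End test_calculus.

Section sobolev.
Context {R : realType} {n : nat}.
Local Notation E := 'rV[R]_n.
Local Notation mu := (lebesgue_rV n : {measure set 'rV[R]_n -> \bar R}).
Implicit Types (u v : E -> R) (F G : E -> E) (i : 'I_n).
Variables (V : set E) (oV : open V) (bV : bounded_set V).
Local Notation integ f := (mu.-integrable V (EFin \o f)).

Let mV : measurable V. Proof. exact: open_rV_measurable. Qed.
Let Voo : (mu V < +oo)%E. Proof. exact: bounded_rV_finite. Qed.

Lemma test_L2 u : test_function V u -> L2 V u.
Proof.
move=> tu; have [M M0 uM] := test_function_bounded tu.
apply: (L2_bounded mV Voo (C := M)) => [|x _]; last exact: uM.
by apply: measurable_funTS; apply: smooth_measurable; exact: test_smooth tu.
Qed.

Lemma test_gradient_L2 u : test_function V u -> L2v V (gradient u).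
Proof.
move=> tu i; under eq_fun do rewrite gradientE.
by apply: test_L2; exact: test_function_partial.
Qed.

Lemma test_weak_gradient u : test_function V u -> weak_gradient V u (gradient u).
Proof.
move=> tu i phi tphi; have su := test_smooth tu; have sphi := test_smooth tphi.
have tdu := test_function_partial i tu; have tdphi := test_function_partial i tphi.
have tup : test_function V (fun x => u x * phi x) by exact: test_functionM.
have := integral_partial i tup; rewrite partialM//.
rewrite -(Rintegral_out (V := V)); last first.
  by move=> x Vx; rewrite (test_function_out tu Vx) (test_function_out tdu Vx) !mul0r addr0.
rewrite RintegralD//; [|by apply: L2_integM => //; exact: test_L2..].
move=> /eqP; rewrite addrC addr_eq0 => /eqP ->; congr (- _).
by apply: eq_Rintegral => x _; rewrite gradientE.
Qed.

(** The competitors in the variational inequality are all of the form u - phi with phi a test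
    function; this makes them members of H^1_0. *)
Lemma H10_subtest u G phi : H10 V u G -> test_function V phi ->
  H10 V (fun x => u x - phi x) (fun x => G x - gradient phi x).
Proof.
move=> [[hu hG wG] happ] tphi; have sphi := test_smooth tphi.
split.
  split; first by apply: L2B => //; exact: test_L2.
    by apply: L2vB => //; exact: test_gradient_L2.
  move=> i zeta tz; have tdz := test_function_partial i tz.
  have hz := test_L2 tz; have hdz := test_L2 tdz; have hphi := test_L2 tphi.
  have hdphi := test_gradient_L2 tphi i.
  under eq_Rintegral do rewrite mulrBl.
  rewrite RintegralB//; [|exact: L2_integM..].
  rewrite (wG i _ tz) (test_weak_gradient tphi i tz).
  under [in RHS]eq_Rintegral do rewrite 2!mxE mulrBl.
  rewrite RintegralB//; first by rewrite opprB opprK addrC.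
    by apply: L2_integM => //; exact: hG.
  exact: L2_integM.
move=> eps /happ[psi tpsi hpsi]; exists (fun x => psi x - phi x); first exact: test_functionB.
have spsi := test_smooth tpsi.
rewrite (_ : (fun x => _ - (u x - phi x)) = (fun x => psi x - u x)); last first.
  by apply/funext => x; rewrite opprB addrA subrK.
rewrite (_ : (fun x => _ - (G x - gradient phi x)) = (fun x => gradient psi x - G x))//.
by apply/funext => x; rewrite gradientB// opprB addrA subrK.
Qed.

Lemma L2_lipschitz_comp (k : R -> R) (C : R) u : measurable_fun setT k ->
  (forall s t, `|k s - k t| <= C * `|s - t|) -> L2 V u -> L2 V (fun x => k (u x)).
Proof.
move=> mk kC hu; have mu_ := L2_measurable mV hu.
have C0 : 0 <= C by have := kC 1 0; rewrite subr0 normr1 mulr1; exact: le_trans.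
apply: (L2_le mV (v := fun x => C * `|u x| + `|k 0|)).
- by apply: L2D => //; [apply: L2Z => //; exact: L2_norm|exact: L2_cst].
- by apply: (measurableT_comp mk).
move=> x _; rewrite [leRHS]ger0_norm; last by rewrite addr_ge0// mulr_ge0.
rewrite -[k (u x)](subrK (k 0)) (le_trans (ler_normD _ _))// lerD2r.
by rewrite (le_trans (kC _ _))// subr0.
Qed.

Lemma L2norm_comp_le (k : R -> R) (C : R) u v : measurable_fun setT k ->
  (forall s t, `|k s - k t| <= C * `|s - t|) -> L2 V u -> L2 V v ->
  L2norm V (fun x => k (u x) - k (v x)) <= C * L2norm V (fun x => u x - v x).
Proof.
move=> mk kC hu hv.
have C0 : 0 <= C by have := kC 1 0; rewrite subr0 normr1 mulr1; exact: le_trans.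
rewrite -[X in X * _](ger0_norm C0) -(L2normZ mV); last exact: L2B.
apply: L2norm_le => //.
- by apply: L2B => //; exact: L2_lipschitz_comp kC _.
- by apply: L2Z => //; exact: L2B.
- by apply: ae_onW => x _; rewrite normrM (ger0_norm C0).
Qed.

Lemma eq0_small (a K : R) : (forall eps, 0 < eps -> `|a| <= K * eps) -> a = 0.
Proof.
move=> h; apply/eqP; rewrite -normr_le0 leNgt; apply/negP => a0.
have K0 : 0 < K by rewrite -(pmulr_lgt0 _ (@ltr01 R)); exact: lt_le_trans (h _ ltr01).
have := h (`|a| / (2 * K)); rewrite divr_gt0 ?mulr_gt0// => /(_ isT).
rewrite (_ : K * _ = `|a| / 2); first by lra.
by field; rewrite gt_eqF.
Qed.

(* Pass to the limit in the classical identity along the test functions that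
   approximate u in H^1. *)
Lemma H10_chain u G (k k' : R -> R) (C : R) psi i : H10 V u G ->
  (forall v, smooth v -> smooth (fun x => k (v x))) ->
  (forall s : R, is_derive s 1 k (k' s)) ->
  measurable_fun setT k -> measurable_fun setT k' ->
  (forall s, `|k' s| <= C) -> (forall s t, `|k' s - k' t| <= C * `|s - t|) ->
  test_function V psi ->
  \int[mu]_(x in V) (partial i psi x * k (u x)) =
  - \int[mu]_(x in V) (psi x * (k' (u x) * G x ord0 i)).
Proof.
move=> [[hu hG wG] happ] sk dk mk mk' k'C lk' tpsi.
have lk := derive_lipschitz dk k'C.
have C0 : 0 <= C := le_trans (normr_ge0 _) (k'C 0).
have spsi := test_smooth tpsi; have tdpsi := test_function_partial i tpsi.
have hpsi := test_L2 tpsi; have hdpsi := test_L2 tdpsi.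
have [M M0 psiM] := test_function_bounded tpsi.
have hku : L2 V (fun x => k (u x)) by exact: L2_lipschitz_comp lk _.
have mu_ := L2_measurable mV hu.
have hGi := hG i.
have hk'G v : L2 V v -> L2 V (fun x => k' (v x) * G x ord0 i).
  move=> hv; have := L2_bdd mV hGi (measurableT_comp mk' (L2_measurable mV hv))
    (fun x _ => k'C (v x)).
  by under eq_fun do rewrite mulrC.
apply/eqP; rewrite -addr_eq0; apply/eqP.
(* The three terms are the costs of replacing k(phi) by k(u), the derivative of phi by G, and
   k'(phi) by k'(u). Lipschitz bounds on k and k' let L^2 convergence alone control them. *)
pose K := L2norm V (partial i psi) * C + L2norm V psi * C + M * C * L2norm V (fun x => G x ord0 i).
apply: (@eq0_small _ K) => eps /happ[phi tphi hphi].
have sphi := test_smooth tphi; have hphi2 := test_L2 tphi.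
have hdphi := test_L2 (test_function_partial i tphi).
have skphi := sk _ sphi.
have b1 : L2norm V (fun x => phi x - u x) <= eps.
  by apply: le_trans (ltW hphi); rewrite lerDl L2normv_ge0.
have hgG : L2v V (fun x => gradient phi x - G x).
  by apply: L2vB => //; exact: test_gradient_L2.
have b2 : L2norm V (fun x => partial i phi x - G x ord0 i) <= eps.
  apply: le_trans (ltW hphi); rewrite -[leLHS]add0r lerD ?L2norm_ge0//.
  have := coord_L2norm_le mV i hgG.
  by under eq_fun do rewrite 3!mxE.
have hkphi : L2 V (fun x => k (phi x)) by exact: L2_lipschitz_comp lk _.
have hk'd : L2 V (fun x => k' (phi x) * (partial i phi x - G x ord0 i)).
  have := L2_bdd mV (L2B mV hdphi hGi) (measurableT_comp mk' (L2_measurable mV hphi2))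
    (fun x _ => k'C (phi x)).
  by under eq_fun do rewrite mulrC.
have e1 : \int[mu]_(x in V) (partial i psi x * k (phi x)) +
    \int[mu]_(x in V) (psi x * (k' (phi x) * partial i phi x)) = 0.
  have tpk : test_function V (fun x => psi x * k (phi x)) by exact: test_functionM.
  have := integral_partial i tpk; rewrite partialM// (partial_comp i sphi dk).
  rewrite -(Rintegral_out (V := V)); last first.
    move=> x Vx; rewrite (test_function_out tpsi Vx) (test_function_out tdpsi Vx).
    by rewrite !mul0r addr0.
  rewrite RintegralD//; first exact: L2_integM.
  apply: L2_integM => //.
  have := L2_bdd mV hdphi (measurableT_comp mk' (L2_measurable mV hphi2))
    (fun x _ => k'C (phi x)).
  by under eq_fun do rewrite mulrC.
have i1 := L2_integM mV hdpsi hku.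
have i2 := L2_integM mV hdpsi hkphi.
have i3 := L2_integM mV hpsi (hk'G _ hu).
have i4 := L2_integM mV hpsi (hk'G _ hphi2).
have i5 := L2_integM mV hpsi hk'd.
have e2 : \int[mu]_(x in V) (psi x * (k' (phi x) * partial i phi x)) =
   \int[mu]_(x in V) (psi x * (k' (phi x) * (partial i phi x - G x ord0 i))) +
   \int[mu]_(x in V) (psi x * (k' (phi x) * G x ord0 i)).
  by rewrite -RintegralD//; apply: eq_Rintegral => x _; ring.
have e3 : \int[mu]_(x in V) (partial i psi x * k (u x)) =
  \int[mu]_(x in V) (partial i psi x * k (phi x)) -
  \int[mu]_(x in V) (partial i psi x * (k (phi x) - k (u x))).
  rewrite -RintegralB//; last by apply: L2_integM => //; exact: L2B.
  by apply: eq_Rintegral => x _; ring.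
have hd : L2 V (fun x => psi x * (k' (phi x) - k' (u x))).
  have := L2_bdd mV (L2B mV (L2_lipschitz_comp mk' lk' hphi2) (L2_lipschitz_comp mk' lk' hu))
     (measurable_funTS (smooth_measurable spsi)) (fun x _ => psiM x).
  by under eq_fun do rewrite mulrC.
have e4 : \int[mu]_(x in V) (psi x * (k' (u x) * G x ord0 i)) =
  \int[mu]_(x in V) (psi x * (k' (phi x) * G x ord0 i)) -
  \int[mu]_(x in V) ((psi x * (k' (phi x) - k' (u x))) * G x ord0 i).
  rewrite -RintegralB//; last exact: L2_integM.
  by apply: eq_Rintegral => x _; ring.
have bnd1 := L2_CS mV hdpsi (L2B mV hkphi hku).
have bnd2 := L2_CS mV hpsi hk'd.
have bnd3 := L2_CS mV hd hGi.
have c1 := L2norm_comp_le mk lk hphi2 hu.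
have c2 : L2norm V (fun x => k' (phi x) * (partial i phi x - G x ord0 i)) <=
    C * L2norm V (fun x => partial i phi x - G x ord0 i).
  rewrite -[X in X * _](ger0_norm C0) -(L2normZ mV); last exact: L2B.
  apply: L2norm_le => //; first by apply: L2Z => //; exact: L2B.
  by apply: ae_onW => x _; rewrite !normrM ler_wpM2r// (le_trans (k'C _))// ler_norm.
have c3 : L2norm V (fun x => psi x * (k' (phi x) - k' (u x))) <=
    M * C * L2norm V (fun x => phi x - u x).
  rewrite -[X in X * _](@ger0_norm _ (M * C)) ?mulr_ge0// -(L2normZ mV); last exact: L2B.
  apply: L2norm_le => //; first by apply: L2Z => //; exact: L2B.
  apply: ae_onW => x _; rewrite !normrM (ger0_norm M0) (ger0_norm C0) -mulrA.
  by rewrite ler_pM.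
rewrite e3 e4; move: e1; rewrite e2.
set a1 := \int[mu]_(x in V) _; set a2 := \int[mu]_(x in V) _.
set a3 := \int[mu]_(x in V) _; set a4 := \int[mu]_(x in V) _; set a5 := \int[mu]_(x in V) _.
move=> e1; rewrite (_ : _ + _ = - a4 - a2 - a5); last by lra.
have d1 : `|a4| <= L2norm V (partial i psi) * (C * eps).
  apply: le_trans bnd1 _; rewrite ler_wpM2l ?L2norm_ge0//.
  by apply: le_trans c1 _; rewrite ler_wpM2l.
have d2 : `|a2| <= L2norm V psi * (C * eps).
  apply: le_trans bnd2 _; rewrite ler_wpM2l ?L2norm_ge0//.
  by apply: le_trans c2 _; rewrite ler_wpM2l.
have d3 : `|a5| <= (M * C * eps) * L2norm V (fun x => G x ord0 i).
  apply: le_trans bnd3 _; rewrite ler_wpM2r ?L2norm_ge0//.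
  by apply: le_trans c3 _; rewrite ler_wpM2l// mulr_ge0.
rewrite /K; apply: le_trans (ler_normB _ _) _.
apply: le_trans (lerD (ler_normB _ _) (lexx _)) _; rewrite normrN.
by lra.
Qed.

End sobolev.

(** * The multiplier of the obstacle problem *)

Section obstacle_multiplier.
Context {R : realType} {n : nat}.
Local Notation E := 'rV[R]_n.
Local Notation mu := (lebesgue_rV n : {measure set 'rV[R]_n -> \bar R}).
Implicit Types (v : E -> R) (i : 'I_n).
Variables (V : set E) (oV : open V) (bV : bounded_set V).
Variables (u : E -> R) (G : E -> E) (c : R).
Hypothesis uG : H10 V u G.

Let mV : measurable V. Proof. exact: open_rV_measurable. Qed.
Let Voo : (mu V < +oo)%E. Proof. exact: bounded_rV_finite. Qed.
Let hu : L2 V u. Proof. by case: uG => -[]. Qed.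
Let hG : L2v V G. Proof. by case: uG => -[]. Qed.

Lemma test_eq0_ae (m : E -> R) : mu.-integrable V (EFin \o m) ->
  (forall phi, test_function V phi -> (forall x, 0 <= phi x) ->
     \int[mu]_(x in V) (m x * phi x) = 0) ->
  ae_on V (fun x => m x = 0).
Proof.
move=> im h.
have h1 : ae_on V (fun x => 0 <= m x).
  by apply: (test_nonneg_ae mV oV (@subset_refl _ V) im) => phi tphi phi0; rewrite h.
have h2 : ae_on V (fun x => 0 <= - m x).
  apply: (test_nonneg_ae mV oV (@subset_refl _ V) (integN im)) => phi tphi phi0.
  under eq_Rintegral do rewrite mulNr.
  rewrite RintegralN// ?h ?oppr0//.
  have [M M0 phiM] := test_function_bounded tphi.
  apply: (integM mV im (C := M)) => [|x _]; last exact: phiM.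
  by apply: measurable_funTS; apply: smooth_measurable; exact: test_smooth tphi.
apply: ae_onS (ae_onI h1 h2) => x _ [a b]; apply/eqP; rewrite eq_le a andbT.
by rewrite -oppr_ge0.
Qed.

Section multiplier.
Variables (f : E -> R) (F : E -> E) (w : E -> R).
Hypothesis hf : L2 V f.
Hypothesis Fw : Hdiv V F w.
Hypothesis uc : ae_on V (fun x => u x <= c).
Hypothesis VI : forall v Gv, H10 V v Gv -> ae_on V (fun x => v x <= c) ->
  \int[mu]_(x in V) dotv (F x) (G x - Gv x) <= \int[mu]_(x in V) (f x * (u x - v x)).

Let hF : L2v V F. Proof. by case: Fw. Qed.
Let hw : L2 V w. Proof. by case: Fw. Qed.

(** The competitor is v = u - phi, for which u - v = phi; the weak divergence then moves the
    gradient off phi. *)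
Let VI_test phi : test_function V phi -> ae_on V (fun x => u x - phi x <= c) ->
  0 <= \int[mu]_(x in V) ((f x + w x) * phi x).
Proof.
move=> tphi hc; have hphi := test_L2 oV bV tphi.
have := VI (H10_subtest oV bV uG tphi) hc.
rewrite (_ : (fun x => dotv _ _) = (fun x => dotv (F x) (gradient phi x))); last first.
  by apply/funext => x; congr dotv; rewrite opprB addrC subrK.
rewrite (_ : (fun x => f x * _) = (fun x => f x * phi x)); last first.
  by apply/funext => x; congr (_ * _); rewrite opprB addrC subrK.
case: Fw => _ _ /(_ phi tphi) -> => h.
under eq_Rintegral do rewrite mulrDl.
by rewrite RintegralD//; [lra|exact: L2_integM..].
Qed.

Lemma multiplier_ge0 : ae_on V (fun x => 0 <= f x + w x).
Proof.
apply: (test_nonneg_ae mV oV (@subset_refl _ V)).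
  by apply: L2_integ => //; exact: L2D.
move=> phi tphi phi0; apply: VI_test => //.
apply: ae_onS uc => x _; apply: le_trans.
by rewrite gerBl.
Qed.

(** {u < c} is open by continuity, and u stays below some c - eta on the compact support of phi, so
    that u can also be raised there by a small multiple of phi. *)
Lemma multiplier_eq0 : {in V, continuous u} ->
  ae_on V (fun x => u x < c -> f x + w x = 0).
Proof.
move=> cu; pose U := V `&` [set x | u x < c].
have oU : open U.
  rewrite openE => x [Vx xc]; rewrite /interior; apply: filterI.
    exact: open_nbhs_nbhs.
  have /cu cux : x \in V by rewrite inE.
  by apply: (cux [set y | y < c]); exact: lt_nbhsl.
have UV : U `<=` V by move=> x [].
have im : mu.-integrable V (EFin \o (fun x => - (f x + w x))).
  by apply: L2_integ => //; apply: L2N => //; exact: L2D.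
have : ae_on U (fun x => 0 <= - (f x + w x)).
  apply: (test_nonneg_ae mV oU UV im) => phi tphi phi0.
  have tphiV := test_function_sub UV tphi.
  have [M M0 phiM] := test_function_bounded tphi.
  have [_ [K [cK KU phiK]]] := tphi.
  have [eta eta0 hK] : exists2 eta, 0 < eta & forall x, K x -> u x <= c - eta.
    have [->|/set0P K0] := eqVneq K set0; first by exists 1.
    have cuK : {within K, continuous u}.
      apply: continuous_in_subspaceT => x; rewrite inE => /KU[Vx _].
      by apply: cu; rewrite inE.
    have [z] := compact_EVT_max K0 cK cuK; rewrite inE => /KU[_ /= uz] zmax.
    exists (c - u z); first by rewrite subr_gt0.
    by move=> x Kx; rewrite subKr; apply: zmax; rewrite inE.
  (* This gives a phi <= eta on the support; M + 1 because the bound M may be 0. *)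
  pose a := eta / (M + 1).
  have a0 : 0 < a by rewrite divr_gt0// ltr_wpDl.
  have taphi := test_functionZ (- a) tphiV.
  have : 0 <= \int[mu]_(x in V) ((f x + w x) * (- a * phi x)).
    apply: VI_test => //; apply: ae_onS uc => x _ ucx.
    have [Kx|nKx] := pselect (K x); last by rewrite (phiK _ nKx) mulr0 subr0.
    have ub : a * phi x <= eta.
      have := phiM x; rewrite ger0_norm// => h.
      by rewrite /a mulrAC ler_pdivrMr ?ltr_wpDl// ler_wpM2l ?(ltW eta0)//; lra.
    by have := hK _ Kx; lra.
  have iphi : mu.-integrable V (EFin \o (fun x => - (f x + w x) * phi x)).
    by apply: L2_integM => //; [apply: L2N => //; exact: L2D|exact: test_L2].
  rewrite (@eq_Rintegral _ _ _ mu V (fun x => a * (- (f x + w x) * phi x))); last first.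
    by move=> x _; ring.
  by rewrite RintegralZl// pmulr_rge0.
move=> hU; have hU' : ae_on V (fun x => u x < c -> 0 <= - (f x + w x)).
  by move: hU; rewrite /ae_on; apply: filterS => x h Vx ux; exact: h.
apply: ae_onS (ae_onI multiplier_ge0 hU') => x _ [h1 h2] /h2 h3.
by apply/eqP; rewrite eq_le h1 andbT -oppr_ge0.
Qed.

End multiplier.

(** * Vanishing of the gradient on the contact set *)

Section contact.

(** Equal to 1 at s = 0 and tending to 0 at every other s as dl tends to 0: a symmetric rational
    approximation of the indicator of {0}. *)
Definition qrat (dl s : R) : R := dl ^+ 2 / (dl ^+ 2 + s ^+ 2).

Let den_gt0 (dl s : R) : 0 < dl -> 0 < dl ^+ 2 + s ^+ 2.
Proof. by move=> d0; rewrite ltr_wpDr ?sqr_ge0// exprn_gt0. Qed.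

Lemma qrat_ge0 (dl s : R) : 0 < dl -> 0 <= qrat dl s.
Proof. by move=> d0; rewrite divr_ge0 ?sqr_ge0 ?ltW ?den_gt0. Qed.

Lemma qrat_le1 (dl s : R) : 0 < dl -> qrat dl s <= 1.
Proof. by move=> d0; rewrite ler_pdivrMr ?den_gt0// mul1r lerDl sqr_ge0. Qed.

Lemma is_derive_qrat (dl s : R) : 0 < dl ->
  is_derive s 1 (qrat dl) (- 2 * s * dl ^+ 2 / (dl ^+ 2 + s ^+ 2) ^+ 2).
Proof.
move=> d0; have den := den_gt0 s d0.
have d1 : is_derive s 1 (fun r : R => dl ^+ 2 + r * r) (2 * s).
  apply: is_derive_eq (is_derive_funD (is_derive_cst _ _ _)
    (is_derive_funM (is_derive_id _ _) (is_derive_id _ _))) _.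
  by rewrite /=; ring.
have den' : (fun r : R => dl ^+ 2 + r * r) s != 0 by rewrite /= -expr2 gt_eqF.
rewrite (_ : qrat dl = fun r => dl ^+ 2 * (dl ^+ 2 + r * r)^-1); last first.
  by apply/funext => r; rewrite /qrat expr2.
have h := is_derive_funM (is_derive_cst (dl ^+ 2 : R^o) (s : R^o) 1) 
  (@is_derive_funV R R^o (fun r : R => dl ^+ 2 + r * r) s 1 _ den' d1).
apply: (is_derive_eq h).
by rewrite /= mul0r add0r; field; rewrite -?expr2 gt_eqF.
Qed.

Lemma qrat_lipschitz (dl s t : R) : 0 < dl ->
  `|qrat dl s - qrat dl t| <= dl^-1 * `|s - t|.
Proof.
move=> d0; apply: derive_lipschitz => r; first exact: is_derive_qrat.
have den := den_gt0 r d0.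
have h1 := sqr_ge0 (dl * (dl + r)); have h2 := sqr_ge0 (dl * (dl - r)).
have h3 := sqr_ge0 (dl * r); have h4 := sqr_ge0 (r ^+ 2).
rewrite ler_norml; apply/andP; split.
  rewrite ler_pdivlMr ?exprn_gt0// -(ler_pM2l d0).
  rewrite (_ : dl * (- dl^-1 * _) = - (dl ^+ 2 + r ^+ 2) ^+ 2); first by lra.
  by field; rewrite gt_eqF.
rewrite ler_pdivrMr ?exprn_gt0// -(ler_pM2l d0).
rewrite (_ : dl * (dl^-1 * _) = (dl ^+ 2 + r ^+ 2) ^+ 2); first by lra.
by field; rewrite gt_eqF.
Qed.

Let is_derive_csub (s : R) : is_derive s 1 (fun r : R => c - r) (- 1).
Proof.
have h := @is_deriveB R R^o R^o (cst c) id s 1 0 1 (is_derive_cst _ _ _) (is_derive_id _ _).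
by apply: (is_derive_eq h); rewrite sub0r.
Qed.

(* As dl tends to 0, eta dl u tends to 0 uniformly, while its derivative
   eta' dl u tends to -1 on the contact set and to 0 elsewhere. *)
Let eta (dl s : R) : R := (c - s) * qrat dl (c - s).
Let eta' (dl s : R) : R := qrat dl (c - s) - 2 * (qrat dl (c - s) * qrat dl (c - s)).

(** For q = [qrat dl], r q'(r) = -2 q (1 - q). Hence the closed form q - 2 q^2 of [eta'], whose
    estimates then only use 0 <= q <= 1 and the Lipschitz constant of q. *)
Let is_derive_eta (dl s : R) : 0 < dl -> is_derive s 1 (eta dl) (eta' dl s).
Proof.
move=> d0; have den := den_gt0 (c - s) d0.
have dc := is_derive_csub s.
have h := is_derive_funM dc
  (@is_derive_fun1 R R^o (qrat dl) (fun r : R => c - r) s 1 _ _ (is_derive_qrat (c - s) d0) dc).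
apply: (is_derive_eq h).
by rewrite /eta' /qrat; field; rewrite gt_eqF.
Qed.

Let eta'_bound (dl s : R) : 0 < dl -> `|eta' dl s| <= 1.
Proof.
move=> d0; have q0 := qrat_ge0 (c - s) d0; have q1 := qrat_le1 (c - s) d0.
by rewrite /eta' ler_norml; apply/andP; split; nra.
Qed.

Let eta'_lipschitz (dl s t : R) : 0 < dl ->
  `|eta' dl s - eta' dl t| <= 5 / dl * `|s - t|.
Proof.
move=> d0; have q0 := qrat_ge0 (c - s) d0; have q1 := qrat_le1 (c - s) d0.
have r0 := qrat_ge0 (c - t) d0; have r1 := qrat_le1 (c - t) d0.
have h : `|qrat dl (c - s) - qrat dl (c - t)| <= dl^-1 * `|s - t|.
  apply: le_trans (qrat_lipschitz (c - s) (c - t) d0) _.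
  by rewrite -normrN (_ : - (c - s - (c - t)) = s - t)//; ring.
rewrite /eta'; move: q0 q1 r0 r1 h; set a := qrat _ _; set b := qrat _ _ => q0 q1 r0 r1 h.
rewrite (_ : _ - _ = (a - b) * (1 - 2 * (a + b))); last by ring.
rewrite (_ : 5 / dl * _ = dl^-1 * `|s - t| * 5); last by ring.
rewrite normrM; apply: ler_pM => //.
by rewrite ler_norml; apply/andP; split; lra.
Qed.

Let smooth_eta (dl : R) (v : E -> R) : 0 < dl -> smooth v ->
  smooth (fun x => eta dl (v x)).
Proof.
move=> d0 sv; have gc : smooth_gen (fun x => c + -1 * v x).
  apply: sg_add; first exact: sg_cst.
  by apply: sg_mul; [exact: sg_cst|exact: sg_smooth].
rewrite (_ : (fun x => _) = (fun x => (c + -1 * v x) * (dl ^+ 2 *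
  (dl ^+ 2 + (c + -1 * v x) * (c + -1 * v x))^-1))); last first.
  by apply/funext => x; rewrite /eta /qrat mulN1r -expr2.
apply/smooth_genP/sg_mul => //; apply: sg_mul; first exact: sg_cst.
apply: sg_inv => [x|]; first by rewrite -expr2 gt_eqF// den_gt0.
by apply: sg_add; [exact: sg_cst|exact: sg_mul].
Qed.

Let measurable_qrat (dl : R) : 0 < dl -> measurable_fun setT (fun s : R => qrat dl (c - s)).
Proof.
move=> d0; apply: continuous_measurable_fun => s.
have dc := is_derive_csub s.
have [h _] := @is_derive_fun1 R R^o (qrat dl) (fun r : R => c - r) s 1 _ _
  (is_derive_qrat (c - s) d0) dc.
exact/differentiable_continuous/derivable1_diffP.
Qed.

(** Multiplying by the indicator of the contact set A reduces the claim to one integrable function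
    tested against every psi. The chain rule for [eta] equates an integral that tends to 0 with one
    that tends to the integral of G_i 1_A psi. *)
Lemma gradient_contact_eq0 : ae_on V (fun x => u x = c -> G x = 0).
Proof.
have mu_ := L2_measurable mV hu.
pose A := V `&` [set x | u x = c].
have mA : measurable A.
  rewrite (_ : A = V `&` u @^-1` [set c])//; exact: mu_.
suff hi i : ae_on V (fun x => G x ord0 i * \1_A x = 0).
  have : {ae mu, forall x i, V x -> G x ord0 i * \1_A x = 0}.
    apply: filter_forall => i; exact: hi.
  rewrite /ae_on; apply: filterS => x h Vx ux; apply/rowP => i; rewrite mxE.
  by have := h i Vx; rewrite indicE mem_set// mulr1.
have iG : mu.-integrable V (EFin \o (fun x => G x ord0 i)) by exact: L2_integ.
have mind : measurable_fun V (\1_A : E -> R).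
  by apply: measurable_funTS; exact: measurable_indic.
have ind1 x : V x -> `|(\1_A x : R)| <= 1.
  by move=> _; rewrite indicE; case: (_ \in _); rewrite ?normr1 ?normr0.
have im : mu.-integrable V (EFin \o (fun x => G x ord0 i * \1_A x)) by exact: integM ind1.
apply: test_eq0_ae im _ => psi tpsi psi0.
have hpsi := test_L2 oV bV tpsi.
have tdpsi := test_function_partial i tpsi; have hdpsi := test_L2 oV bV tdpsi.
pose dl (m : nat) : R := m.+1%:R^-1.
have dl0 m : 0 < dl m by rewrite invr_gt0 ltr0n.
have cdl : dl m @[m --> \oo] --> (0 : R) by exact: cvg_harmonic.
have chain m : \int[mu]_(x in V) (partial i psi x * eta (dl m) (u x)) =
  - \int[mu]_(x in V) (psi x * (eta' (dl m) (u x) * G x ord0 i)).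
  have d0 := dl0 m.
  have mq := measurable_qrat d0.
  apply: (@H10_chain R n V oV bV u G (eta (dl m)) (eta' (dl m)) (Num.max 1 (5 / dl m))) => //.
  - by move=> v; exact: smooth_eta.
  - by move=> s; exact: is_derive_eta.
  - by apply: measurable_funM => //; exact: measurable_funB.
  - apply: measurable_funB => //; apply: measurable_funM => //; exact: measurable_funM.
  - by move=> s; rewrite le_max eta'_bound.
  - move=> s t; apply: le_trans (eta'_lipschitz s t d0) _.
    by rewrite ler_wpM2r// le_max lexx orbT.
have lim0 : \int[mu]_(x in V) (partial i psi x * eta (dl m) (u x)) @[m --> \oo] --> (0 : R).
  have idpsi := integ_norm (L2_integ mV Voo hdpsi).
  apply/cvgrPdist_le => eps e0.
  pose K := \int[mu]_(x in V) `|partial i psi x| + 1.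
  have K0 : 0 < K by rewrite ltr_wpDl// Rintegral_ge0.
  have e1 : 0 < eps / K by rewrite divr_gt0.
  move/cvgrPdist_le : cdl => /(_ _ e1)[N _ hN]; exists N => // m /= Nm.
  have := hN m Nm; rewrite sub0r normrN ger0_norm ?(ltW (dl0 m))// => hm.
  (* This is 2 dl |r| <= dl^2 + r^2 with r = c - s. *)
  have eta_le s : `|eta (dl m) s| <= dl m.
    have den := den_gt0 (c - s) (dl0 m).
    have h1 := sqr_ge0 (dl m - (c - s)); have h2 := sqr_ge0 (dl m + (c - s)).
    have d0 := dl0 m.
    rewrite /eta /qrat mulrA ler_norml; apply/andP; split.
      by rewrite ler_pdivlMr// -subr_ge0 -(pmulr_rge0 _ d0); nra.
    by rewrite ler_pdivrMr// -subr_ge0 -(pmulr_rge0 _ d0); nra.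
  have meta : measurable_fun V (fun x => eta (dl m) (u x)).
    have mq := measurable_qrat (dl0 m).
    apply: (measurableT_comp (f := eta (dl m))) => //.
    by apply: measurable_funM => //; exact: measurable_funB.
  have ie : mu.-integrable V (EFin \o (fun x => partial i psi x * eta (dl m) (u x))).
    apply: (integM mV (C := dl m)) => //; exact: L2_integ.
  rewrite sub0r normrN; apply: le_trans (le_normr_Rintegral mV ie) _.
  apply: (@le_trans _ _ (\int[mu]_(x in V) (dl m * `|partial i psi x|))).
    apply: le_Rintegral => //; [exact: integ_norm|exact: integZ|].
    by move=> x _; rewrite normrM mulrC ler_wpM2r.
  rewrite RintegralZl//; apply: (@le_trans _ _ (eps / K * K)).
    by apply: ler_pM => //; [exact/ltW|exact: Rintegral_ge0|rewrite lerDl].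
  by rewrite mulfVK// gt_eqF.
have lim1 : (- \int[mu]_(x in V) (psi x * (eta' (dl m) (u x) * G x ord0 i))) @[m --> \oo] -->
    \int[mu]_(x in V) (G x ord0 i * \1_A x * psi x).
  have e m : (- \int[mu]_(x in V) (psi x * (eta' (dl m) (u x) * G x ord0 i))) =
     \int[mu]_(x in V) (- (psi x * (eta' (dl m) (u x) * G x ord0 i))).
    rewrite RintegralN//; apply: L2_integM => //.
    under eq_fun do rewrite mulrC.
    apply: (L2_bdd mV (C := 1)) => //; last by move=> x _; exact: eta'_bound.
    have mq := measurable_qrat (dl0 m).
    apply: (measurableT_comp (f := eta' (dl m))) => //.
    apply: measurable_funB => //; apply: measurable_funM => //; exact: measurable_funM.
  under eq_fun do rewrite e.
  have ipG : mu.-integrable V (EFin \o (fun x => `|psi x * G x ord0 i|)).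
    by apply: integ_norm; exact: L2_integM.
  have mpsi := L2_measurable mV hpsi; have mG := L2_measurable mV (hG i).
  apply: (dominated_cvg_Rintegral mV _ _ ipG).
  - move=> m; have mq := measurable_qrat (dl0 m).
    have me : measurable_fun V (fun x => eta' (dl m) (u x)).
      apply: (measurableT_comp (f := eta' (dl m))) => //.
      apply: measurable_funB => //; apply: measurable_funM => //; exact: measurable_funM.
    by apply: measurableT_comp => //; apply: measurable_funM => //; exact: measurable_funM.
  - by apply: measurable_funM => //; exact: measurable_funM.
  - apply: aeW => x Vx.
    have -> : G x ord0 i * \1_A x * psi x = - (psi x * (- \1_A x * G x ord0 i)) by ring.
    apply: cvgN; apply: cvgM; first exact: cvg_cst.
    apply: cvgM; last exact: cvg_cst.
    rewrite indicE; have [ux|ux] := pselect (u x = c).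
      rewrite mem_set//; apply: cvg_near_cst; apply: nearW => m.
      rewrite /eta' /qrat ux subrr expr0n/= addr0 mulfV ?sqrf_eq0 ?gt_eqF//.
      by rewrite /=; ring.
    rewrite memNset; last by case.
    have cu0 : c - u x != 0 by rewrite subr_eq0 eq_sym; exact/eqP.
    have cq : qrat (dl m) (c - u x) @[m --> \oo] --> (0 : R).
      have cd2 : dl m ^+ 2 @[m --> \oo] --> (0 : R).
        rewrite -(mulr0 (0 : R)); under eq_fun do rewrite expr2; exact: cvgM.
      rewrite -[X in _ --> X](mul0r (0 + (c - u x) ^+ 2)^-1).
      apply: cvgM; first exact: cd2.
      apply: cvgV; first by rewrite add0r sqrf_eq0.
      by apply: cvgD; [exact: cd2|exact: cvg_cst].
    rewrite oppr0 -[X in _ --> X](_ : 0 - 2 * (0 * 0) = 0); last by ring.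
    by apply: cvgB => //; apply: cvgM; [exact: cvg_cst|exact: cvgM].
  - move=> m x _; rewrite normrN mulrCA normrM ler_piMl//.
    exact: eta'_bound.
rewrite -(cvg_lim (@norm_hausdorff _ _) lim1).
apply: cvg_lim; first exact: norm_hausdorff.
rewrite (_ : (fun m => _) = (fun m => \int[mu]_(x in V) (partial i psi x * eta (dl m) (u x)))) //.
by apply/funext => m; rewrite chain.
Qed.

End contact.
End obstacle_multiplier.

(** * Sign of the divergence on the contact set *)

Section lewy_stampacchia.
Context {R : realType} {n : nat}.
Local Notation E := 'rV[R]_n.
Local Notation mu := (lebesgue_rV n : {measure set 'rV[R]_n -> \bar R}).
Implicit Types (v : E -> R) (i : 'I_n).
Variables (V : set E) (oV : open V) (bV : bounded_set V).
Variables (u : E -> R) (G : E -> E) (c : R).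
Hypothesis uG : H10 V u G.

Let mV : measurable V. Proof. exact: open_rV_measurable. Qed.
Let Voo : (mu V < +oo)%E. Proof. exact: bounded_rV_finite. Qed.
Let hu : L2 V u. Proof. by case: uG => -[]. Qed.
Let hG : L2v V G. Proof. by case: uG => -[]. Qed.

Variables (F : E -> E) (w : E -> R).
Hypothesis Fw : Hdiv V F w.
Hypothesis FG0 : ae_on V (fun x => 0 <= dotv (F x) (G x)).
Hypothesis F0 : ae_on V (fun x => u x = c -> F x = 0).
Hypothesis uc : ae_on V (fun x => u x <= c).

Let hF : L2v V F. Proof. by case: Fw. Qed.
Let hw : L2 V w. Proof. by case: Fw. Qed.

(** A smooth nondecreasing substitute for the indicator of s >= c: it equals 1 there, and tends to 0
    at each s < c as dl tends to 0. Monotonicity excludes the symmetric [qrat] here. The factor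
    [flat 2] in [k'] is the derivative of [flat 0]. *)
Let k (dl s : R) := dl / (dl + flat 0 (c - s)).
Let k' (dl s : R) := dl * flat 2 (c - s) / (dl + flat 0 (c - s)) ^+ 2.

Let den_gt0 (dl s : R) : 0 < dl -> 0 < dl + flat 0 s.
Proof. by move=> d0; rewrite ltr_wpDr ?flat_ge0. Qed.

Let k_ge0 (dl s : R) : 0 < dl -> 0 <= k dl s.
Proof. by move=> d0; rewrite divr_ge0 ?ltW ?den_gt0. Qed.

Let k_le1 (dl s : R) : 0 < dl -> k dl s <= 1.
Proof. by move=> d0; rewrite ler_pdivrMr ?den_gt0// mul1r lerDl flat_ge0. Qed.

Let k'_ge0 (dl s : R) : 0 < dl -> 0 <= k' dl s.
Proof. by move=> d0; rewrite divr_ge0 ?sqr_ge0// mulr_ge0 ?flat_ge0// ltW. Qed.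

(** The 4 is [flat_le] at index 2, and the denominator is at least dl^2. *)
Let k'_le (dl s : R) : 0 < dl -> `|k' dl s| <= 4 / dl.
Proof.
move=> d0; rewrite ger0_norm ?k'_ge0// ler_pdivrMr ?exprn_gt0 ?den_gt0//.
rewrite -(ler_pM2l d0) (_ : dl * (4 / dl * _) = 4 * (dl + flat 0 (c - s)) ^+ 2); last first.
  by field; rewrite gt_eqF.
rewrite mulrA mulrC ler_pM ?flat_ge0 ?mulr_ge0 ?(ltW d0)//.
  by apply: le_trans (flat_le _ _) _; rewrite -natrX.
by rewrite -expr2 lerXn2r ?nnegrE ?lerDl ?flat_ge0// ltW// den_gt0.
Qed.

Let is_derive_k (dl s : R) : 0 < dl -> is_derive s 1 (k dl) (k' dl s).
Proof.
move=> d0.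
have h := @is_deriveB R R^o R^o (cst c) id s 1 0 1 (is_derive_cst _ _ _) (is_derive_id _ _).
have h1 : is_derive s 1 (fun r : R => c - r) (- 1).
  by apply: (is_derive_eq h); rewrite sub0r.
have h2 := @is_derive_fun1 R R^o (flat 0) (fun r : R => c - r) s 1 _ _
  (is_derive_flat 0 (c - s)) h1.
have h3 := @is_derive_funD R R^o _ _ s 1 _ _ (is_derive_cst (dl : R^o) (s : R^o) 1) h2.
have d0' : (fun r : R => dl + flat 0 (c - r)) s != 0 by rewrite /= gt_eqF// den_gt0.
have h4 := @is_derive_funV R R^o (fun r : R => dl + flat 0 (c - r)) s 1 _ d0' h3.
have h5 := @is_derive_funM R R^o _ _ s 1 _ _ (is_derive_cst (dl : R^o) (s : R^o) 1) h4.
apply: (is_derive_eq h5); rewrite /k' /=.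
by field; rewrite gt_eqF// den_gt0.
Qed.

Let smooth_k (dl : R) v : 0 < dl -> smooth v -> smooth (fun x => k dl (v x)).
Proof.
move=> d0 sv; rewrite (_ : (fun x => _) =
    (fun x => dl * (dl + flat 0 (c + -1 * v x))^-1)); last first.
  by apply/funext => x; rewrite /k mulN1r.
apply/smooth_genP/sg_mul; first exact: sg_cst.
apply: sg_inv => [x|]; first by rewrite gt_eqF// den_gt0.
apply: sg_add; first exact: sg_cst.
apply/sg_flat/sg_add; first exact: sg_cst.
by apply: sg_mul; [exact: sg_cst|exact: sg_smooth].
Qed.

Let measurable_inv (g : R -> R) : (forall s, g s != 0) -> continuous g ->
  measurable_fun setT (fun s => (g s)^-1).
Proof.
move=> g0 cg.
have h : continuous (fun s => (g s)^-1) by move=> s; exact: cvgV (g0 s) (cg s).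
by have := continuous_measurable_fun h.
Qed.

Let continuous_den (dl : R) : continuous (fun s : R => dl + flat 0 (c - s)).
Proof.
move=> s; apply: cvgD; first exact: cvg_cst.
have h : (c - t) @[t --> s] --> c - s by apply: cvgB; [exact: cvg_cst|exact: cvg_id].
exact: (continuous_comp h (@continuous_flat R 0 (c - s))).
Qed.

Let measurable_k (dl : R) : 0 < dl -> measurable_fun setT (k dl).
Proof.
move=> d0; apply: measurable_funM => //; apply: measurable_inv => [s|].
  by rewrite gt_eqF// den_gt0.
exact: continuous_den.
Qed.

Let measurable_flatc j : measurable_fun setT (fun s : R => flat j (c - s)).
Proof.
apply: (measurableT_comp (f := @flat R j)).
  by have := continuous_measurable_fun (@continuous_flat R j).
exact: measurable_funB.
Qed.

Let measurable_k' (dl : R) : 0 < dl -> measurable_fun setT (k' dl).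
Proof.
move=> d0.
have mi : measurable_fun setT (fun s : R => (dl + flat 0 (c - s))^-1).
  by apply: measurable_inv => [s|]; [rewrite gt_eqF// den_gt0|exact: continuous_den].
rewrite (_ : k' dl = fun s => dl * flat 2 (c - s) *
  ((dl + flat 0 (c - s))^-1 * (dl + flat 0 (c - s))^-1)); last first.
  by apply/funext => s; rewrite /k' expr2 invfM.
apply: measurable_funM; last exact: measurable_funM.
by apply: measurable_funM => //; exact: measurable_flatc.
Qed.

Let le0_small (a K : R) : (forall eps, 0 < eps -> a <= K * eps) -> a <= 0.
Proof.
move=> h; rewrite leNgt; apply/negP => a0.
have K0 : 0 < K by rewrite -(pmulr_lgt0 _ (@ltr01 R)); exact: lt_le_trans (h _ ltr01).
have := h (a / (2 * K)); rewrite divr_gt0 ?mulr_gt0// => /(_ isT).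
rewrite (_ : K * _ = a / 2); first by lra.
by field; rewrite gt_eqF.
Qed.

Let L2_dotv_gradient psi : test_function V psi ->
  L2 V (fun x => dotv (F x) (gradient psi x)).
Proof.
move=> tpsi; apply/(L2P mV); split.
  by have /integ_measurable := L2_dotv mV hF (test_gradient_L2 oV bV tpsi).
have bnd i : exists M, forall x, `|partial i psi x| <= M.
  by have [M _ h] := test_function_bounded (test_function_partial i tpsi); exists M.
have /choice[M hM] := bnd.
have h : L2 V (fun x => enorm (F x) * \sum_i `|M i|).
  have := L2Z mV (\sum_i `|M i|) (L2v_enorm mV hF).
  by under eq_fun do rewrite mulrC.
apply: (integ_le mV (L2_sqr mV h)).
  apply: measurable_funX.
  by have /integ_measurable := L2_dotv mV hF (test_gradient_L2 oV bV tpsi).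
move=> x _; rewrite normrX lerXn2r ?nnegrE ?mulr_ge0 ?enorm_ge0 ?sumr_ge0//.
apply: le_trans (dotv_norm_le _ _) _; rewrite ler_wpM2l ?enorm_ge0//.
apply: le_trans (enorm_le_sum _) _; apply: ler_sum => i _.
by rewrite gradientE (le_trans (hM i x))// ler_norm.
Qed.

(* F . grad (k o u) >= 0 because k is nondecreasing, so testing div F against
   psi (k o u) only leaves the derivative of psi. *)
Let div_comp_le (dl : R) psi : 0 < dl -> test_function V psi -> (forall x, 0 <= psi x) ->
  \int[mu]_(x in V) ((w x * psi x + dotv (F x) (gradient psi x)) * k dl (u x)) <= 0.
Proof.
move=> d0 tpsi psi0; have spsi := test_smooth tpsi.
have hpsi := test_L2 oV bV tpsi.
have [M M0 psiM] := test_function_bounded tpsi.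
have mpsi := L2_measurable mV hpsi.
pose C := 4 / dl.
have dk (s : R) : is_derive s 1 (k dl) (k' dl s) by exact: is_derive_k.
have k'C (s : R) : `|k' dl s| <= C by exact: k'_le.
have C0 : 0 <= C := le_trans (normr_ge0 _) (k'C 0).
have lk := derive_lipschitz dk k'C.
have mk := measurable_k d0; have mk' := measurable_k' d0.
have hFp := L2_dotv_gradient tpsi.
have hwp : L2 V (fun x => w x * psi x) by apply: (L2_bdd mV hw mpsi (C := M)) => x _.
pose q x := w x * psi x + dotv (F x) (gradient psi x).
have hq : L2 V q by exact: L2D.
have hku : L2 V (fun x => k dl (u x)) by exact: (L2_lipschitz_comp oV bV mk lk hu).
pose K := L2norm V q * C + M * C * L2normv V F.
apply: (@le0_small _ K) => eps e0; have [_ /(_ _ e0)[phi tphi hphi]] := uG.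
have sphi := test_smooth tphi; have hphi2 := test_L2 oV bV tphi.
have mphi := L2_measurable mV hphi2.
have hdphi := test_gradient_L2 oV bV tphi.
have hgG : L2v V (fun x => gradient phi x - G x) by exact: L2vB.
have b1 : L2norm V (fun x => phi x - u x) <= eps.
  by apply: le_trans (ltW hphi); rewrite lerDl L2normv_ge0.
have b2 : L2normv V (fun x => gradient phi x - G x) <= eps.
  by apply: le_trans (ltW hphi); rewrite -[leLHS]add0r lerD ?L2norm_ge0.
have hkphi : L2 V (fun x => k dl (phi x)) by exact: (L2_lipschitz_comp oV bV mk lk hphi2).
have tpk : test_function V (fun x => psi x * k dl (phi x)).
  by apply: test_functionM => //; exact: smooth_k.
have gpk x : gradient (fun x => psi x * k dl (phi x)) x =
    k dl (phi x) *: gradient psi x + (psi x * k' dl (phi x)) *: gradient phi x.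
  rewrite gradientM//; last exact: smooth_k.
  congr (_ + _); apply/rowP => i; rewrite !mxE (partial_comp i sphi dk).
  by rewrite mulrA.
pose F' x := (psi x * k' dl (phi x)) *: F x.
have bF' x : V x -> `|psi x * k' dl (phi x)| <= M * C.
  by move=> _; rewrite normrM ler_pM.
have mF' : measurable_fun V (fun x => psi x * k' dl (phi x)).
  by apply: measurable_funM => //; exact: (measurableT_comp mk' mphi).
have hF' : L2v V F'.
  move=> i; under eq_fun do rewrite mxE mulrC.
  exact: L2_bdd (hF i) mF' bF'.
have nF' : L2normv V F' <= M * C * L2normv V F.
  rewrite -[X in X * _](ger0_norm (mulr_ge0 M0 C0)).
  rewrite -(L2normZ mV); last exact: L2v_enorm.
  apply: L2norm_le => //; [exact: L2v_enorm|by apply: L2Z => //; exact: L2v_enorm|].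
  apply: ae_onW => x Vx; rewrite enormZ [leLHS]normrM normr_id [leRHS]normrM ler_wpM2r//.
  by rewrite (le_trans (bF' x Vx))// ler_norm.
have iFpk : mu.-integrable V (EFin \o (fun x => dotv (F x) (gradient psi x) * k dl (phi x))).
  exact: L2_integM.
have e1 : \int[mu]_(x in V) (w x * psi x * k dl (phi x)) =
   - (\int[mu]_(x in V) (dotv (F x) (gradient psi x) * k dl (phi x)) +
      \int[mu]_(x in V) dotv (F' x) (gradient phi x)).
  have [_ _ /(_ _ tpk) wd] := Fw.
  rewrite (@eq_Rintegral _ _ _ mu V (fun x => w x * (psi x * k dl (phi x)))); last first.
    by move=> x _; rewrite mulrA.
  rewrite -[LHS]opprK -wd; congr (- _).
  rewrite -RintegralD//; last exact: L2_dotv.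
  by apply: eq_Rintegral => x _; rewrite gpk dotvDr !dotvZr dotvZl [k _ _ * _]mulrC.
(* Only the gap between grad phi and G is small; the rest, F' . G, is isolated because it has a
   sign. *)
have e2 : \int[mu]_(x in V) dotv (F' x) (gradient phi x) =
   \int[mu]_(x in V) dotv (F' x) (gradient phi x - G x) +
   \int[mu]_(x in V) dotv (F' x) (G x).
  rewrite -RintegralD//; [|exact: L2_dotv..].
  by apply: eq_Rintegral => x _; rewrite -dotvDr subrK.
have pos : 0 <= \int[mu]_(x in V) dotv (F' x) (G x).
  apply: ae_ge0_Rintegral => //; first exact: L2_dotv.
  by apply: ae_onS FG0 => x _ h; rewrite dotvZl mulr_ge0// mulr_ge0// k'_ge0.
have e3 : \int[mu]_(x in V) (q x * k dl (u x)) =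
   \int[mu]_(x in V) (w x * psi x * k dl (phi x)) +
   \int[mu]_(x in V) (dotv (F x) (gradient psi x) * k dl (phi x)) -
   \int[mu]_(x in V) (q x * (k dl (phi x) - k dl (u x))).
  rewrite -RintegralD//; last exact: L2_integM.
  rewrite -RintegralB//; last by apply: L2_integM => //; exact: L2B.
    by apply: eq_Rintegral => x _; rewrite /q; ring.
  by apply: integD => //; exact: L2_integM.
have c1 := L2_CS mV hq (L2B mV hkphi hku).
have c2 := L2v_CS mV hF' hgG.
have c3 := L2norm_comp_le oV bV mk lk hphi2 hu.
have d1 : L2norm V q * L2norm V (fun x => k dl (phi x) - k dl (u x)) <= L2norm V q * (C * eps).
  rewrite ler_wpM2l ?L2norm_ge0//; apply: le_trans c3 _; exact: ler_wpM2l.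
have d2 : L2normv V F' * L2normv V (fun x => gradient phi x - G x) <=
   M * C * L2normv V F * eps by apply: ler_pM => //; exact: L2norm_ge0.
move: c1 c2; rewrite !ler_norml => /andP[c1 _] /andP[c2 _].
by rewrite e3 e1 e2 /K; lra.
Qed.

(** As dl tends to 0, k(u) tends to the indicator of A = {u = c}, since u <= c almost everywhere. F
    vanishes on A, so the limit of the integrals in [div_comp_le] is the integral of w psi over
    A. *)
Lemma div_contact_le0 : ae_on V (fun x => u x = c -> w x <= 0).
Proof.
have mu_ := L2_measurable mV hu.
pose A := V `&` [set x | u x = c].
have mA : measurable A.
  rewrite (_ : A = V `&` u @^-1` [set c])//; exact: mu_.
have mind : measurable_fun V (\1_A : E -> R).
  by apply: measurable_funTS; exact: measurable_indic.
have ind1 x : V x -> `|(\1_A x : R)| <= 1.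
  by move=> _; rewrite indicE; case: (_ \in _); rewrite ?normr1 ?normr0.
have iw := L2_integ mV Voo hw.
have im : mu.-integrable V (EFin \o (fun x => - (w x * \1_A x))).
  by apply: integN; exact: integM ind1.
suff : ae_on V (fun x => 0 <= - (w x * \1_A x)).
  apply: ae_onS => x Vx + ux; rewrite indicE mem_set// mulr1.
  by rewrite oppr_ge0.
apply: (test_nonneg_ae mV oV (@subset_refl _ V) im) => psi tpsi psi0.
have hpsi := test_L2 oV bV tpsi; have mpsi := L2_measurable mV hpsi.
have [M M0 psiM] := test_function_bounded tpsi.
have hFp := L2_dotv_gradient tpsi.
have hwp : L2 V (fun x => w x * psi x) by apply: (L2_bdd mV hw mpsi (C := M)) => x _.
pose q x := w x * psi x + dotv (F x) (gradient psi x).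
have hq : L2 V q by exact: L2D.
have iq := L2_integ mV Voo hq; have mq := L2_measurable mV hq.
pose dl (m : nat) : R := m.+1%:R^-1.
have dl0 m : 0 < dl m by rewrite invr_gt0 ltr0n.
have cdl : dl m @[m --> \oo] --> (0 : R) by exact: cvg_harmonic.
have lim : \int[mu]_(x in V) (q x * k (dl m) (u x)) @[m --> \oo] -->
   \int[mu]_(x in V) (q x * \1_A x).
  apply: (dominated_cvg_Rintegral mV _ _ (integ_norm iq)).
  - move=> m; apply: measurable_funM => //.
    exact: (measurableT_comp (measurable_k (dl0 m)) mu_).
  - exact: measurable_funM.
  - apply: ae_onS uc => x Vx ucx; apply: cvgM; first exact: cvg_cst.
    rewrite indicE; have [ux|ux] := pselect (u x = c).
      rewrite mem_set//; apply: cvg_near_cst; apply: nearW => m.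
      by rewrite /k ux subrr flat_eq0// addr0 mulfV// gt_eqF.
    rewrite memNset; last by case.
    have fp : 0 < flat 0 (c - u x).
      by rewrite flat_gt0// subr_gt0 lt_neqAle ucx andbT; exact/eqP.
    rewrite -[X in _ --> X](mul0r (0 + flat 0 (c - u x))^-1).
    apply: cvgM => //; apply: cvgV; first by rewrite add0r gt_eqF.
    by apply: cvgD => //; exact: cvg_cst.
  - move=> m x _; rewrite normrM ler_piMr//.
    by rewrite ger0_norm ?k_ge0// k_le1.
have le0 : \int[mu]_(x in V) (q x * \1_A x) <= 0.
  rewrite -(cvg_lim (@norm_hausdorff _ _) lim).
  apply: limr_le; first by apply/cvg_ex; eexists; exact: lim.
  by apply: nearW => m; exact: div_comp_le.
have iwi : mu.-integrable V (EFin \o (fun x => w x * psi x * \1_A x)).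
  by apply: (integM mV _ mind ind1); exact: L2_integ.
rewrite (@eq_Rintegral _ _ _ mu V (fun x => - (w x * psi x * \1_A x))); last first.
  by move=> x _; ring.
rewrite RintegralN// oppr_ge0; apply: le_trans le0.
apply: ae_le_Rintegral => //; first exact: integM ind1.
apply: ae_onS F0 => x Vx hx; rewrite /q indicE.
have [ux|ux] := pselect (u x = c); first by rewrite mem_set// (hx ux) dotv0l addr0.
by rewrite memNset ?mulr0//; case.
Qed.

End lewy_stampacchia.

(** * Quadratic detachment from the contact set *)

Section directional.
Context {R : realType} {n : nat}.
Local Notation E := 'rV[R]_n.
Implicit Types (u v : E -> R).

(** [smooth] speaks of derivatives along the coordinate axes, whereas bumps will be moved in an
    arbitrary direction h. For bumps the formula follows from closure under products and
    compositions. *)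
Definition dirdiff u := forall x h,
  is_derive x h u (\sum_j h ord0 j * partial j u x).

Lemma dirdiffI u (du : 'I_n -> E -> R) :
  (forall x h, is_derive x h u (\sum_j h ord0 j * du j x)) -> dirdiff u.
Proof.
move=> hu x h; apply: is_derive_eq (hu x h) _; apply: eq_bigr => j _; congr (_ * _).
have [_ e] := hu x (delta_mx ord0 j); rewrite /partial e (bigD1 j)//= mxE !eqxx mul1r.
by rewrite big1 ?addr0// => i ij; rewrite mxE (negbTE ij) andbF mul0r.
Qed.

Lemma dirdiffM u v : dirdiff u -> dirdiff v -> dirdiff (fun x => u x * v x).
Proof.
move=> du dv; apply: (@dirdiffI _ (fun j x => partial j u x * v x + u x * partial j v x)).
move=> x h; apply: is_derive_eq (is_derive_funM (du x h) (dv x h)) _.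
by rewrite mulr_suml mulr_sumr -big_split; apply: eq_bigr => j _ /=; ring.
Qed.

Lemma dirdiff_affine (a b : R) i : dirdiff (fun x : E => a + b * x ord0 i).
Proof.
apply: (@dirdiffI _ (fun j _ => b * (j == i)%:R)) => x h.
have hh := is_derive_funD (is_derive_cst a x h)
  (is_derive_funM (is_derive_cst b x h) (is_derive_coord i x h)).
apply: (is_derive_eq hh); rewrite mul0r !add0r (bigD1 i)//= eqxx big1 => [|j ji].
  by rewrite /=; ring.
by rewrite (negbTE ji) !mulr0.
Qed.

Lemma dirdiff_comp (k k' : R -> R) u : (forall s : R, is_derive s 1 k (k' s)) ->
  dirdiff u -> dirdiff (fun x => k (u x)).
Proof.
move=> dk du; apply: (@dirdiffI _ (fun j x => k' (u x) * partial j u x)) => x h.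
apply: is_derive_eq (is_derive_fun1 (dk _) (du x h)) _.
by rewrite mulr_sumr; apply: eq_bigr => j _; ring.
Qed.

Lemma dirdiff_prod (I : Type) (s : seq I) (F : I -> E -> R) :
  (forall i, dirdiff (F i)) -> dirdiff (fun x => \prod_(i <- s) F i x).
Proof.
move=> dF; elim: s => [|i s IH].
  under eq_fun do rewrite big_nil.
  apply: (@dirdiffI _ (fun _ _ => 0)) => x h.
  by apply: is_derive_eq (is_derive_cst _ _ _) _; rewrite big1// => j _; rewrite mulr0.
by under eq_fun do rewrite big_cons; exact: dirdiffM.
Qed.

Lemma dirdiff_bumpv (c : E) r : dirdiff (bumpv c r).
Proof.
apply: dirdiff_prod => i; apply: dirdiffM.
  apply: (dirdiff_comp (is_derive_flat 0)).
  rewrite (_ : (fun x : E => _) = (fun x : E => (r - c ord0 i) + 1 * x ord0 i)).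
    exact: dirdiff_affine.
  by apply/funext => x; ring.
apply: (dirdiff_comp (is_derive_flat 0)).
rewrite (_ : (fun x : E => _) = (fun x : E => (r + c ord0 i) + (-1) * x ord0 i)).
  exact: dirdiff_affine.
by apply/funext => x; ring.
Qed.

Lemma bumpv_shift (c a : E) r x : bumpv (c + a) r x = bumpv c r (x - a).
Proof. by apply: eq_bigr => i _; rewrite !mxE opprD addrA addrAC. Qed.

Lemma partial_shift u (a x : E) j :
  partial j (fun x => u (x - a)) x = partial j u (x - a).
Proof.
rewrite /partial /derive (_ : (fun h : R => _) = (fun h : R =>
  h^-1 *: ((u \o shift (x - a)) (h *: delta_mx ord0 j) - u (x - a))))//.
by apply/funext => h /=; rewrite addrA.
Qed.

Lemma compact_tube (K V : set E) : compact K -> open V -> K `<=` V ->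
  exists2 r, 0 < r & forall x, K x -> ocube x r `<=` V.
Proof.
move=> cK /open_rVP oV KV.
have cover : forall x, K x -> \forall x' \near x & r \near (0 : R)^'+, ocube x' r `<=` V.
  move=> x /KV Vx; have [rho rho0 hrho] := oV x Vx.
  have r2 : 0 < rho / 2 by rewrite divr_gt0.
  exists (ocube x (rho / 2), [set r | r < rho / 2]) => /=.
    split; last exact: (nbhs_right_lt r2).
    rewrite -nbhs_ballE; exists (rho / 2) => //= y [_ yx] i.
    by rewrite distrC; exact: yx.
  move=> [x' r] /= [hx' hr] z hz; apply: hrho => i.
  rewrite (le_lt_trans (ler_distD (x' ord0 i) _ _))// [ltRHS]splitr ltrD//.
  exact: lt_trans (hz i) hr.
have := (@compact_near_coveringP _ K).1 cK R (0^'+) (fun r x => ocube x r `<=` V) _ cover.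
move=> near_r.
have : \forall r \near (0 : R)^'+, 0 < r /\ K `<=` [set x | ocube x r `<=` V].
  by near=> r; split; near: r; [exact: nbhs_right_gt|exact: near_r].
by move=> /filter_ex[r [r0 hr]]; exists r.
Unshelve. all: by end_near. Qed.

End directional.

Section contact_quadratic.
Context {R : realType} {n : nat}.
Local Notation E := 'rV[R]_n.
Local Notation mu := (lebesgue_rV n : {measure set 'rV[R]_n -> \bar R}).
Implicit Types (m u v : E -> R) (x y z h : E).
Variables (V : set E) (oV : open V) (bV : bounded_set V).
Local Notation integ f := (mu.-integrable V (EFin \o f)).

Let mV : measurable V. Proof. exact: open_rV_measurable. Qed.
Let Voo : (mu V < +oo)%E. Proof. exact: bounded_rV_finite. Qed.

Lemma Linfty_bound m : Linfty V m ->
  [/\ measurable_fun V m, exists2 M, 0 <= M & ae_on V (fun x => `|m x| <= M) & integ m].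
Proof.
move=> hm; have mm : measurable_fun V m.
  by apply/(measurable_restrictT _ mV); have /sub_Lfun_mfun := hm; rewrite inE.
(* At exponent +oo the norm is the essential supremum provided that the whole space has positive
   measure. *)
have muT : (0 < mu setT)%E by apply: open_rV_gt0; [exact: openT|exists 0].
have bnd : exists2 M, 0 <= M & ae_on V (fun x => `|m x| <= M).
  have /sub_Lfun_finLfun := hm; rewrite inE /finite_norm unlock/= muT => fin.
  set s := ess_sup _ _ in fin.
  have := ess_sup_ge mu (abse \o (EFin \o (m \_ V))); rewrite -/s => h.
  exists (Num.max 0 (fine s)); first by rewrite le_max lexx.
  rewrite /ae_on; apply: filterS h => x /= hx Vx.
  have : (`|m x|%:E <= s)%E by move: hx; rewrite /patch mem_set.
  move: fin {hx}; move: s => s; case: s => [r _|//|_].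
    by rewrite lee_fin => hr /=; rewrite le_max hr orbT.
  by rewrite leNgt ltNyr.
split=> //; have [M M0 mM] := bnd.
(* Truncation at the essential bound gives a bounded function, integrable since V has finite
   measure, and equal to m almost everywhere. *)
pose m' x := Num.min M (Num.max (- M) (m x)).
have mm' : measurable_fun V m'.
  by apply: measurable_minr => //; exact: measurable_maxr.
have im' : integ m'.
  apply: L2_integ => //; apply: (L2_bounded mV Voo (C := M)) => // x _.
  by rewrite /m' ler_norml ge_min lexx/= le_min le_max lexx/= andbT; lra.
apply/integrableP; split; first exact/measurable_EFinP.
have /integrableP[_] := im'; congr (_ < _)%E.
apply: ae_eq_integral => //; first by apply: measurableT_comp => //; exact/measurable_EFinP.
  by apply: measurableT_comp => //; exact/measurable_EFinP.
apply: ae_onS mM => x _; rewrite ler_norml => /andP[h1 h2] /=.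
by rewrite /m' (max_idPr h1) (min_idPr h2).
Qed.

(** Differentiation under the integral. The bump at y + s h is the fixed one evaluated at x - s h,
    whence a minus sign; the one in [weak_partial] later cancels it when the derivative is moved
    onto the weight. *)
Lemma derive_moving_bump m (y h : E) (r t : R) : integ m ->
  is_derive t 1 (fun s : R => \int[mu]_(x in V) (m x * bumpv (y + s *: h) r x))
   (- \sum_j h ord0 j * \int[mu]_(x in V) (m x * partial j (bumpv (y + t *: h) r) x)).
Proof.
move=> im; have mm := integ_measurable im.
have tb := @test_bumpv R n setT y r (@subsetT _ _).
have sb := test_smooth tb.
have bnd j : exists M, forall x, `|partial j (bumpv y r) x| <= M.
  by have [M _ hM] := test_function_bounded (test_function_partial j tb); exists M.
have [M hM] := choice bnd.
pose f (s : R) (x : E) := m x * bumpv (y + s *: h) r x.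
have dfE (s : R) (x : E) : is_derive s 1 (f ^~ x)
    (- (m x * \sum_j h ord0 j * partial j (bumpv y r) (x - s *: h))).
  have d1 := @dirdiff_bumpv R n y r (x + s *: (- h)) (- h).
  have d2 := (is_derive_line _ _ _ _ _).1 d1.
  have d3 := @is_derive_funM R R^o _ _ s 1 _ _ (is_derive_cst (m x : R^o) (s : R^o) 1) d2.
  rewrite (_ : f ^~ x = (fun t0 : R => cst (m x) t0 * bumpv y r (x + t0 *: - h))); last first.
    by apply/funext => s' /=; rewrite /f bumpv_shift scalerN.
  apply: (is_derive_eq d3); rewrite mul0r add0r /= -mulrN scalerN; congr (_ * _).
  by rewrite -sumrN; apply: eq_bigr => j _; rewrite mxE mulNr.
have pE j s x : partial j (bumpv (y + s *: h) r) x = partial j (bumpv y r) (x - s *: h).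
  rewrite -partial_shift; congr (partial j _ x); apply/funext => z.
  exact: bumpv_shift.
have d1f (s : R) (x : E) : partial1of2 f s x =
    - (m x * \sum_j h ord0 j * partial j (bumpv (y + s *: h) r) x).
  rewrite partial1of2E; have [_ ->] := dfE s x; congr (- (_ * _)).
  by apply: eq_bigr => j _; rewrite pE.
have sbs s : smooth (bumpv (y + s *: h) r) by exact: smooth_bumpv.
have intf s : integ (f s).
  apply: (integM mV im (C := 1)); first exact: measurable_funTS (smooth_measurable (sbs s)).
  by move=> x _; rewrite ger0_norm ?bumpv_ge0// bumpv_le1.
have mp j : measurable_fun V (partial j (bumpv (y + t *: h) r)).
  exact: measurable_funTS (smooth_measurable (partial_smooth j (sbs t))).
pose K := \sum_j `|h ord0 j| * `|M j|.
have bK s x : `|\sum_j h ord0 j * partial j (bumpv (y + s *: h) r) x| <= K.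
  apply: le_trans (ler_norm_sum _ _ _) _; apply: ler_sum => j _.
  by rewrite normrM ler_wpM2l// pE (le_trans (hM j _))// ler_norm.
have ip j : integ (fun x => m x * partial j (bumpv (y + t *: h) r) x).
  by apply: (integM mV im (mp j) (C := M j)) => x _; rewrite pE.
have G0 x : 0 <= K * `|m x|.
  by rewrite mulr_ge0// sumr_ge0// => j _; rewrite mulr_ge0.
have iG : integ (fun x => K * `|m x|) by apply: integZ => //; exact: integ_norm.
have ub s x : `|partial1of2 f s x| <= K * `|m x|.
  by rewrite d1f normrN normrM mulrC ler_wpM2r.
have It : `]t - 1, t + 1[%classic t by rewrite /= in_itv/=; apply/andP; split; lra.
have df (x : R) (y0 : E) (_ : `]t - 1, t + 1[%classic x) (_ : V y0) : derivable (f ^~ y0) x 1.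
  by have [] := dfE x y0.
have gub (x : R) (y0 : E) (_ : `]t - 1, t + 1[%classic x) (_ : V y0) : `|partial1of2 f x y0| <= K * `|m y0|.
  exact: ub.
have D1 := @derivable_under_integral R _ _ mu f V mV t (t - 1) (t + 1) It
   (fun s _ => intf s) df _ G0 iG gub.
have D2 := @differentiation_under_integral R _ _ mu f V mV t (t - 1) (t + 1) It
   (fun s _ => intf s) df _ G0 iG gub.
apply: DeriveDef => //; rewrite -derive1E D2.
under eq_Rintegral do rewrite d1f.
rewrite RintegralN//; last first.
  apply: (integM mV im (C := K)) => [|x _]; last exact: bK.
  by apply: measurable_sum => j; exact: measurable_funM (measurable_cst _) (mp j).
congr (- _).
rewrite (@eq_Rintegral _ _ _ mu V (fun x => \sum_j h ord0 j * (m x * partial j (bumpv (y + t *: h) r) x))); last first.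
  by move=> x _; rewrite mulr_sumr; apply: eq_bigr => j _; ring.
rewrite Rintegral_sum//; last by move=> j; exact: integZ.
by apply: eq_bigr => j _; rewrite RintegralZl.
Qed.

Lemma MVT_closed (f df : R -> R) (a b : R) : a <= b ->
  (forall x : R, a <= x <= b -> is_derive x 1 f (df x)) ->
  exists2 xi, a <= xi <= b & f b - f a = df xi * (b - a).
Proof.
move=> ab dfx; have [||xi xiab ->] := @MVT_segment R f df a b ab.
- by move=> x /subset_itv_oo_cc; rewrite in_itv/=; exact: dfx.
- apply: derivable_within_continuous => x; rewrite in_itv/= => /dfx[] //.
- by exists xi => //; rewrite in_itv/= in xiab.
Qed.

Lemma is_derive_funsum (I : Type) (s : seq I) (f : I -> R -> R) (df : I -> R) (t : R) :
  (forall i, is_derive t 1 (f i) (df i)) ->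
  is_derive t 1 (fun x : R => \sum_(i <- s) f i x) (\sum_(i <- s) df i).
Proof.
move=> hf; elim: s => [|i s IH].
  by under eq_fun do rewrite big_nil; rewrite big_nil; exact: is_derive_cst.
by under eq_fun do rewrite big_cons; rewrite big_cons; exact: is_derive_funD.
Qed.

Lemma bumpv_integral_gt0 (y : E) (r : R) : 0 < r -> 0 < \int[mu]_x bumpv y r x.
Proof.
move=> r0; have tb := @test_bumpv R n setT y r (@subsetT _ _).
rewrite ltNge; apply/negP => le0.
have := ae_eq0_Rintegral measurableT (test_function_integrable tb)
  (aeW _ (fun x _ => bumpv_ge0 y r x)) le0.
move=> -[N [mN N0 hN]].
have sub : ocube y r `<=` N.
  move=> x xy; apply: hN => /= h; have := bumpv_gt0 xy.
  by rewrite h// ltxx.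
have : (lebesgue_rV n (ocube y r) <= 0)%E.
  rewrite -[X in (_ <= X)%E]N0; apply: le_measure; rewrite ?inE//.
  exact: measurable_ocube.
by rewrite lebesgue_rV_ocube// lee_fin leNgt exprn_gt0// mulrn_wgt0.
Qed.

Lemma integral_moving_bump (y a : E) (r : R) : ccube (y + a) r `<=` V ->
  \int[mu]_(x in V) bumpv (y + a) r x = \int[mu]_x bumpv y r x.
Proof.
move=> QV; rewrite Rintegral_out; last first.
  by move=> x; exact: test_function_out (test_bumpv QV).
under eq_Rintegral do rewrite bumpv_shift.
have tb := @test_bumpv R n setT y r (@subsetT _ _).
exact: (Rintegral_translate (- a) (test_function_integrable tb)).
Qed.

(** [b] adds k t^2 / 2 to [A] and is thus convex on [-s, 1]: its chord over [-s, 0] is no steeper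
    than its chord over [0, 1]. *)
Lemma three_point (A B C : R -> R) (s k : R) : 0 < s ->
  (forall t : R, - s <= t <= 1 -> is_derive t 1 A (B t)) ->
  (forall t : R, - s <= t <= 1 -> is_derive t 1 B (C t)) ->
  (forall t : R, - s <= t <= 1 -> - k <= C t) ->
  A 0 - A (- s) - k / 2 * s ^+ 2 <= s * (A 1 - A 0 + k / 2).
Proof.
move=> s0 dA dB bC.
pose b (t : R) := A t + k / 2 * (t * t).
pose b' (t : R) := B t + k * t.
have db (t : R) : - s <= t <= 1 -> is_derive t 1 b (b' t).
  move=> ht.
  have d1 := @is_derive_funM R R^o _ _ t 1 _ _ (is_derive_id (t : R^o) 1) (is_derive_id (t : R^o) 1).
  have d2 := @is_derive_funM R R^o _ _ t 1 _ _ (is_derive_cst (k / 2 : R^o) (t : R^o) 1) d1.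
  have d := @is_derive_funD R R^o _ _ t 1 _ _ (dA t ht) d2.
  by apply: (is_derive_eq d); rewrite /b' /=; lra.
have db' (t : R) : - s <= t <= 1 -> is_derive t 1 b' (C t + k).
  move=> ht.
  have d2 := @is_derive_funM R R^o _ _ t 1 _ _ (is_derive_cst (k : R^o) (t : R^o) 1)
    (is_derive_id (t : R^o) 1).
  have d := @is_derive_funD R R^o _ _ t 1 _ _ (dB t ht) d2.
  by apply: (is_derive_eq d) => /=; lra.
have [||xi1 /andP[x11 x12] e1] := @MVT_closed b b' 0 1.
- exact: ler01.
- by move=> x /andP[xa xb]; apply: db; apply/andP; split; lra.
have [||xi2 /andP[x21 x22] e2] := @MVT_closed b b' (- s) 0.
- by rewrite oppr_le0 ltW.
- by move=> x /andP[xa xb]; apply: db; apply/andP; split; lra.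
have [||xi3 /andP[x31 x32] e3] := @MVT_closed b' (fun t => C t + k) xi2 xi1.
- exact: le_trans x22 x11.
- by move=> x /andP[xa xb]; apply: db'; apply/andP; split; lra.
have b'mono : b' xi2 <= b' xi1.
  rewrite -subr_ge0 e3 mulr_ge0//; last by rewrite subr_ge0 (le_trans x22 x11).
  have : - k <= C xi3 by apply: bC; apply/andP; split; lra.
  by lra.
have := ler_wpM2l (ltW s0) b'mono.
have /= E1 := congr1 ( *%R s) e1.
by move: E1 e2; rewrite /b; lra.
Qed.

(** The errors are eps + 2 s eps from the values of the averages and (s + s^2) k / 2 from the
    curvature; s <= 1 turns these into 3 eps and s k. [J] is the mass of the bump, divided out at
    the end. *)
Lemma contact_arith (c uz eps s k J a0 a1 as_ : R) : 0 < eps -> 0 < s -> s <= 1 ->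
  0 < J -> 0 <= k -> (c - eps) * J <= a0 -> a1 <= (uz + eps) * J -> as_ <= c * J ->
  a0 - as_ - k * J / 2 * s ^+ 2 <= s * (a1 - a0 + k * J / 2) ->
  s * (c - uz) <= s * k + 3 * eps.
Proof.
move=> e0 s0 s1 J0 k0 h0 h1 hs ineq.
have fin : 0 <= (s * (uz - c) + s * k + 3 * eps) * J.
  have p1 : s * a1 <= s * ((uz + eps) * J) by rewrite ler_wpM2l// ltW.
  have p2 : s * ((c - eps) * J) <= s * a0 by rewrite ler_wpM2l// ltW.
  have p3 : 0 <= s * (1 - s) * (k * J).
    by apply: mulr_ge0; [apply: mulr_ge0; [exact: ltW|lra]|apply: mulr_ge0 => //; exact: ltW].
  have p4 : 0 <= (1 - s) * (eps * J).
    by apply: mulr_ge0; [lra|apply: mulr_ge0; exact: ltW].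
  lra.
by move: fin; rewrite pmulr_lge0//; lra.
Qed.

(* Averages of u over bumps moving along the segment have a second derivative
   bounded below, since the second derivatives fall on u; near the contact point
   they are at most c on both sides, which forces a vanishing slope there. *)
Lemma contact_quadratic u : W2infty V u -> {in V, continuous u} ->
  exists2 M, 0 <= M & forall c y z, (forall x, V x -> u x <= c) -> V y -> u y = c ->
    (forall t, 0 <= t <= 1 -> V (y + t *: (z - y))) ->
    c - u z <= M * enorm (z - y) ^+ 2.
Proof.
move=> [G [H [Lu LG wG LH wH]]] cu.
have [_ _ iu] := Linfty_bound Lu.
have iG i : integ (fun x => G x ord0 i) by have [] := Linfty_bound (LG i).
have iH i j : integ (H i j) by have [] := Linfty_bound (LH i j).
have [MH hMH] : exists MH : 'I_n * 'I_n -> R, forall p,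
    0 <= MH p /\ ae_on V (fun x => `|H p.1 p.2 x| <= MH p).
  have ex (p : 'I_n * 'I_n) : exists M : R, 0 <= M /\ ae_on V (fun x => `|H p.1 p.2 x| <= M).
    by have [_ [M M0 hM] _] := Linfty_bound (LH p.1 p.2); exists M.
  by have [f hf] := choice ex; exists f.
(* Each |h_i| is at most |h|, so the sum of the bounds of all entries controls the second derivative
   along h by [m0] |h|^2. It is chosen before c, y and z. *)
pose m0 := \sum_i \sum_j MH (i, j).
have m00 : 0 <= m0 by apply: sumr_ge0 => i _; apply: sumr_ge0 => j _; case: (hMH (i, j)).
exists m0 => // c y z uc Vy uy seg; set h := z - y.
have Pz : y + 1 *: h = z by rewrite scale1r addrC subrK.
have Vz : V z by rewrite -Pz; apply: seg; rewrite ler01 lexx.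
have [ry ry0 hry] := (open_rVP V).1 oV y Vy.
(* V being open, the segment is prolonged behind y by a parameter length s0, at most 1 as
   [contact_arith] asks. N stays positive even when h = 0. *)
pose N : R := `|h| + 1; have N0 : 0 < N by rewrite ltr_wpDl.
pose s0 : R := Num.min 1 (ry / N / 2).
have s00 : 0 < s0 by rewrite lt_min ltr01 !divr_gt0.
have s01 : s0 <= 1 by rewrite ge_min lexx.
have small (t : R) i : `|t| <= s0 -> `|(t *: h) ord0 i| < ry.
  move=> ts; rewrite mxE normrM (@le_lt_trans _ _ (s0 * N))//.
    by apply: ler_pM => //; rewrite (le_trans (coord_le_norm _ _))// lerDl.
  rewrite (@le_lt_trans _ _ (ry / N / 2 * N))//.
    by rewrite ler_wpM2r ?(ltW N0)// ge_min lexx orbT.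
  by rewrite mulrAC mulfVK ?gt_eqF// ltr_pdivrMr//; lra.
have Vrange (t : R) : - s0 <= t <= 1 -> V (y + t *: h).
  move=> /andP[t1 t2]; have [t0|t0] := leP t 0.
    apply: hry => i; rewrite mxE addrAC subrr add0r small//.
    by rewrite ler_norml t1 (le_trans t0)// ltW.
  by apply: seg; rewrite (ltW t0).
have rng0 : - s0 <= (0 : R) <= 1.
  by apply/andP; split; [rewrite oppr_le0 ltW|exact: ler01].
have rng1 : - s0 <= (1 : R) <= 1.
  by apply/andP; split=> //; rewrite (le_trans _ (@ler01 R))// oppr_le0 ltW.
have rngs : - s0 <= - s0 <= 1.
  by apply/andP; split=> //; rewrite (le_trans _ (@ler01 R))// oppr_le0 ltW.
pose K := (fun t : R => y + t *: h) @` `[- s0, 1]%classic.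
have cK : compact K.
  apply: continuous_compact; last exact: segment_compact.
  apply: continuous_subspaceT => t; apply: cvgD; first exact: cvg_cst.
  by apply: cvgZr_tmp.
have KV : K `<=` V by move=> _ [t + <-]; rewrite /= in_itv/=; exact: Vrange.
have [r1 r10 hr1] := compact_tube cK oV KV.
(* [s0] does not depend on eps, so eps can tend to 0 here and s0 be divided out afterwards. *)
suff main eps : 0 < eps -> s0 * (c - u z) <= s0 * (m0 * enorm h ^+ 2) + 3 * eps.
  rewrite leNgt; apply/negP => lt; set k0 := m0 * _ in main lt *.
  have e0 : 0 < s0 * (c - u z - k0) / 6 by rewrite divr_gt0// mulr_gt0// subr_gt0.
  have := main _ e0; nra.
move=> e0.
have near_u (x : E) : V x -> exists2 r, 0 < r & forall x', ocube x r x' -> `|u x' - u x| <= eps.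
  move=> Vx; have cux : {for x, continuous u} by apply: cu; rewrite inE.
  move/cvgrPdist_le : cux => /(_ _ e0); rewrite -nbhs_ballE => -[r /= r0 hr].
  exists r => // x' hx'; rewrite distrC; apply: hr; split => // i j.
  by rewrite [i]ord1 /ball/= distrC; exact: hx'.
have [r2 r20 hr2] := near_u _ Vy; have [r3 r30 hr3] := near_u _ Vz.
(* Strictly below the tube radius because the bumps are supported in closed cubes; at most [r2] and
   [r3] so that u is within eps of its values at y and z on the bumps centred there. *)
pose r := Num.min (r1 / 2) (Num.min r2 r3).
have r0 : 0 < r by rewrite !lt_min divr_gt0//= r20 r30.
have rr1 : r < r1 by rewrite gt_min ltr_pdivrMr// mulr_natr mulr2n ltrDl r10.
have Q (t : R) : - s0 <= t <= 1 -> ccube (y + t *: h) r `<=` V.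
  move=> ht x hx; apply: (hr1 (y + t *: h)); first by exists t => //=; rewrite in_itv.
  by move=> i; exact: le_lt_trans (hx i) rr1.
pose J := \int[mu]_x bumpv y r x.
have J0 : 0 < J by exact: bumpv_integral_gt0.
pose phi (t : R) := bumpv (y + t *: h) r.
have Jphi (t : R) : - s0 <= t <= 1 -> \int[mu]_(x in V) phi t x = J.
  by move=> ht; apply: integral_moving_bump; exact: Q.
have mphi t : measurable_fun V (phi t).
  exact: measurable_funTS (smooth_measurable (smooth_bumpv _ _)).
have phi1 t x : V x -> `|phi t x| <= 1.
  by move=> _; rewrite ger0_norm ?bumpv_ge0// bumpv_le1.
have iphi t : integ (phi t).
  exact: (L2_integ mV Voo (L2_bounded mV Voo (mphi t) (phi1 t))).
have imphi m t : integ m -> integ (fun x => m x * phi t x).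
  by move=> im; exact: integM im (mphi t) (phi1 t).
pose A (t : R) := \int[mu]_(x in V) (u x * phi t x).
pose B (t : R) := \sum_j h ord0 j * \int[mu]_(x in V) (G x ord0 j * phi t x).
pose C (t : R) := \sum_i h ord0 i * \sum_j h ord0 j * \int[mu]_(x in V) (H i j x * phi t x).
have dA (t : R) : - s0 <= t <= 1 -> is_derive t 1 A (B t).
  move=> ht; apply: is_derive_eq (derive_moving_bump y h r t iu) _.
  rewrite -sumrN; apply: eq_bigr => j _; rewrite -mulrN; congr (_ * _).
  by rewrite (wG j _ (test_bumpv (Q t ht))) opprK.
have dB (t : R) : - s0 <= t <= 1 -> is_derive t 1 B (C t).
  move=> ht; apply: is_derive_funsum => i.
  have d1 := derive_moving_bump y h r t (iG i).
  have d2 := @is_derive_funM R R^o _ _ t 1 _ _ (is_derive_cst (h ord0 i : R^o) (t : R^o) 1) d1.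
  apply: (is_derive_eq d2); rewrite mul0r add0r; congr (_ * _).
  rewrite -sumrN; apply: eq_bigr => j _; rewrite -mulrN; congr (_ * _).
  by rewrite (wH i j _ (test_bumpv (Q t ht))) opprK.
pose kap := m0 * enorm h ^+ 2 * J.
have kap0 : 0 <= kap by exact: mulr_ge0 (mulr_ge0 m00 (sqr_ge0 _)) (ltW J0).
have bC (t : R) : - s0 <= t <= 1 -> - kap <= C t.
  move=> ht; suff : `|C t| <= kap by rewrite ler_norml => /andP[].
  apply: le_trans (ler_norm_sum _ _ _) _; rewrite /kap /m0 !mulr_suml.
  apply: ler_sum => i _; rewrite normrM.
  apply: (@le_trans _ _ (`|h ord0 i| * \sum_j `|h ord0 j * \int[mu]_(x in V) (H i j x * phi t x)|)).
    by rewrite ler_wpM2l// ler_norm_sum.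
  rewrite mulr_sumr !mulr_suml; apply: ler_sum => j _; rewrite normrM.
  have [M0 hM] := hMH (i, j).
  have iHp := imphi _ t (iH i j).
  have b : `|\int[mu]_(x in V) (H i j x * phi t x)| <= MH (i, j) * J.
    apply: le_trans (le_normr_Rintegral mV iHp) _.
    rewrite -(Jphi t ht) -RintegralZl//; apply: ae_le_Rintegral => //.
    - exact: integ_norm.
    - exact: integZ.
    apply: ae_onS hM => x _ /= hx.
    by rewrite normrM (ger0_norm (bumpv_ge0 _ _ _)) ler_wpM2r ?bumpv_ge0.
  rewrite (_ : MH (i, j) * enorm h ^+ 2 * J = enorm h * (enorm h * (MH (i, j) * J))); last by ring.
  by apply: ler_pM; rewrite ?coord_le_enorm ?mulr_ge0//; apply: ler_pM; rewrite ?coord_le_enorm.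
have ineq := three_point s00 dA dB bC.
have A0 : (c - eps) * J <= A 0.
  rewrite -(Jphi 0 rng0) -(RintegralZl _ mV (iphi 0)).
  apply: (le_Rintegral mV (integZ mV _ (iphi 0)) (imphi u 0 iu)) => x Vx; have [xy|xy] := pselect (ocube y r x).
    rewrite ler_wpM2r ?bumpv_ge0//.
    have : `|u x - u y| <= eps.
      by apply: hr2 => i; apply: lt_le_trans (xy i) _; rewrite !ge_min lexx orbT.
    by rewrite uy ler_norml lerBrDl => /andP[].
  by rewrite /phi scale0r addr0 bumpv_eq0// !mulr0.
have A1 : A 1 <= (u z + eps) * J.
  rewrite -(Jphi 1 rng1) -(RintegralZl _ mV (iphi 1)).
  apply: (le_Rintegral mV (imphi u 1 iu) (integZ mV _ (iphi 1))) => x Vx; rewrite /phi Pz; have [xy|xy] := pselect (ocube z r x).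
    rewrite ler_wpM2r ?bumpv_ge0//.
    have : `|u x - u z| <= eps.
      by apply: hr3 => i; apply: lt_le_trans (xy i) _; rewrite !ge_min lexx !orbT.
    by rewrite ler_norml lerBlDl => /andP[].
  by rewrite bumpv_eq0// !mulr0.
have As : A (- s0) <= c * J.
  rewrite -(Jphi (- s0) rngs) -(RintegralZl _ mV (iphi (- s0))).
  by apply: (le_Rintegral mV (imphi u (- s0) iu) (integZ mV _ (iphi (- s0)))) => x Vx; rewrite ler_wpM2r ?bumpv_ge0// uc.
exact: (contact_arith e0 s00 s01 J0 (mulr_ge0 m00 (sqr_ge0 _)) A0 A1 As ineq).
Qed.

End contact_quadratic.

(** * Cells of a polytopal mesh *)

Section mesh.
Context {R : realType} {n : nat}.
Local Notation E := 'rV[R]_n.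
Local Notation mu := (lebesgue_rV n : {measure set 'rV[R]_n -> \bar R}).
Variables (V : set E) (oV : open V) (bV : bounded_set V) (T : polytopal_mesh V).
Local Notation integ D f := (mu.-integrable D (EFin \o f)).
Implicit Types (K : mesh_cells T).

Let mV : measurable V. Proof. exact: open_rV_measurable. Qed.
Let Voo : (mu V < +oo)%E. Proof. exact: bounded_rV_finite. Qed.

Lemma measurable_cell K : measurable (cell K).
Proof. by apply: open_rV_measurable; exact: cell_open. Qed.

Lemma closed_hyperplane (a : E) b : closed (hyperplane a b).
Proof.
rewrite (_ : hyperplane a b = dotv a @^-1` [set b])//.
apply: preimage_closed => [x _|]; last exact: closed_eq.
have h : continuous (fun x : E => dotv a x).
  by apply: (@continuous_dotv _ _ (fun=> a) id) => i; [exact: cst_continuous|exact: continuous_coord].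
exact: h.
Qed.

(* Points of V outside all cells lie on cell boundaries, hence on the finitely
   many hyperplanes that carry the faces. *)
Lemma ae_cell : ae_on V (fun x => exists K, cell K x).
Proof.
have /choice[H hH] : forall s : mesh_faces T, exists p : E * R,
    p.1 != 0 /\ face s `<=` hyperplane p.1 p.2.
  move=> s; have [a [b [U [a0 _ ->]]]] := face_hyperplane s.
  by exists (a, b); split=> //; exact: subIsetr.
have null s : mu.-negligible (hyperplane (H s).1 (H s).2).
  apply/negligibleP; first exact: measurable_hyperplane.
  by apply: hyperplane_null; exact: (hH s).1.
have nullU : mu.-negligible (\big[setU/set0]_(s : mesh_faces T) hyperplane (H s).1 (H s).2).
  apply: big_ind => [|A B|s _]; [exact: negligible_set0|exact: negligibleU|exact: null].
apply: negligibleS nullU => x /= /not_implyP[Vx nK].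
have : closure V x by exact: subset_closure.
rewrite (cell_cover T) => -[K _ clK].
have bK : boundary (cell K) x.
  split=> //; move=> /interior_subset Kx; apply: nK; by exists K.
rewrite (cell_boundary K) in bK; case: bK => s _ clf.
rewrite -bigcup_seq; exists s => /=; first exact: mem_index_enum.
have := closure_subset (hH s).2 clf.
by move: x {Vx nK clK clf}; apply: closed_hyperplane.
Qed.

Lemma Rintegral_cells g : integ V g ->
  \int[mu]_(x in V) g x = \sum_(K : mesh_cells T) \int[mu]_(x in cell K) g x.
Proof.
move=> ig; have mg := integ_measurable ig.
have ind1 (K : mesh_cells T) x : V x -> `|(\1_(cell K) x : R)| <= 1.
  by move=> _; rewrite indicE; case: (_ \in _); rewrite ?normr1 ?normr0.
have iK (K : mesh_cells T) : integ V (fun x => g x * \1_(cell K) x).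
  apply: (integM mV ig _ (ind1 K)); apply: measurable_funTS.
  by apply: measurable_indic; exact: measurable_cell.
have eK (K : mesh_cells T) : \int[mu]_(x in cell K) g x = \int[mu]_(x in V) (g x * \1_(cell K) x).
  rewrite Rintegral_mkcond [RHS]Rintegral_mkcond; apply: eq_Rintegral => x _.
  rewrite /patch indicE; have [xK|xK] := boolP (x \in cell K).
    have -> : x \in V by rewrite inE; apply: (@cell_sub _ _ _ T K); rewrite inE in xK.
    by rewrite mulr1.
  by case: ifP => // _; rewrite mulr0.
under eq_bigr do rewrite eK.
rewrite -Rintegral_sum//; apply: ae_eq_Rintegral => //.
  by apply: measurable_sum => K; exact: integ_measurable (iK K).
apply: ae_onS ae_cell => x Vx [K Kx].
rewrite (bigD1 K)//= indicE mem_set// mulr1 big1 ?addr0// => L LK.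
rewrite indicE memNset ?mulr0// => Lx; move/negP: LK; apply; apply/eqP.
by have /(_ L K I I) := @cell_disjoint _ _ _ T; apply; exists x.
Qed.

Lemma enorm_diam K x y : cell K x -> cell K y -> enorm (x - y) <= diam (cell K).
Proof.
move=> Kx Ky; apply: ub_le_sup; last by exists x => //; exists y.
have [r r0 hr] := bounded_rVP bV.
exists (\sum_(i < n) (r + r)) => _ [a Ka [b Kb <-]].
apply: le_trans (enorm_le_sum _) _; apply: ler_sum => i _; rewrite !mxE.
have := hr _ (@cell_sub _ _ _ T K _ Ka) i; have := hr _ (@cell_sub _ _ _ T K _ Kb) i.
rewrite !mxE !subr0 => h1 h2.
by rewrite (le_trans (ler_normB _ _))// lerD// ltW.
Qed.

Lemma diam_ge0 K : 0 <= diam (cell K).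
Proof.
have [x Kx] := cell_neq0 K; apply: le_trans (enorm_diam Kx Kx).
exact: enorm_ge0.
Qed.

Lemma diam_le_size K : diam (cell K) <= mesh_size T.
Proof.
apply: ub_le_sup; last by exists K.
exists (\sum_(L : mesh_cells T) diam (cell L)) => _ [L _ <-].
rewrite (bigD1 L)//= lerDl; apply: sumr_ge0 => M _; exact: diam_ge0.
Qed.

Lemma mesh_size_ge0 : 0 <= mesh_size T.
Proof.
have [K|h] := pickP (fun _ : mesh_cells T => true).
  by move=> _; apply: le_trans (diam_le_size K); exact: diam_ge0.
rewrite /mesh_size (_ : range (fun K : mesh_cells T => diam (cell K)) = set0) ?sup0//.
by rewrite -subset0 => x [K]; have := h K.
Qed.

(** [cell_star] leaves out the far end of the segment, here y itself, hence the separate case t = 0.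
    Omega need not be convex: this keeps the segment from y to the cell point inside it. *)
Lemma cell_segment K y t : cell K y -> 0 <= t <= 1 ->
  cell K (y + t *: (cell_point K - y)).
Proof.
move=> Ky /andP[t0 t1]; have [->|tn0] := eqVneq t 0; first by rewrite scale0r addr0.
rewrite (_ : y + _ = cell_point K + (1 - t) *: (y - cell_point K)).
  apply: cell_star; first exact: subset_closure.
  by rewrite subr_ge0 t1 ltrBlDr ltrDl lt_neqAle eq_sym tn0.
by apply/rowP => i; rewrite !mxE; ring.
Qed.

Lemma L2_sub (U : set E) g : measurable U -> U `<=` V -> L2 V g -> L2 U g.
Proof.
move=> mU UV /(L2P mV)[mg ig]; apply/(L2P mU); split; first exact: measurable_funS mg.
exact: integrableS ig.
Qed.

End mesh.

(** * The multiplier term, cell by cell *)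

Section contact_error.
Context {R : realType} {n : nat}.
Local Notation E := 'rV[R]_n.
Local Notation mu := (lebesgue_rV n : {measure set 'rV[R]_n -> \bar R}).
Variables (V : set E) (oV : open V) (bV : bounded_set V).

Let mV : measurable V. Proof. exact: open_rV_measurable. Qed.
Let Voo : (mu V < +oo)%E. Proof. exact: bounded_rV_finite. Qed.

(** The part of V where c < u is open, and a nonempty open set is not null. The everywhere bound is
    needed at single points such as [cell_point K]. *)
Lemma ae_le_continuous (u : E -> R) c : {in V, continuous u} ->
  ae_on V (fun x => u x <= c) -> forall x, V x -> u x <= c.
Proof.
move=> cu [N [mN N0 hN]] x Vx; rewrite leNgt; apply/negP => ux.
pose U := V `&` [set x | c < u x].
have oU : open U.
  rewrite openE => z [Vz zc]; rewrite /interior; apply: filterI.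
    exact: open_nbhs_nbhs.
  have cuz : {for z, continuous u} by apply: cu; rewrite inE.
  by apply: (cuz [set y | c < y]); exact: lt_nbhsr.
have UN : U `<=` N.
  by move=> z [Vz /= zc]; apply: hN => /= /(_ Vz); rewrite leNgt zc.
have : (lebesgue_rV n U <= 0)%E.
  rewrite -[X in (_ <= X)%E]N0; apply: le_measure; rewrite ?inE//.
  exact: open_rV_measurable.
by apply/negP; rewrite -ltNge; apply: open_rV_gt0 => //; exists x.
Qed.

(* On a cell without contact the multiplier m vanishes; on a cell with a contact
   point, the obstacle is within O(h^2) of u at the cell point. *)
Lemma contact_error_le (T : polytopal_mesh V) (u f m p : E -> R) (c C2 M : R) :
  L2 V f -> L2 V m -> L2 V p ->
  ae_on V (fun x => 0 <= m x) -> ae_on V (fun x => u x < c -> m x = 0) ->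
  ae_on V (fun x => `|m x| <= `|f x|) -> (forall x, V x -> u x <= c) -> 0 <= M ->
  (forall y z, V y -> u y = c ->
    (forall t, 0 <= t <= 1 -> V (y + t *: (z - y))) -> c - u z <= M * enorm (z - y) ^+ 2) ->
  (forall K : mesh_cells T, L2norm (cell K) (fun x => p x - u (cell_point K)) <=
     C2 * diam (cell K) ^+ 2 * Num.sqrt (fine (lebesgue_rV n (cell K)))) ->
  \int[mu]_(x in V) (m x * (c - p x)) <=
   (M + `|C2|) * ((\int[mu]_(x in V) (f x ^+ 2) + fine (mu V)) / 2) * mesh_size T ^+ 2.
Proof.
move=> hf hm hp m0 mc mf uc M0 quad interp.
have hcp : L2 V (fun x => c - p x) by apply: L2B => //; exact: L2_cst.
rewrite (Rintegral_cells oV T); last exact: L2_integM.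
have i1 : mu.-integrable V (EFin \o (fun _ : E => 1 : R)) by apply: L2_integ => //; exact: L2_cst.
have volE : fine (mu V) = \sum_(K : mesh_cells T) fine (mu (cell K)).
  have := Rintegral_cells oV T i1; rewrite Rintegral_cst// mul1r => ->.
  by apply: eq_bigr => K _; rewrite Rintegral_cst ?mul1r//; exact: measurable_cell.
rewrite volE (Rintegral_cells oV T (L2_sqr mV hf)) -big_split/=.
rewrite mulr_suml mulr_sumr mulr_suml; apply: ler_sum => K _.
have mK := measurable_cell K; have KV := @cell_sub _ _ _ T K.
have Koo : (mu (cell K) < +oo)%E.
  by apply: le_lt_trans Voo; apply: le_measure; rewrite ?inE.
have fK := L2_sub oV mK KV hf; have mmK := L2_sub oV mK KV hm.
have pK := L2_sub oV mK KV hp; have cpK := L2_sub oV mK KV hcp.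
have aeK (P : E -> Prop) : ae_on V P -> ae_on (cell K) P.
  by rewrite /ae_on; apply: filterS => x h Kx; apply: h; exact: KV.
set vol := fine (mu (cell K)).
have vol0 : 0 <= vol by rewrite fine_ge0.
set F2 := \int[mu]_(x in cell K) (f x ^+ 2).
have F20 : 0 <= F2 by apply: Rintegral_ge0 => x _; exact: sqr_ge0.
have size2 : diam (cell K) ^+ 2 <= mesh_size T ^+ 2.
  by rewrite lerXn2r ?nnegrE ?diam_ge0 ?mesh_size_ge0// diam_le_size.
have MC : 0 <= M + `|C2| by rewrite addr_ge0.
apply: (@le_trans _ _ ((M + `|C2|) * ((F2 + vol) / 2) * diam (cell K) ^+ 2)); last first.
  by rewrite ler_wpM2l// mulr_ge0// divr_ge0// addr_ge0.
have [[y Ky uy]|noc] := pselect (exists2 y, cell K y & u y = c); last first.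
  rewrite (@ae_eq_Rintegral _ _ _ mu _ mK _ (fun=> 0)); first last.
  - apply: ae_onS (aeK _ mc) => x Kx h; rewrite h ?mul0r// lt_neqAle uc ?andbT//; last exact: KV.
    by apply/negP => /eqP ux; apply: noc; exists x.
  - exact: measurable_cst.
  - by apply: measurable_funM; [exact: (L2_measurable mK)|exact: (L2_measurable mK)].
  rewrite /Rintegral integral0/=; apply: mulr_ge0; last exact: sqr_ge0.
  by rewrite mulr_ge0// divr_ge0// addr_ge0.
set xK := cell_point K; set d := diam (cell K).
have uxc : u xK <= c by apply/uc/KV; exact: cell_point_in.
have near : c - u xK <= M * d ^+ 2.
  apply: le_trans (quad y xK (KV _ Ky) uy _) _.
    by move=> t ht; apply: KV; exact: cell_segment.
  rewrite ler_wpM2l// lerXn2r ?nnegrE ?enorm_ge0 ?diam_ge0//.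
  by apply: (enorm_diam bV) => //; exact: cell_point_in.
have m2F : \int[mu]_(x in cell K) (m x ^+ 2) <= F2.
  apply: ae_le_Rintegral => //; [exact: L2_sqr..|].
  apply: ae_onS (aeK _ mf) => x _ h.
  rewrite -[m x ^+ 2]real_normK ?num_real// -[f x ^+ 2]real_normK ?num_real//.
  by rewrite lerXn2r ?nnegrE ?normr_ge0.
have ioneK : mu.-integrable (cell K) (EFin \o (fun _ : E => 1 : R)).
  by apply: L2_integ => //; exact: L2_cst.
have imK := L2_integ mK Koo mmK.
(* From m <= |f| <= (f^2 + 1) / 2: in this form the bounds add up over the cells to the integral of
   f^2 plus the volume. *)
have int1 : \int[mu]_(x in cell K) m x <= (F2 + vol) / 2.
  have -> : (F2 + vol) / 2 = \int[mu]_(x in cell K) (2^-1 * (f x ^+ 2 + 1)).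
    rewrite RintegralZl//; last by apply: integD => //; exact: L2_sqr.
    rewrite RintegralD//; last exact: L2_sqr.
    by rewrite Rintegral_cst// mul1r mulrC.
  apply: ae_le_Rintegral => //.
    by apply: integZ => //; apply: integD => //; exact: L2_sqr.
  apply: ae_onS (aeK _ mf) => x _ h.
  have := ler_norm (m x); have := sqr_ge0 (`|f x| - 1).
  by rewrite -[f x ^+ 2]real_normK ?num_real//; lra.
have int0 : 0 <= \int[mu]_(x in cell K) m x by apply: ae_ge0_Rintegral => //; exact: aeK.
have hpu : L2 (cell K) (fun x => p x - u xK) by apply: L2B => //; exact: L2_cst.
(* The value of u at the cell point is inserted between c and [p]: the gap to c is quadratic in the
   diameter, the gap to [p] is the interpolation hypothesis. *)
have eq1 : \int[mu]_(x in cell K) (m x * (c - p x)) =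
    (c - u xK) * \int[mu]_(x in cell K) m x - \int[mu]_(x in cell K) (m x * (p x - u xK)).
  rewrite -RintegralZl// -RintegralB//; [|exact: integZ|exact: L2_integM].
  by apply: eq_Rintegral => x _; ring.
have cs := L2_CS mK mmK hpu.
(* The factor sqrt |K| of the interpolation bound is paired with the norm of m by 2 a b <= a^2 +
   b^2, which yields the same cell quantity as before. *)
have cs2 : L2norm (cell K) m * L2norm (cell K) (fun x => p x - u xK) <=
    `|C2| * d ^+ 2 * ((F2 + vol) / 2).
  apply: (@le_trans _ _ (L2norm (cell K) m * (`|C2| * d ^+ 2 * Num.sqrt vol))).
    rewrite ler_wpM2l ?L2norm_ge0//; apply: le_trans (interp K) _.
    by rewrite ler_wpM2r ?sqrtr_ge0// ler_wpM2r ?sqr_ge0// ler_norm.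
  rewrite mulrCA; apply: ler_wpM2l; first by rewrite mulr_ge0// sqr_ge0.
  have := sqr_ge0 (L2norm (cell K) m - Num.sqrt vol).
  by rewrite sqrrB (L2norm_sqr mK mmK) sqr_sqrtr//; lra.
have p1 : (c - u xK) * \int[mu]_(x in cell K) m x <= M * d ^+ 2 * ((F2 + vol) / 2).
  by apply: ler_pM => //; rewrite subr_ge0.
move: cs; rewrite ler_norml => /andP[cs _].
by rewrite eq1; lra.
Qed.

End contact_error.

(** * Error estimate for the gradient scheme *)

Section scheme.
Context {R : realType} {n : nat}.
Local Notation E := 'rV[R]_n.
Local Notation mu := (lebesgue_rV n : {measure set 'rV[R]_n -> \bar R}).
Variables (V : set E) (oV : open V) (bV : bounded_set V).

Let mV : measurable V. Proof. exact: open_rV_measurable. Qed.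
Let Voo : (mu V < +oo)%E. Proof. exact: bounded_rV_finite. Qed.

Lemma L2_le_ae (u v : E -> R) : L2 V v -> measurable_fun V u ->
  ae_on V (fun x => `|u x| <= `|v x|) -> L2 V u.
Proof.
move=> hv mu_ uv; apply/(L2P mV); split=> //.
have iv := L2_sqr mV hv; have mv := L2_measurable mV hv.
apply/integrableP; split; first by apply/measurable_EFinP; exact: measurable_funX.
have /integrableP[_] := iv; apply: le_lt_trans.
apply: ae_ge0_le_integral => //.
- by apply: measurableT_comp => //; apply/measurable_EFinP; exact: measurable_funX.
- by apply: measurableT_comp => //; apply/measurable_EFinP; exact: measurable_funX.
apply: ae_onS uv => x _ h /=; rewrite lee_fin !normrX.
by rewrite lerXn2r ?nnegrE ?normr_ge0.
Qed.

Section tensor.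
Variables (Lambda : E -> 'M[R]_n) (lmin lmax : R).
Hypothesis lmin0 : 0 < lmin.
Hypothesis lmax0 : 0 < lmax.
Hypothesis adm : admissible_tensor V Lambda lmin lmax.

Lemma tensor_L2v F : L2v V F -> L2v V (fun x => mulmv (Lambda x) (F x)).
Proof.
move=> hF; have [mL aeL] := adm.
have mF i : measurable_fun V (fun x => mulmv (Lambda x) (F x) ord0 i).
  under eq_fun do rewrite mulmv_coord.
  apply: measurable_sum => j; apply: measurable_funM; first exact: mL.
  exact: (L2_measurable mV (hF j)).
move=> i; apply: (L2_le_ae (L2Z mV lmax (L2v_enorm mV hF)) (mF i)).
apply: ae_onS aeL => x _ [sM eM].
rewrite (le_trans (coord_le_enorm _ _))// (le_trans (enorm_mulmv lmin0 sM eM _))//.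
exact: ler_norm.
Qed.

Lemma tensor_coercive F : L2v V F ->
  lmin * L2normv V F ^+ 2 <= \int[mu]_(x in V) dotv (mulmv (Lambda x) (F x)) (F x).
Proof.
move=> hF; rewrite L2normv_sqr// -RintegralZl//; last exact: L2_dotv.
apply: ae_le_Rintegral => //; first by apply: integZ => //; exact: L2_dotv.
  by apply: L2_dotv => //; exact: tensor_L2v.
by apply: ae_onS adm.2 => x _ [sM eM]; exact: dotv_mulmv_ge eM _.
Qed.

Lemma tensor_continuous F G : L2v V F -> L2v V G ->
  \int[mu]_(x in V) dotv (mulmv (Lambda x) (F x)) (G x) <=
    lmax * (L2normv V F * L2normv V G).
Proof.
move=> hF hG; have hL := tensor_L2v hF.
apply: le_trans (ler_norm _) _; apply: le_trans (L2v_CS mV hL hG) _.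
rewrite mulrA ler_wpM2r ?L2normv_ge0//.
rewrite -[X in X * _](ger0_norm (ltW lmax0)) -(L2normZ mV); last exact: L2v_enorm.
apply: L2norm_le => //; [exact: L2v_enorm|by apply: L2Z => //; exact: L2v_enorm|].
apply: ae_onS adm.2 => x _ [sM eM].
rewrite ger0_norm ?enorm_ge0// (le_trans (enorm_mulmv lmin0 sM eM _))//.
exact: ler_norm.
Qed.

End tensor.

Variable D : gradient_discretisation V.
Local Notation X := (gd_space D).
Local Notation Pi := (@gd_Pi _ _ _ D).
Local Notation nabla := (@gd_grad _ _ _ D).

Lemma gd_PiB (v w : X) : ae_on V (fun x => Pi (v - w) x = Pi v x - Pi w x).
Proof.
apply: ae_onS (gd_Pi_linear (-1) w v) => x _.
by rewrite scaleN1r addrC => ->; rewrite mulN1r addrC.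
Qed.

Lemma gd_gradB (v w : X) : ae_on V (fun x => nabla (v - w) x = nabla v x - nabla w x).
Proof.
apply: ae_onS (gd_grad_linear (-1) w v) => x _.
by rewrite scaleN1r addrC => ->; rewrite scaleN1r addrC.
Qed.

Lemma gd_Pi0 : ae_on V (fun x => Pi 0 x = 0).
Proof. by apply: ae_onS (gd_PiB 0 0) => x _; rewrite !subrr. Qed.

Lemma gd_norm_gt0 (v : X) : v != 0 -> 0 < L2normv V (nabla v).
Proof.
move=> v0; rewrite lt_neqAle L2normv_ge0 andbT eq_sym; apply: contra v0 => /eqP h.
by have [/(_ v h) ->] := gd_norm D.
Qed.

Lemma gd_norm0 : L2normv V (nabla 0) = 0.
Proof. by have [_ /(_ 0 0)] := gd_norm D; rewrite scale0r normr0 mul0r. Qed.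

(** The absolute value of M is taken because [C_D] is -oo on the trivial space and then allows M <
    0. The vector v = 0 is outside the supremum and is treated by linearity, which holds almost
    everywhere. *)
Lemma Pi_le_nabla (M : R) (v : X) : (C_D D <= M%:E)%E ->
  L2norm V (Pi v) <= `|M| * L2normv V (nabla v).
Proof.
move=> CM; have [->|v0] := eqVneq v 0.
  rewrite gd_norm0 mulr0.
  apply: le_trans (_ : L2norm V (fun=> 0) <= 0).
    apply: L2norm_le => //; [exact: gd_Pi_L2|exact: L2_cst|].
    by apply: ae_onS gd_Pi0 => x _ ->.
  apply: L2norm_le_sqr => //; first exact: L2_cst.
  by rewrite expr0n /Rintegral integral0.
have N0 := gd_norm_gt0 v0.
rewrite -ler_pdivrMr// (le_trans _ (ler_norm _))// -lee_fin.
by apply: le_trans CM; apply: ereal_sup_ubound; exists v.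
Qed.

Lemma W_D_set_ge0 psi divpsi (r : R) :
  [set (L2normv V (nabla v))^-1 * `|\int[mu]_(x in V)
     (dotv (nabla v x) (psi x) + Pi v x * divpsi x)| | v in [set v : X | v != 0]] r -> 0 <= r.
Proof. by move=> [v _ <-]; rewrite mulr_ge0// invr_ge0 L2normv_ge0. Qed.

Lemma W_D_ge0 psi divpsi : 0 <= W_D D psi divpsi.
Proof.
rewrite /W_D; set S := [set _ | _ in _].
have [hS|/sup_out -> //] := pselect (has_sup S).
have [[r Sr] _] := hS.
by apply: le_trans (W_D_set_ge0 Sr) _; apply: ub_le_sup => //; case: hS.
Qed.

(** A real [sup] dominates the elements of its set only if that set is bounded above; Cauchy-Schwarz
    and the bound on [C_D] provide this. *)
Lemma W_D_bound (M : R) psi divpsi (v : X) : (C_D D <= M%:E)%E ->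
  L2v V psi -> L2 V divpsi ->
  \int[mu]_(x in V) dotv (nabla v x) (psi x) + \int[mu]_(x in V) (Pi v x * divpsi x) <=
    W_D D psi divpsi * L2normv V (nabla v).
Proof.
move=> CM hpsi hdiv.
have split_int w : \int[mu]_(x in V) (dotv (nabla w x) (psi x) + Pi w x * divpsi x) =
    \int[mu]_(x in V) dotv (nabla w x) (psi x) + \int[mu]_(x in V) (Pi w x * divpsi x).
  rewrite RintegralD//; first exact: L2_dotv (gd_grad_L2 _) hpsi.
  exact: L2_integM (gd_Pi_L2 _) hdiv.
have bound w : `|\int[mu]_(x in V) (dotv (nabla w x) (psi x) + Pi w x * divpsi x)| <=
    (L2normv V psi + `|M| * L2norm V divpsi) * L2normv V (nabla w).
  rewrite split_int (le_trans (ler_normD _ _))// mulrDl lerD//.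
    by rewrite mulrC; exact: L2v_CS (gd_grad_L2 _) hpsi.
  apply: le_trans (L2_CS mV (gd_Pi_L2 w) hdiv) _.
  by rewrite mulrAC ler_wpM2r ?L2norm_ge0// Pi_le_nabla.
rewrite -split_int; apply: le_trans (ler_norm _) _.
have [->|v0] := eqVneq v 0.
  by apply: le_trans (bound 0) _; rewrite gd_norm0 !mulr0.
have N0 := gd_norm_gt0 v0.
rewrite -ler_pdivrMr// mulrC; apply: ub_le_sup; last by exists v.
exists (L2normv V psi + `|M| * L2norm V divpsi) => _ [w w0 <-].
by rewrite mulrC ler_pdivrMr ?gd_norm_gt0.
Qed.

(** With r = P / a, x > r + Q would give x (x - r) > Q x >= Q^2. A bound linear in Q is what turns
    an O(h^2) multiplier term into an O(h) error. *)
Lemma quadratic_bound (a P Q x : R) : 0 < a -> 0 <= P -> 0 <= Q -> 0 <= x ->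
  a * x ^+ 2 <= P * x + a * Q ^+ 2 -> x <= P / a + Q.
Proof.
move=> a0 P0 Q0 x0 h; rewrite leNgt; apply/negP => lt.
set r := P / a in lt; have r0 : 0 <= r by rewrite divr_ge0// ltW.
have Pe : P = a * r by rewrite /r mulrC mulfVK// gt_eqF.
move: h; rewrite Pe leNgt => /negP; apply.
rewrite -mulrA -mulrDr ltr_pM2l//.
have h1 : 0 < (x - r - Q) * x by apply: mulr_gt0; lra.
have h2 : 0 <= Q * (x - Q) by apply: mulr_ge0; lra.
by lra.
Qed.

Lemma scheme_energy (Lambda : E -> 'M[R]_n) (lmin lmax M : R) f w (F : E -> E) (u v : X) :
  0 < lmin -> 0 < lmax -> admissible_tensor V Lambda lmin lmax -> (C_D D <= M%:E)%E ->
  L2 V f -> L2v V F -> L2 V w ->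
  \int[mu]_(x in V) dotv (mulmv (Lambda x) (nabla u x)) (nabla (u - v) x) <=
    \int[mu]_(x in V) (f x * Pi (u - v) x) ->
  lmin * L2normv V (nabla (v - u)) ^+ 2 <=
    (lmax * L2normv V (fun x => nabla v x - F x) + W_D D (fun x => mulmv (Lambda x) (F x)) w) *
      L2normv V (nabla (v - u)) +
    \int[mu]_(x in V) ((f x + w x) * (Pi u x - Pi v x)).
Proof.
move=> lmin0 lmax0 adm CM hf hF hw scheme.
have hu := gd_grad_L2 u; have hv := gd_grad_L2 v.
have hvu := gd_grad_L2 (v - u); have huv := gd_grad_L2 (u - v).
have hvF : L2v V (fun x => nabla v x - F x) := L2vB mV hv hF.
have tL G := @tensor_L2v _ _ _ lmin0 adm G.
set A := fun x => mulmv (Lambda x) (F x).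
have i1 := L2_dotv mV (tL _ hvF) hvu.
have i2 := L2_dotv mV hvu (tL _ hF).
have i3 := L2_dotv mV (tL _ hu) huv.
have j1 := L2_integM mV hf (gd_Pi_L2 (u - v)).
have j2 := L2_integM mV (gd_Pi_L2 (v - u)) hw.
have hfw := L2D mV hf hw.
have hPi := L2B mV (gd_Pi_L2 u) (gd_Pi_L2 v).
(* Pointwise, Lambda (grad v - grad u) = Lambda (grad v - F) + Lambda F - Lambda grad u:
   interpolation error, consistency defect, and the term that the scheme controls. *)
have eqI : \int[mu]_(x in V) dotv (mulmv (Lambda x) (nabla (v - u) x)) (nabla (v - u) x) <=
    \int[mu]_(x in V) (dotv (mulmv (Lambda x) (nabla v x - F x)) (nabla (v - u) x) +
      dotv (nabla (v - u) x) (A x) +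
      dotv (mulmv (Lambda x) (nabla u x)) (nabla (u - v) x)).
  apply: ae_le_Rintegral => //; first exact: L2_dotv (tL _ hvu) hvu.
    by apply: integD => //; exact: integD.
  apply: ae_onS (ae_onI (gd_gradB v u) (gd_gradB u v)) => x _ [-> ->].
  rewrite -[nabla u x - _]opprB dotvNr (dotvC _ (A x)) /A /mulmv.
  rewrite !mulmxBl !dotvBl !dotvBr; lra.
rewrite RintegralD// in eqI; last exact: integD.
rewrite RintegralD// in eqI.
(* The divergence part of the defect contributes w (Pi u - Pi v), which joins the right-hand side f
   of the scheme to form the multiplier f + w. *)
have eqJ : \int[mu]_(x in V) (f x * Pi (u - v) x) - \int[mu]_(x in V) (Pi (v - u) x * w x) <=
    \int[mu]_(x in V) ((f x + w x) * (Pi u x - Pi v x)).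
  rewrite -RintegralB//; apply: ae_le_Rintegral => //; first exact: integB.
    exact: L2_integM hfw hPi.
  apply: ae_onS (ae_onI (gd_PiB v u) (gd_PiB u v)) => x _ [-> ->]; lra.
have t1 := tensor_coercive lmin0 adm hvu.
have t2 := tensor_continuous lmin0 lmax0 adm hvF hvu.
have t3 := W_D_bound (v - u) CM (tL _ hF) hw.
rewrite mulrDl -mulrA.
move: t1 t2 t3 eqI eqJ scheme; clear; lra.
Qed.

Lemma scheme_error (M : R) (p : E -> R) (F : E -> E) (u v : X) : (C_D D <= M%:E)%E ->
  L2 V p -> L2v V F ->
  L2normv V (fun x => nabla u x - F x) + L2norm V (fun x => Pi u x - p x) <=
    (1 + `|M|) * L2normv V (nabla (v - u)) + S_D D p F v.
Proof.
move=> CM hp hF; have hu := gd_grad_L2 u; have hv := gd_grad_L2 v.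
have hvu := gd_grad_L2 (v - u).
have Pu := gd_Pi_L2 u; have Pv := gd_Pi_L2 v; have Pvu := gd_Pi_L2 (v - u).
have b1 : L2normv V (fun x => nabla u x - F x) <=
    L2normv V (nabla (v - u)) + L2normv V (fun x => nabla v x - F x).
  rewrite -(L2normvN _ (nabla (v - u))).
  apply: le_trans (L2normvD mV (L2vN mV hvu) (L2vB mV hv hF)).
  rewrite le_eqVlt; apply/orP; left; apply/eqP; apply: L2normv_ae => //.
  - exact: L2vB.
  - by apply: L2vD => //; [exact: L2vN|exact: L2vB].
  apply: ae_onS (gd_gradB v u) => x _ ->.
  by rewrite opprB addrA subrK.
have b2 : L2norm V (fun x => Pi u x - p x) <=
    L2norm V (Pi (v - u)) + L2norm V (fun x => Pi v x - p x).
  rewrite -(L2normN mV Pvu).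
  apply: le_trans (L2normD mV (L2N mV Pvu) (L2B mV Pv hp)).
  rewrite le_eqVlt; apply/orP; left; apply/eqP; apply: L2norm_ae => //.
  - exact: L2B.
  - by apply: L2D => //; [exact: L2N|exact: L2B].
  apply: ae_onS (gd_PiB v u) => x _ ->.
  by rewrite opprB addrA subrK.
have b3 := Pi_le_nabla (v - u) CM.
rewrite /S_D; move: b1 b2 b3; clear; lra.
Qed.

End scheme.

Theorem theorem2p13 (R : realType) (d : nat) (Omega : set 'rV[R]_d)
    (lmin lmax C1 C2 CDmax : R) (f ubar : 'rV[R]_d -> R) :
  (0 < d)%N -> open Omega -> bounded_set Omega -> connected Omega ->
  polytopal Omega -> lipschitz_boundary Omega ->
  0 < lmin -> 0 < lmax ->
  L2 Omega f ->
  {in Omega, continuous ubar} -> W2infty Omega ubar ->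
  exists C : R,
  forall (Lambda : 'rV[R]_d -> 'M[R]_d) (g : 'rV[R]_d -> R)
    (D : gradient_discretisation Omega) (T : polytopal_mesh Omega)
    (gradubar : 'rV[R]_d -> 'rV[R]_d) (divflux : 'rV[R]_d -> R)
    (u : gd_space D),
  let flux := fun x => mulmv (Lambda x) (gradubar x) in
  admissible_tensor Omega Lambda lmin lmax ->
  L2 Omega g ->
  (exists c : R, ae_on Omega (fun x => g x = c)) ->
  K_D D g !=set0 ->
  weak_solution Omega Lambda f g ubar gradubar ->
  scheme_solution D Lambda f g u ->
  Hdiv Omega flux divflux ->
  (C_D D <= CDmax%:E)%E ->
  (exists vD : gd_space D,
    [/\ K_D D g vD,
        S_D D ubar gradubar vD <= C1 * mesh_size T &
        forall K : mesh_cells T,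
          L2norm (cell K) (fun x => gd_Pi vD x - ubar (cell_point K)) <=
          C2 * diam (cell K) ^+ 2
             * Num.sqrt (fine (lebesgue_rV d (cell K)))]) ->
  L2normv Omega (fun x => gd_grad u x - gradubar x) +
    L2norm Omega (fun x => gd_Pi u x - ubar x) <=
  C * mesh_size T + C * W_D D flux divflux.
Proof.
move=> _ oV bV _ _ _ lmin0 lmax0 hf cu W2.
have mV := open_rV_measurable oV; have Voo := bounded_rV_finite mV bV.
have [M M0 quad] := contact_quadratic oV bV W2 cu.
pose C3 := (M + `|C2|) * ((\int[lebesgue_rV d]_(x in Omega) (f x ^+ 2) +
   fine (lebesgue_rV d Omega)) / 2).
have C30 : 0 <= C3.
  rewrite mulr_ge0 ?addr_ge0// divr_ge0// addr_ge0 ?fine_ge0//.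
  by apply: integral_ge0 => x _; rewrite lee_fin sqr_ge0.
(* Chosen so that lmin (Q h)^2 is the bound C3 h^2 of the multiplier term, the form that
   [quadratic_bound] takes. *)
pose Q := Num.sqrt (C3 / lmin).
have Q0 : 0 <= Q by exact: sqrtr_ge0.
have QE : lmin * Q ^+ 2 = C3.
  by rewrite sqr_sqrtr ?divr_ge0 ?(ltW lmin0)// mulrC mulfVK// gt_eqF.
pose B := 1 + `|CDmax|.
have B0 : 0 <= B by rewrite addr_ge0.
(* Read off from B delta + S_D, where delta <= (lmax |C1| h + W) / lmin + Q h and S_D <= |C1| h. In
   B, the 1 is for gradients and |CDmax| for their reconstructions; |C1| keeps [Ch] nonnegative. *)
pose Ch := B * (lmax * `|C1| / lmin + Q) + `|C1|.
pose CW := B / lmin.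
have Ch0 : 0 <= Ch.
  by rewrite addr_ge0// mulr_ge0// addr_ge0// divr_ge0 ?mulr_ge0// ltW.
have CW0 : 0 <= CW by rewrite divr_ge0// ltW.
exists (Ch + CW) => Lambda g D T G w u flux adm hg [c gc] _ [[uG ug] VI] [uK scheme] Fw CM
  [v [vK vS interp]].
have [[hu hG _] _] := uG; have [hF hw _] := Fw.
have ucae : ae_on Omega (fun x => ubar x <= c).
  by apply: ae_onS (ae_onI ug gc) => x _ [h <-].
have uc := ae_le_continuous oV cu ucae.
have VIc z Gz : H10 Omega z Gz -> ae_on Omega (fun x => z x <= c) ->
    \int[lebesgue_rV d]_(x in Omega) dotv (flux x) (G x - Gz x) <=
    \int[lebesgue_rV d]_(x in Omega) (f x * (ubar x - z x)).
  move=> zG zc; apply: VI; split=> //.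
  by apply: ae_onS (ae_onI zc gc) => x _ [h ->].
have m0 := multiplier_ge0 oV bV uG hf Fw ucae VIc.
have mc := multiplier_eq0 oV bV uG hf Fw ucae VIc cu.
have G0 := gradient_contact_eq0 oV bV c uG.
have FG0 : ae_on Omega (fun x => 0 <= dotv (flux x) (G x)).
  apply: ae_onS adm.2 => x _ [sM eM].
  by apply: le_trans (dotv_mulmv_ge sM eM _); rewrite mulr_ge0 ?dotv_ge0// ltW.
have F0 : ae_on Omega (fun x => ubar x = c -> flux x = 0).
  by apply: ae_onS G0 => x _ h /h; rewrite /flux => ->; rewrite /mulmv mul0mx.
have w0 := div_contact_le0 oV bV uG Fw FG0 F0 ucae.
have mf : ae_on Omega (fun x => `|f x + w x| <= `|f x|).
  apply: ae_onS (ae_onI m0 (ae_onI mc w0)) => x Vx [h1 [h2 h3]].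
  have := uc x Vx; rewrite le_eqVlt => /orP[/eqP/h3 h|/h2 ->]; last by rewrite normr0.
  by rewrite ger0_norm// (le_trans _ (ler_norm _))// gerDl.
have hm : L2 Omega (fun x => f x + w x) by exact: L2D.
have err := contact_error_le oV bV hf hm (gd_Pi_L2 v) m0 mc mf uc M0
  (fun y z Vy uy => quad c y z uc Vy uy) interp.
set h := mesh_size T in vS err *; have h0 : 0 <= h := mesh_size_ge0 bV T.
have W0 := W_D_ge0 D flux w.
have energy := scheme_energy oV bV lmin0 lmax0 adm CM hf hG hw (scheme v vK).
have total := scheme_error oV bV u v CM hu hG.
rewrite -/flux in energy; set W := W_D D flux w in energy W0 *.
set dlt := L2normv Omega _ in energy total.
have dlt0 : 0 <= dlt := L2normv_ge0 _ _.
have S1 : L2normv Omega (fun x => gd_grad v x - G x) <= `|C1| * h.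
  rewrite (le_trans _ (le_trans vS _))// ?lerDr ?L2norm_ge0//.
  by rewrite ler_wpM2r// ler_norm.
have mult : \int[lebesgue_rV d]_(x in Omega) ((f x + w x) * (gd_Pi u x - gd_Pi v x)) <=
    C3 * h ^+ 2.
  apply: le_trans err; apply: ae_le_Rintegral => //.
  - by apply: L2_integM => //; apply: L2B => //; exact: gd_Pi_L2.
  - by apply: L2_integM => //; apply: L2B; [|exact: L2_cst|exact: gd_Pi_L2].
  apply: ae_onS (ae_onI m0 (ae_onI uK gc)) => x _ [m0x [uKx <-]].
  by rewrite ler_wpM2l// lerB.
have dltle : dlt <= (lmax * (`|C1| * h) + W) / lmin + Q * h.
  apply: quadratic_bound => //; [|exact: mulr_ge0|].
    by rewrite addr_ge0// !mulr_ge0// ltW.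
  rewrite exprMn (mulrA lmin (Q ^+ 2)) QE; apply: le_trans energy _.
  by rewrite lerD// ler_wpM2r// lerD2r ler_wpM2l// ltW.
apply: le_trans total _.
have : B * dlt + S_D D ubar G v <= Ch * h + CW * W.
  have -> : Ch * h + CW * W = B * ((lmax * (`|C1| * h) + W) / lmin + Q * h) + `|C1| * h.
    by rewrite /Ch /CW; ring.
  rewrite lerD ?ler_wpM2l// (le_trans vS)// ler_wpM2r// ler_norm//.
move=> /le_trans; apply.
by rewrite lerD// ler_wpM2r// ?lerDl ?lerDr.
Qed.
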